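(* (Gårding inequality.) Let $p_+(x,\xi)$ be a positive symbol, even in the $\xi$ variable, such that $p_+^{1/2}\in\mathcal{S}_{1,1}\cap\mathcal{S}_{2,0}$ and $$\sup_\xi\left(\|\partial_x\partial_\xi p_+^{1/2}(\cdot,\xi)\|_{H^{-\varepsilon}}+\|\partial_x\partial_\xi p_+^{1/2}(\cdot,\xi)\|_{H^{1+\varepsilon}}\right)<\infty$$ for some $\varepsilon>0$, and let $f\in L^2(\mathbb{R})$. Then $$-\int_{\mathbb{R}}f\,\mathrm{Op}(p_+)f\,dx\le C\left(|||\mathfrak{C}(p_+^{1/2},p_+^{1/2})|||+\|p_+^{1/2}\|_{1,1}\,|||\mathrm{Op}(p_+^{1/2})^{skew}|||\right)\|f\|_{L^2}^2.$$
   Context: Functions are real valued. For a symbol $p(x,\xi)$ on $\mathbb{R}\times\mathbb{R}$, $\mathrm{Op}(p)f(x)=\int_{\mathbb{R}}e^{2\pi ix\xi}p(x,\xi)\hat f(\xi)\,d\xi$ with $\hat f(\xi)=\int e^{-2\pi ix\xi}f(x)\,dx$ (for Schwartz $f$, extended to $L^2$ by density). $\mathfrak{C}(p_1,p_2)=\mathrm{Op}(p_1)\circ\mathrm{Op}(p_2)-\mathrm{Op}(p_1p_2)$; $\mathrm{Op}(p)^{skew}=\mathrm{Op}(p)-\mathrm{Op}(p)^T$, where $\mathrm{Op}(p)^T$ is the adjoint with respect to the $L^2$ product $\int fg\,dx$. $|||\cdot|||$ denotes the operator norm bound on $L^2(\mathbb{R})$ of the indicated operator. $\|p\|_{\alpha,\beta}=\sup_{x,\xi,\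 \alpha'\le\alpha,\ \beta'\le\beta}|\partial_x^{\alpha'}\partial_\xi^{\beta'}p(x,\xi)|$ (distributional derivatives), $p\in\mathcal{S}_{\alpha,\beta}$ iff $\|p\|_{\alpha,\beta}<\infty$. $C$ is a constant independent of $p_+$ and $f$. *)

(* Defs.v *)
From HB Require Import structures.
From mathcomp Require Import all_boot all_order all_algebra complex.
From mathcomp Require Import all_classical all_reals all_analysis.

Set Implicit Arguments.
Unset Strict Implicit.
Unset Printing Implicit Defensive.

Import Order.TTheory GRing.Theory Num.Theory.
Import numFieldNormedType.Exports.

Local Open Scope classical_set_scope.
Local Open Scope ring_scope.
Local Open Scope complex_scope.

Section ComplexIntegral.
Context {R : realType}.
Local Notation mu := (@lebesgue_measure R).

Definition cexpi (t : R) : R[i] := cos t +i* sin t.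

Definition cabs (z : R[i]) : R := Num.sqrt (complex.Re z ^+ 2 + complex.Im z ^+ 2).

Definition cmeasurable (F : R -> R[i]) : Prop :=
  measurable_fun setT (fun x => complex.Re (F x)) /\
  measurable_fun setT (fun x => complex.Im (F x)).

Definition cintegrable (F : R -> R[i]) : Prop :=
  mu.-integrable setT (fun x => (complex.Re (F x))%:E) /\
  mu.-integrable setT (fun x => (complex.Im (F x))%:E).

Definition cintegral (F : R -> R[i]) : R[i] :=
  Rintegral mu setT (fun x => complex.Re (F x)) +i*
  Rintegral mu setT (fun x => complex.Im (F x)).

End ComplexIntegral.

Section L2.
Context {R : realType}.
Local Notation mu := (@lebesgue_measure R).

(* Real-valued functions, not quotiented by a.e. equality. *)
Definition L2 : set (R -> R) := [set f | f \in Lfun mu 2%:E].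

Definition L2norm (f : R -> R) : \bar R := Lnorm mu 2%:E (EFin \o f).

Definition opnorm (T : (R -> R) -> (R -> R)) : \bar R :=
  ereal_sup [set L2norm (T f) | f in [set f | L2 f /\ (L2norm f <= 1)%E]].

Definition is_adjoint_at (T : (R -> R) -> (R -> R)) (f g : R -> R) : Prop :=
  L2 g /\ forall h, L2 h ->
    Rintegral mu setT (fun x => g x * h x) =
    Rintegral mu setT (fun x => f x * T h x).

(* [g] is determined up to a.e. equality; it exists whenever [T] is a bounded
   linear operator. *)
Definition adjoint (T : (R -> R) -> (R -> R)) (f : R -> R) : R -> R :=
  xget (fun=> 0) [set g | is_adjoint_at T f g].

Definition op_skew (T : (R -> R) -> (R -> R)) (f : R -> R) : R -> R :=
  fun x => T f x - adjoint T f x.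

End L2.

Section PseudoDifferential.
Context {R : realType}.

Definition schwartz (f : R -> R) : Prop :=
  (forall n x, derivable (derive1n n f) x 1) /\
  (forall m n, exists M : R, forall x, `|x ^+ m * derive1n n f x| <= M).

Definition fourier (f : R -> R) (xi : R) : R[i] :=
  cintegral (fun x => cexpi (- (2 * pi * x * xi)) * (f x)%:C).

Definition Op_schwartz (p : R -> R -> R) (f : R -> R) (x : R) : R[i] :=
  cintegral (fun xi => cexpi (2 * pi * x * xi) * (p x xi)%:C * fourier f xi).

(* For [p] even in the second variable, [Op_schwartz p f] is real valued, so
   that its L^2 limits are real functions. *)
Definition is_Op_at (p : R -> R -> R) (f g : R -> R) : Prop :=
  L2 g /\ forall phi : nat -> R -> R,
    (forall n, schwartz (phi n)) ->
    (fun n => L2norm (phi n \- f)) @ \oo --> 0%E ->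
    (fun n => L2norm (fun x => cabs (Op_schwartz p (phi n) x - (g x)%:C)))
      @ \oo --> 0%E.

(* Extension by density: [g] is determined up to a.e. equality, and exists for
   every [f] in L^2 when [Op_schwartz p] is L^2-bounded and [p] is even in the
   second variable. *)
Definition Op (p : R -> R -> R) (f : R -> R) : R -> R :=
  xget (fun=> 0) [set g | is_Op_at p f g].

Definition compdefect (p1 p2 : R -> R -> R) (f : R -> R) : R -> R :=
  fun x => Op p1 (Op p2 f) x - Op (fun y xi => p1 y xi * p2 y xi) f x.

End PseudoDifferential.

Section SymbolClasses.
Context {R : realType}.
Local Notation mu := (@lebesgue_measure R).
Local Notation mu2 := (mu \x mu)%E.

Definition dx (phi : R -> R -> R) : R -> R -> R :=
  fun x xi => derive1 (phi ^~ xi) x.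

Definition dxi (phi : R -> R -> R) : R -> R -> R :=
  fun x xi => derive1 (phi x) xi.

(* A word [w] in [true] (d/dx) and [false] (d/dxi) encodes an iterated partial
   derivative. *)
Definition iterpd (w : seq bool) (phi : R -> R -> R) : R -> R -> R :=
  foldr (fun b psi => if b then dx psi else dxi psi) phi w.

Definition smooth2 (phi : R -> R -> R) : Prop := forall w : seq bool,
  continuous (fun z : R * R => iterpd w phi z.1 z.2) /\
  forall x xi, derivable (iterpd w phi ^~ xi) x 1 /\
               derivable (iterpd w phi x) xi 1.

Definition test2 (phi : R -> R -> R) : Prop :=
  smooth2 phi /\
  exists M : R, forall x xi, M < `|x| \/ M < `|xi| -> phi x xi = 0.

Definition locint2 (g : R -> R -> R) : Prop :=
  measurable_fun setT (fun z : R * R => g z.1 z.2) /\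
  forall K : set (R * R), compact K ->
    mu2.-integrable K (fun z => (g z.1 z.2)%:E).

(* [g] represents the distributional derivative d_x^a d_xi^b p. *)
Definition weak_deriv (a b : nat) (p g : R -> R -> R) : Prop :=
  [/\ locint2 p, locint2 g & forall phi, test2 phi ->
    Rintegral mu2 setT (fun z => g z.1 z.2 * phi z.1 z.2) =
    (-1) ^+ (a + b) *
    Rintegral mu2 setT (fun z => p z.1 z.2 * iter a dx (iter b dxi phi) z.1 z.2)].

(* The L^oo norm of d_x^a d_xi^b p; it is +oo when this distribution is not a
   function (infimum of the empty set). *)
Definition weak_deriv_sup (a b : nat) (p : R -> R -> R) : \bar R :=
  ereal_inf [set Lnorm mu2 +oo%E (fun z => (g z.1 z.2)%:E)
            | g in [set g | weak_deriv a b p g]].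

Definition symbol_norm (a b : nat) (p : R -> R -> R) : \bar R :=
  ereal_sup [set weak_deriv_sup ab.1 ab.2 p
            | ab in [set ab : nat * nat | (ab.1 <= a)%N && (ab.2 <= b)%N]].

Definition symbol_class (a b : nat) : set (R -> R -> R) :=
  [set p | (symbol_norm a b p < +oo)%E].

End SymbolClasses.

Section Sobolev.
Context {R : realType}.
Local Notation mu := (@lebesgue_measure R).

(* [v] is the Fourier transform of the tempered distribution [u]; by linearity,
   real-valued test functions suffice. *)
Definition is_fourier (u : R -> R) (v : R -> R[i]) : Prop :=
  cmeasurable v /\ forall phi, schwartz phi ->
    [/\ cintegrable (fun x => (u x)%:C * fourier phi x),
        cintegrable (fun xi => v xi * (phi xi)%:C) &
        cintegral (fun xi => v xi * (phi xi)%:C) =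
        cintegral (fun x => (u x)%:C * fourier phi x)].

(* Inhomogeneous Sobolev norm, equal to +oo when [u] is not in H^s. *)
Definition Hnorm (s : R) (u : R -> R) : \bar R :=
  ereal_inf [set L2norm (fun xi => (1 + xi ^+ 2) `^ (s / 2) * cabs (v xi))
            | v in [set v | is_fourier u v]].

(* The supremum over all [xi] of the norms of the slices of one representative
   [r] is the essential supremum, as [r] may be changed for [xi] in a null
   set. *)
Definition mixed_deriv_sobolev (eps : R) (q : R -> R -> R) : Prop :=
  exists2 r : R -> R -> R, weak_deriv 1 1 q r &
    (ereal_sup [set Hnorm (- eps) (r ^~ xi) + Hnorm (1 + eps) (r ^~ xi)
               | xi in [set: R]] < +oo)%E.

End Sobolev.

(* Main.v *)
Require Import Defs.
From HB Require Import structures.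
From mathcomp Require Import all_boot all_order all_algebra complex ring lra.
From mathcomp Require Import all_classical all_reals all_analysis.
From mathcomp Require Import measurable_realfun ess_sup_inf.

(** Put Q = Op(p^{1/2}), with adjoint Q^T. Since Op(p) = Q Q - C(p^{1/2}, p^{1/2}),
    - <f, Op(p) f> = <f, C f> - <Q^T f, Q f> = <f, C f> - |Q f|^2 + <(Q - Q^T) f, Q f>,
    so that everything follows from the L^2 bound |Q f| <= C |p^{1/2}|_{1,1} |f|, a
    Calderón-Vaillancourt estimate. It is proved by discretisation: averaging the symbol
    against a smooth partition of unity on a grid of mesh 1/n with n^2 points in each
    variable gives coefficients whose first and mixed differences are controlled by the weak
    derivatives, and turns <v, Q u> into a sum over Z/n^2 of the form
    sum_{j,l,i} Q_{jl} v_j u_i cos(2 pi (j - i) l / n^2). This sum is bounded by cutting j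
    into blocks of length n, summing by parts in j inside a block and in l against the second
    difference that produces the decay in |i - j|, and using the Parseval identity of the
    finite Fourier transform. The estimate passes to the limit for smooth compactly supported
    u, v, and to L^2 by density. *)

Set Implicit Arguments.
Unset Strict Implicit.
Unset Printing Implicit Defensive.

Import Order.TTheory GRing.Theory Num.Theory.
Import numFieldNormedType.Exports.

Local Open Scope ring_scope.

(** * Finite Fourier sums *)

Section DiscreteFourier.
Context {R : realType}.
Implicit Types (a b w m u v : nat -> R) (x y t c h : R).

(** The symbol norm controls one derivative in each variable and the mixed one, whereas a decay in
    [|i - j|] that can be summed takes two differences in the frequency, of which the multiplier
    bears only one. The other is put on the transform of [v]: once [v] is cut to a window of length
    [n], a step in frequency changes that transform by order [1 / n] in mean square, which is as
    good as a derivative. This forces the blocks. Freezing the symbol in [j] on a block costs [n]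
    increments of size [1 / n], each again a multiplier with one controlled difference; here the
    mixed derivative enters. Grid sums are periodic, so the supports are kept small compared with
    the period [n ^ 2]; the periodic weight then dominates the square of the true distance and the
    blocks can be summed. A free weight [t] between the two square sums is optimised only at the
    level of L^2 norms. On the operator side, [Op] and [adjoint] choose functions rather than
    classes, with a default value when no suitable function exists, so boundedness and homogeneity
    have to cover the default values too. *)

Lemma sum_cos_eq0 (N k : nat) h c : N%:R * h = k%:R * (2 * pi) ->
  sin (h / 2) != 0 -> \sum_(l < N) cos (c + h * l%:R) = 0.
Proof.
move=> Nh sh.
(* Multiplied by [2 sin (h / 2)], each cosine becomes a difference of sines at consecutive
   half-steps. *)
have tel : forall M : nat, 2 * sin (h / 2) * (\sum_(l < M) cos (c + h * l%:R)) =
    sin (c + h * M%:R - h / 2) - sin (c - h / 2).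
  elim=> [|M IH]; first by rewrite big_ord0 !mulr0 addr0 subrr.
  rewrite big_ord_recr /= mulrDr IH -[M.+1%:R]natr1.
  have -> : c + h * (M%:R + 1) - h / 2 = (c + h * M%:R) + h / 2 by field.
  move: (c + h * M%:R) (sin (c - h / 2)) => t s.
  by rewrite sinB [sin (t + _)]sinD; ring.
have := tel N; have -> : c + h * N%:R - h / 2 = (c - h / 2) + (pi *+ 2) *+ k.
  by rewrite [h * _]mulrC Nh -[_ *+ k]mulr_natr -[pi *+ 2]mulr_natr; ring.
rewrite (periodicn (@sinD2pi R)) subrr => /eqP.
by rewrite mulf_eq0 mulf_eq0 (negbTE sh) pnatr_eq0 /= => /eqP.
Qed.

Lemma sqr_sin_le x : sin x ^+ 2 <= x ^+ 2.
Proof.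
have P : forall y, 0 <= y -> `|sin y| <= y.
  move=> y; rewrite le_eqVlt => /orP[/eqP <-|y0]; first by rewrite sin0 normr0.
  have [z _] := @MVT R (@sin R) (@cos R) 0 y y0 (fun z _ => is_derive_sin z)
     (continuous_subspaceT (@continuous_sin R)).
  rewrite sin0 !subr0 => ->; rewrite normrM (gtr0_norm y0).
  by apply: ler_piMl; [exact: ltW | exact: cos_max].
rewrite -[X in X <= _]real_normK ?num_real// -[X in _ <= X]real_normK ?num_real//.
rewrite ler_sqr ?nnegrE//; case: (leP 0 x) => x0.
  by rewrite (ger0_norm x0); exact: P.
by rewrite (ltr0_norm x0) -normrN -sinN; apply: P; rewrite oppr_ge0 ltW.
Qed.

Lemma cos_half x : 2 - 2 * cos x = 4 * sin (x / 2) ^+ 2.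
Proof.
have -> : cos x = cos ((x / 2) *+ 2) by congr cos; rewrite mulr2n; field.
by rewrite cos_mulr2n cos2sin2 mulr2n; ring.
Qed.

Lemma cos_defect_le x : 2 - 2 * cos x <= x ^+ 2.
Proof. by rewrite cos_half; have := sqr_sin_le (x / 2); nra. Qed.

Lemma cos_defect_ge0 x : 0 <= 2 - 2 * cos x.
Proof. by have := cos_le1 x; lra. Qed.

(** The mean value theorem gives [sin (x / 2) = cos z * (x / 2)] with [cos z >= 1 / 2] on this
    range. With [cos_defect_le], the defect is comparable to a square, which lets a periodic weight
    stand for a squared distance. *)
Lemma cos_defect_ge x : `|x| <= 1 -> x ^+ 2 / 4 <= 2 - 2 * cos x.
Proof.
move=> x1; rewrite -[cos x]cos_norm -[x ^+ 2]real_normK ?num_real//.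
move: `|x| (normr_ge0 x) x1 => {}x x0 x1.
have c12 z : z \in `]0, (x / 2)[ -> 1 / 2 <= cos z.
  rewrite in_itv /= => /andP[z0 zx].
  have := sqr_sin_le (z / 2); have := cos_half z; nra.
rewrite cos_half; move: x0; rewrite le_eqVlt => /orP[/eqP <-|x0].
  by rewrite expr0n !mul0r sin0 expr0n mulr0.
have x20 : 0 < x / 2 by lra.
have [z zx] := @MVT R (@sin R) (@cos R) 0 (x / 2) x20 (fun z _ => is_derive_sin z)
     (continuous_subspaceT (@continuous_sin R)).
rewrite sin0 !subr0 => ->; have := c12 z zx => c.
have : (1 / 2) ^+ 2 <= cos z ^+ 2 by rewrite ler_sqr ?nnegrE; lra.
rewrite exprMn; nra.
Qed.

Variables (n : nat) (n_gt0 : (0 < n)%N).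
Let N := (n * n)%N.
Let th : R := 2 * pi / N%:R.

Let N_gt0 : (0 < N)%N. Proof. by rewrite muln_gt0 n_gt0. Qed.
Let NR_gt0 : 0 < N%:R :> R. Proof. by rewrite ltr0n. Qed.
Let nR_gt0 : 0 < n%:R :> R. Proof. by rewrite ltr0n. Qed.

(** Real part, and below imaginary part, of the sum of [a i * exp (I * th * (i - c) * x)]. The
    centre [c] makes the dependence on [x] slow for coefficients supported near [c]. *)
Definition dftC a c x := \sum_(i < N) a i * cos (th * (i%:R - c) * x).
Definition dftS a c x := \sum_(i < N) a i * sin (th * (i%:R - c) * x).

(** Orthogonality of characters: for [i] different from [j] the phase is affine in [l] with slope
    [th * (i - j)], a nontrivial multiple of a full turn over [N]; the shifts [L0] and [d] only
    change the constant term. *)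
Lemma sum_dft_mode (i j : nat) L0 c d : (i < N)%N -> (j < N)%N ->
  \sum_(l < N) cos (th * (i%:R - c) * (l%:R - L0) - th * (j%:R - c) * (l%:R - L0 + d))
   = if i == j then N%:R * cos (th * (i%:R - c) * d) else 0.
Proof.
move=> iN jN; case: eqP => [<-|/eqP ij].
  rewrite -[N in RHS]card_ord -sum1_card natr_sum mulr_suml; apply: eq_bigr => l _.
  rewrite mul1r -[RHS]cosN; congr cos; ring.
have sym : forall (i j : nat) c0, (i < N)%N -> (j < i)%N ->
    \sum_(l < N) cos (c0 + th * (i%:R - j%:R) * l%:R) = 0.
  move=> {ij} {i j iN jN} i j c0 iN ji; apply: (@sum_cos_eq0 N (i - j)).
    rewrite natrB 1?ltnW// /th; field; rewrite gt_eqF//.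
  apply: lt0r_neq0; apply: sin_gt0_pi.
  have ij : 0 < (i%:R - j%:R : R) by rewrite subr_gt0 ltr_nat.
  have iN' : i%:R - j%:R < N%:R :> R.
    by rewrite -natrB 1?ltnW// ltr_nat (leq_ltn_trans _ iN)// leq_subr.
  have -> : th * (i%:R - j%:R) / 2 = pi * ((i%:R - j%:R) / N%:R) by rewrite /th; field; rewrite gt_eqF.
  rewrite mulr_gt0 ?pi_gt0 ?divr_gt0//= gtr_pMr ?pi_gt0//.
  by rewrite ltr_pdivrMr// mul1r.
case: (ltngtP i j) ij => // ij _.
- rewrite -[RHS](sym j i (th * (j%:R - c) * (d - L0) + th * (i%:R - c) * L0) jN ij).
  apply: eq_bigr => l _; rewrite -cosN; congr cos; ring.
- rewrite -[RHS](sym i j (- (th * (j%:R - c) * (d - L0)) - th * (i%:R - c) * L0) iN ij).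
  apply: eq_bigr => l _; congr cos; ring.
Qed.

(** Parseval with a lag [d] between the two transforms: [d = 0] gives [dft_norm], and [d = 1] is the
    cross term in [dft_diff_norm]. *)
Lemma dft_polar L0 a b c d :
  \sum_(l < N) (dftC a c (l%:R - L0) * dftC b c (l%:R - L0 + d)
              + dftS a c (l%:R - L0) * dftS b c (l%:R - L0 + d))
  = N%:R * \sum_(i < N) a i * b i * cos (th * (i%:R - c) * d).
Proof.
transitivity (\sum_(i < N) \sum_(j < N) a i * b j *
  \sum_(l < N) cos (th * (i%:R - c) * (l%:R - L0) - th * (j%:R - c) * (l%:R - L0 + d))).
  under [RHS]eq_bigr do under eq_bigr do rewrite mulr_sumr.
  under [RHS]eq_bigr do rewrite exchange_big /=.
  rewrite [RHS]exchange_big; apply: eq_bigr => l _ /=.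
  rewrite /dftC /dftS !mulr_suml -big_split; apply: eq_bigr => i _ /=.
  rewrite !mulr_sumr -big_split; apply: eq_bigr => j _ /=.
  by rewrite cosB; ring.
rewrite mulr_sumr; apply: eq_bigr => i _.
rewrite (bigD1 i)//= sum_dft_mode// eqxx big1 ?addr0; first ring.
by move=> j ji; rewrite sum_dft_mode//= eq_sym (negbTE (ji : val j != val i)) mulr0.
Qed.

Lemma dft_norm L0 a c :
  \sum_(l < N) (dftC a c (l%:R - L0) ^+ 2 + dftS a c (l%:R - L0) ^+ 2)
  = N%:R * \sum_(i < N) a i ^+ 2.
Proof.
have := dft_polar L0 a a c 0; under eq_bigr do rewrite addr0 -!expr2.
by move=> ->; congr (_ * _); apply: eq_bigr => i _; rewrite mulr0 cos0 mulr1.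
Qed.

Lemma dft_diff_norm L0 a c :
  \sum_(l < N) ((dftC a c (l%:R - L0 + 1) - dftC a c (l%:R - L0)) ^+ 2
              + (dftS a c (l%:R - L0 + 1) - dftS a c (l%:R - L0)) ^+ 2)
  = N%:R * \sum_(i < N) a i ^+ 2 * (2 - 2 * cos (th * (i%:R - c))).
Proof.
have e1 := dft_norm L0 a c; have e2 := dft_norm (L0 - 1) a c.
have e3 := dft_polar L0 a a c 1.
transitivity (N%:R * (\sum_(i < N) a i ^+ 2) + N%:R * (\sum_(i < N) a i ^+ 2)
  - 2 * (N%:R * \sum_(i < N) a i * a i * cos (th * (i%:R - c) * 1))).
  rewrite -{1}e2 -{1}e1 -e3 mulr_sumr -sumrN -!big_split; apply: eq_bigr => l _ /=.
  have -> : l%:R - (L0 - 1) = l%:R - L0 + 1 :> R by ring.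
  by ring.
rewrite !mulr_sumr -sumrN -!big_split; apply: eq_bigr => i _ /=.
by rewrite mulr1; ring.
Qed.

(** What [- n ^ 2] times the second difference in frequency multiplies coefficients by. As
    [n * th = 2 * pi / n], it behaves like [(2 * pi * (i - c) / n) ^ 2] near [c]: a squared distance
    measured in block lengths. *)
Let sg c (i : nat) := n%:R ^+ 2 * (2 - 2 * cos (th * (i%:R - c))).

Let sg_ge0 c i : 0 <= sg c i.
Proof. by rewrite mulr_ge0 ?sqr_ge0 ?cos_defect_ge0. Qed.

(** Young's inequality for a planar scalar product; the weight [t] stays free so that the sum of
    squares can become a product of norms at the very end. *)
Lemma dot_le (k mu t p1 p2 q1 q2 : R) : 0 < t -> `|k| <= mu ->
  `|k * (p1 * q1 + p2 * q2)| <= mu / 2 * (t * (p1 ^+ 2 + p2 ^+ 2) + (q1 ^+ 2 + q2 ^+ 2) / t).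
Proof.
move=> t0 km; rewrite normrM -mulrA; apply: ler_pM => //.
have tV : 0 < t^-1 by rewrite invr_gt0.
have h (p q : R) : 0 <= t * (p ^+ 2) + q ^+ 2 / t - 2 * (p * q).
  have -> : t * p ^+ 2 + q ^+ 2 / t - 2 * (p * q) = t^-1 * (t * p - q) ^+ 2.
    by field; rewrite gt_eqF.
  by rewrite mulr_ge0 ?sqr_ge0// ltW.
have := h p1 q1; have := h p2 q2; have := h p1 (- q1); have := h p2 (- q2).
rewrite !sqrrN !mulrN ler_norml [(_ + _) / t]mulrDl [t * (_ + _)]mulrDr.
move: (q1 ^+ 2 / t) (q2 ^+ 2 / t) (t * p1 ^+ 2) (t * p2 ^+ 2) => x y z s; lra.
Qed.

Lemma dft_second_difference b c x :
  (dftC (fun i => b i * (1 + sg c i)) c x = dftC b c x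
     + n%:R ^+ 2 * (2 * dftC b c x - dftC b c (x + 1) - dftC b c (x - 1))) *
  (dftS (fun i => b i * (1 + sg c i)) c x = dftS b c x
     + n%:R ^+ 2 * (2 * dftS b c x - dftS b c (x + 1) - dftS b c (x - 1))).
Proof.
split; rewrite /dftC /dftS !mulr_sumr -!sumrN -!big_split mulr_sumr -big_split;
  apply: eq_bigr => i _ /=; rewrite /sg; move: (th * (i%:R - c)) => z;
  rewrite [z * (x + 1)]mulrDr [z * (x - 1)]mulrBr mulr1.
- by rewrite [cos (_ - z)]cosB [cos (_ + z)]cosD; ring.
- by rewrite [sin (_ - z)]sinB [sin (_ + z)]sinD; ring.
Qed.

(* With [w = b / (1 + sg c)], the transform of [b] is that of [w] minus [n ^ 2] times its
   second difference in the frequency; summation by parts moves one of the two differences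
   onto the multiplier and onto [a], whose support in a window of length [n] makes it cheap. *)
Lemma multiplier_bound L0 c (mu : R) t m a b : 0 < t ->
  (forall l, `|m l| <= mu) -> (forall l, `|m l.+1 - m l| <= mu / n%:R) ->
  m 0%N = 0 -> m N = 0 ->
  (forall i, (i < N)%N -> a i != 0 -> `|i%:R - c| <= n%:R) ->
  `|\sum_(l < N) m l * (dftC a c (l%:R - L0) * dftC b c (l%:R - L0)
                      + dftS a c (l%:R - L0) * dftS b c (l%:R - L0))|
  <= 33 * mu * N%:R * (t * (\sum_(i < N) a i ^+ 2)
                       + (\sum_(i < N) b i ^+ 2 / (1 + sg c i)) / t).
Proof.
move=> t0 m_le dm_le m0 mN a_supp.
have sg1 i : 0 < 1 + sg c i by rewrite ltr_pwDl.
pose w i := b i / (1 + sg c i).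
have bE : b = fun i => w i * (1 + sg c i).
  by apply/funext => i; rewrite /w mulfVK// gt_eqF.
pose x (l : nat) : R := l%:R - L0.
have xS l : x l.+1 = x l + 1 by rewrite /x -natr1; ring.
(* The increments of [Y] sum to zero since [m] vanishes at [0] and at [N]. Adding them splits the
   sum into three parts: no difference, a difference on [m], a difference on the transform of
   [a]. *)
pose Y l := m l * (dftC a c (x l) * (dftC w c (x l) - dftC w c (x l - 1))
                 + dftS a c (x l) * (dftS w c (x l) - dftS w c (x l - 1))).
have -> : \sum_(l < N) m l * (dftC a c (l%:R - L0) * dftC b c (l%:R - L0)
                      + dftS a c (l%:R - L0) * dftS b c (l%:R - L0)) =
  (\sum_(l < N) m l * (dftC a c (x l) * dftC w c (x l) + dftS a c (x l) * dftS w c (x l)))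
  + n%:R ^+ 2 * (\sum_(l < N) (m l.+1 - m l) *
     (dftC a c (x l.+1) * (dftC w c (x l + 1) - dftC w c (x l)) +
      dftS a c (x l.+1) * (dftS w c (x l + 1) - dftS w c (x l))))
  + n%:R ^+ 2 * (\sum_(l < N) m l *
     ((dftC a c (x l + 1) - dftC a c (x l)) * (dftC w c (x l + 1) - dftC w c (x l)) +
      (dftS a c (x l + 1) - dftS a c (x l)) * (dftS w c (x l + 1) - dftS w c (x l)))).
  have YE : \sum_(l < N) n%:R ^+ 2 * (Y l.+1 - Y l) = 0.
    rewrite -mulr_sumr -(big_mkord xpredT (fun l => Y l.+1 - Y l)) telescope_sumr//.
    by rewrite /Y m0 mN !mul0r subrr mulr0.
  rewrite -[LHS]addr0 -[X in _ + X = _]YE !mulr_sumr -!big_split; apply: eq_bigr => l _ /=.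
  rewrite -/(x l) bE !dft_second_difference /Y xS.
  have -> : x l + 1 - 1 = x l by ring.
  by ring.
set A2 := \sum_(i < N) a i ^+ 2; set B2 := \sum_(i < N) _ / _.
have mu0 : 0 <= mu by apply: le_trans (m_le 0%N).
have A20 : 0 <= A2 by apply: sumr_ge0 => i _; apply: sqr_ge0.
have tV0 : 0 < t^-1 by rewrite invr_gt0.
have wB : \sum_(i < N) w i ^+ 2 <= B2.
  apply: ler_sum => i _; rewrite /w expr_div_n ler_wpM2l ?sqr_ge0// lef_pV2 ?posrE ?exprn_gt0//.
  by have := sg_ge0 c i; nra.
pose dw := \sum_(i < N) w i ^+ 2 * (2 - 2 * cos (th * (i%:R - c))).
pose da := \sum_(i < N) a i ^+ 2 * (2 - 2 * cos (th * (i%:R - c))).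
(* One of the two factors [1 + sg] in the denominator of [w ^ 2] absorbs [sg]. *)
have wsB : n%:R ^+ 2 * dw <= B2.
  rewrite mulr_sumr; apply: ler_sum => i _; rewrite mulrCA /w -/(sg c i) expr_div_n -mulrA ler_wpM2l ?sqr_ge0//.
  rewrite mulrC ler_pdivrMr ?exprn_gt0// expr2 mulrA mulVf ?gt_eqF// mul1r.
  by rewrite lerDr.
(* On the support [|i - c| <= n], so [n * th * |i - c| <= 2 * pi]; [64] bounds [(2 * pi) ^ 2]
   through [pi <= 4]. *)
have aB : n%:R ^+ 2 * da <= 64 * A2.
  rewrite !mulr_sumr; apply: ler_sum => i _; rewrite mulrCA mulrC.
  have [->|ai] := eqVneq (a i) 0; first by rewrite expr0n !mulr0.
  rewrite ler_wpM2r ?sqr_ge0//; have := a_supp i (ltn_ord i) ai; rewrite ler_norml => ic.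
  apply: le_trans (_ : n%:R ^+ 2 * (th * (i%:R - c)) ^+ 2 <= _).
    by rewrite ler_wpM2l ?sqr_ge0// cos_defect_le.
  have thn : th * n%:R ^+ 2 = 2 * pi.
    by rewrite /th /N natrM; field; rewrite gt_eqF.
  have pi4 : pi <= 4 :> R by have := @pihalf_lt2 R; lra.
  have th0 : 0 <= th by rewrite /th divr_ge0// mulr_ge0 ?pi_ge0.
  have : (i%:R - c) ^+ 2 <= n%:R ^+ 2 by nra.
  move=> h; have : (th * (i%:R - c)) ^+ 2 <= th ^+ 2 * n%:R ^+ 2.
    by rewrite exprMn ler_wpM2l ?sqr_ge0.
  move=> h2; have : n%:R ^+ 2 * (th * (i%:R - c)) ^+ 2 <= (th * n%:R ^+ 2) ^+ 2.
    have -> : (th * n%:R ^+ 2) ^+ 2 = n%:R ^+ 2 * (th ^+ 2 * n%:R ^+ 2) by ring.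
    by rewrite ler_wpM2l ?sqr_ge0.
  move/le_trans; apply; rewrite thn; have := @pi_ge0 R; nra.
have sum_dot_le (k : nat -> R) (k0 t1 : R) (p1 p2 q1 q2 : nat -> R) : 0 < t1 ->
    (forall l, `|k l| <= k0) ->
    `|\sum_(l < N) k l * (p1 l * q1 l + p2 l * q2 l)| <= k0 / 2 *
      (t1 * (\sum_(l < N) (p1 l ^+ 2 + p2 l ^+ 2)) + (\sum_(l < N) (q1 l ^+ 2 + q2 l ^+ 2)) / t1).
  move=> t10 kk; apply: le_trans (ler_norm_sum _ _ _) _.
  rewrite mulr_sumr mulr_suml -big_split mulr_sumr; apply: ler_sum => l _.
  exact: dot_le.
have S1 := @sum_dot_le m mu t (fun l => dftC a c (x l)) (fun l => dftS a c (x l))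
  (fun l => dftC w c (x l)) (fun l => dftS w c (x l)) t0 m_le.
(* The difference of [m] gains [1 / n], and so does the difference of the transform of [w]; the
   weight [t / n] balances both gains against the factor [n ^ 2]. *)
have tn0 : 0 < t / n%:R by rewrite divr_gt0.
have S2 := @sum_dot_le (fun l => m l.+1 - m l) (mu / n%:R) (t / n%:R)
  (fun l => dftC a c (x l.+1)) (fun l => dftS a c (x l.+1))
  (fun l => dftC w c (x l + 1) - dftC w c (x l))
  (fun l => dftS w c (x l + 1) - dftS w c (x l)) tn0 dm_le.
have S3 := @sum_dot_le m mu t (fun l => dftC a c (x l + 1) - dftC a c (x l))
  (fun l => dftS a c (x l + 1) - dftS a c (x l))
  (fun l => dftC w c (x l + 1) - dftC w c (x l))
  (fun l => dftS w c (x l + 1) - dftS w c (x l)) t0 m_le.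
have shift : \sum_(l < N) (dftC a c (x l.+1) ^+ 2 + dftS a c (x l.+1) ^+ 2) = N%:R * A2.
  rewrite -(dft_norm (L0 - 1) a c); apply: eq_bigr => l _.
  by have -> : x l.+1 = l%:R - (L0 - 1) by rewrite xS /x; ring.
rewrite !dft_norm -/A2 in S1; rewrite !dft_diff_norm shift -/dw in S2.
rewrite !dft_diff_norm -/da -/dw in S3.
move: wB S1 S2 S3; set W2 := \sum_(i < N) w i ^+ 2; set s1 := \sum_(l < N) _; set s2 := \sum_(l < N) _; set s3 := \sum_(l < N) _.
move=> wB S1 S2 S3.
have n2 : 0 <= n%:R ^+ 2 :> R by apply: sqr_ge0.
apply: le_trans (ler_normD _ _) _; apply: le_trans (lerD (ler_normD _ _) (lexx _)) _.
rewrite ![`|n%:R ^+ 2 * _|]normrM (ger0_norm n2).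
have S2' : n%:R ^+ 2 * `|s2| <= mu / 2 * N%:R * (t * A2 + B2 / t).
  apply: le_trans (ler_wpM2l n2 S2) _.
  have -> : n%:R ^+ 2 * (mu / n%:R / 2 * (t / n%:R * (N%:R * A2) + N%:R * dw / (t / n%:R)))
     = mu / 2 * N%:R * (t * A2 + n%:R ^+ 2 * dw / t).
    by field; rewrite !gt_eqF.
  rewrite ler_wpM2l ?mulr_ge0 ?invr_ge0// lerD2l.
  by rewrite ler_wpM2r// (ltW tV0).
have S3' : n%:R ^+ 2 * `|s3| <= mu / 2 * N%:R * (t * (64 * A2) + B2 / t).
  apply: le_trans (ler_wpM2l n2 S3) _.
  have -> : n%:R ^+ 2 * (mu / 2 * (t * (N%:R * da) + N%:R * dw / t))
     = mu / 2 * N%:R * (t * (n%:R ^+ 2 * da) + n%:R ^+ 2 * dw / t).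
    by field; rewrite !gt_eqF.
  rewrite ler_wpM2l ?mulr_ge0 ?invr_ge0// lerD//.
    by rewrite ler_wpM2l// ltW.
  by rewrite ler_wpM2r// (ltW tV0).
have S1' : `|s1| <= mu / 2 * N%:R * (t * A2 + B2 / t).
  apply: le_trans S1 _.
  have -> : mu / 2 * (t * (N%:R * A2) + N%:R * W2 / t)
     = mu / 2 * N%:R * (t * A2 + W2 / t).
    by field; rewrite gt_eqF.
  by rewrite ler_wpM2l ?mulr_ge0 ?invr_ge0// lerD2l ler_wpM2r// (ltW tV0).
have B20 : 0 <= B2 / t.
  by rewrite mulr_ge0 ?(ltW tV0)// sumr_ge0// => i _; rewrite divr_ge0 ?sqr_ge0 ?ltW.
have K0 : 0 <= mu * N%:R * (B2 / t) by rewrite mulr_ge0// mulr_ge0.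
have K1 : 0 <= mu * N%:R * (t * A2) by rewrite mulr_ge0// mulr_ge0// ltW.
(* [33 = (1 + 1 + 64) / 2], from the three contributions to the coefficient of [t * A2]. *)
clear -S1' S2' S3' K0 K1; lra.
Qed.

(** Each term is at most four times an increment over a unit step of [s / (1 + |s|)], which stays in
    [[-1, 1]]; the sum telescopes to at most [4 * 2], uniformly in [M] and [y]. *)
Lemma sum_inv_sqr_le (M : nat) y : \sum_(k < M) (1 + (y - k%:R) ^+ 2)^-1 <= 8.
Proof.
pose g (s : R) := s / (1 + `|s|).
have g1 s : `|g s| <= 1.
  have s0 := normr_ge0 s.
  rewrite /g normrM normfV [`|1 + `|s| |]ger0_norm ?addr_ge0//.
  by rewrite ler_pdivrMr ?mul1r; lra.
have step s : (1 + s ^+ 2)^-1 <= 4 * (g (s + 1) - g s).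
  have s2 : 0 <= s ^+ 2 by apply: sqr_ge0.
  rewrite -[_^-1]mul1r ler_pdivrMr; last lra.
  rewrite /g; case: (leP 0 s) => s0.
    rewrite !ger0_norm; [|lra|lra].
    have -> : (s + 1) / (1 + (s + 1)) - s / (1 + s) = ((1 + s) * (2 + s))^-1.
      by field; apply/andP; split; lra.
    rewrite mulrAC ler_pdivlMr; [nra|apply: mulr_gt0; lra].
  case: (leP 0 (s + 1)) => s1.
    rewrite (ltr0_norm s0) ger0_norm; last lra.
    have -> : (s + 1) / (1 + (s + 1)) - s / (1 - s) = ((s + 1) * (1 - s) - s * (2 + s)) / ((1 - s) * (2 + s)).
      by field; apply/andP; split; lra.
    rewrite mulrA mulrAC ler_pdivlMr; [nra|apply: mulr_gt0; lra].
  rewrite (ltr0_norm s0) ltr0_norm; last lra.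
  have -> : (s + 1) / (1 - (s + 1)) - s / (1 - s) = ((- s) * (1 - s))^-1.
    by field; apply/andP; split; lra.
  rewrite mulrAC ler_pdivlMr; [nra|apply: mulr_gt0; lra].
apply: (@le_trans _ _ (\sum_(k < M) 4 * (g (k.+1%:R - y) - g (k%:R - y)))).
  apply: ler_sum => k _; have := step (k%:R - y).
  have -> : (k%:R - y) ^+ 2 = (y - k%:R) ^+ 2 by ring.
  by have -> : k%:R - y + 1 = k.+1%:R - y by rewrite -[k.+1%:R]natr1; ring.
rewrite -mulr_sumr -(big_mkord xpredT (fun k => g (k.+1%:R - y) - g (k%:R - y))).
rewrite (telescope_sumr (fun k : nat => g (k%:R - y)))//.
have := g1 (M%:R - y); have := g1 (0%:R - y); rewrite !ler_norml; lra.
Qed.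

(** The condition [s + r < j] is put in the summand, so that the range of [r] does not depend on [j]
    and the two sums can be exchanged. *)
Lemma telescope_below (F : nat -> R) (M s j : nat) : (s <= j)%N -> (j <= s + M)%N ->
  F j = F s + \sum_(r < M) (if (s + r < j)%N then F (s + r).+1 - F (s + r)%N else 0).
Proof.
move=> sj jM; rewrite -big_mkcond /=.
rewrite (eq_bigl (fun r : 'I_M => r < j - s)%N); last first.
  by move=> r; rewrite ltn_subRL.
rewrite -(big_ord_widen M (fun r => F (s + r).+1 - F (s + r)%N)) ?leq_subLR//.
rewrite -(big_mkord xpredT (fun r => F (s + r).+1 - F (s + r)%N)).
under eq_bigr do rewrite -addnS.
rewrite (telescope_sumr (fun r => F (s + r)%N))// addn0 subnKC//; ring.
Qed.

(** * Decomposition into blocks of length n *)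

Section Blocks.
Variables (L0 mu t : R) (Q : nat -> nat -> R) (u v : nat -> R).
Hypothesis t_gt0 : 0 < t.
Hypothesis Q_le : forall j l, `|Q j l| <= mu.
Hypothesis Qj_le : forall j l, `|Q j.+1 l - Q j l| <= mu / n%:R.
Hypothesis Ql_le : forall j l, `|Q j l.+1 - Q j l| <= mu / n%:R.
Hypothesis Qjl_le : forall j l,
  `|(Q j.+1 l.+1 - Q j l.+1) - (Q j.+1 l - Q j l)| <= mu / n%:R / n%:R.
Hypothesis Q0 : forall j, Q j 0%N = 0.
Hypothesis QN : forall j, Q j N = 0.
Hypothesis uv_near : forall i j, (i < N)%N -> (j < N)%N -> u i != 0 -> v j != 0 ->
  16 * `|i%:R - j%:R| <= N%:R :> R.
Hypothesis n_ge16 : (16 <= n)%N.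

Let t_ge0 : 0 <= t. Proof. exact: ltW. Qed.
Let tV_ge0 : 0 <= t^-1. Proof. by rewrite invr_ge0. Qed.

Let block (k j : nat) : R := if (j %/ n == k)%N then v j else 0.
(** The part of a block beyond offset [r]: an increment of [Q] at that offset is felt exactly there,
    as [blockD] shows. *)
Let tail (k r j : nat) : R := if (k * n + r < j)%N then block k j else 0.
(** Mass of [u] as seen from block [k], decaying with the distance in block lengths; summed over [k]
    it is at most [8] times the mass of [u]. *)
Let G k := \sum_(i < N) u i ^+ 2 / (1 + (i%:R / n%:R - k%:R) ^+ 2).
Let dot a k l :=
  dftC a (k * n)%:R (l%:R - L0) * dftC u (k * n)%:R (l%:R - L0) +
  dftS a (k * n)%:R (l%:R - L0) * dftS u (k * n)%:R (l%:R - L0).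

Let dotE a k l : dot a k l =
  \sum_(j < N) a j * \sum_(i < N) u i * cos (th * (j%:R - i%:R) * (l%:R - L0)).
Proof.
rewrite /dot /dftC /dftS !mulr_suml -big_split; apply: eq_bigr => j _ /=.
rewrite !mulr_sumr -big_split; apply: eq_bigr => i _ /=.
have -> : th * (j%:R - i%:R) * (l%:R - L0) =
  th * (j%:R - (k * n)%:R) * (l%:R - L0) - th * (i%:R - (k * n)%:R) * (l%:R - L0) by ring.
by rewrite cosB; ring.
Qed.

Let block_supp k j : block k j != 0 -> (k * n <= j < k * n + n)%N.
Proof.
rewrite /block; case: ifP => [/eqP <- _|]; last by rewrite eqxx.
by rewrite leq_divM/= -mulSnr -ltn_divLR.
Qed.

Let blockD k j l : block k j * Q j l = block k j * Q (k * n)%N l +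
  \sum_(r < n) tail k r j * (Q (k * n + r).+1 l - Q (k * n + r)%N l).
Proof.
have [b0|b0] := eqVneq (block k j) 0.
  by rewrite b0 !mul0r big1 ?addr0// => r _; rewrite /tail b0 if_same mul0r.
have /andP[kj jk] := block_supp b0.
rewrite (telescope_below (fun j => Q j l) kj (ltnW jk)) mulrDr; congr (_ + _).
rewrite mulr_sumr; apply: eq_bigr => r _; rewrite /tail.
by case: ifP; rewrite ?mul0r ?mulr0.
Qed.

(** The hypothesis on [a] covers a block and all its tails at once. An empty block is treated apart,
    because closeness of [u] to the block is known only through a point where [v] does not
    vanish. *)
Let piece_bound k (a : nat -> R) (m : nat -> R) (c : R) :
  (forall j, a j = 0 \/ a j = block k j) ->
  (forall l, `|m l| <= c) -> (forall l, `|m l.+1 - m l| <= c / n%:R) ->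
  m 0%N = 0 -> m N = 0 ->
  `|\sum_(l < N) m l * dot a k l| <=
    33 * c * N%:R * (t * (\sum_(j < N) block k j ^+ 2) + G k / t).
Proof.
move=> ab mc dmc m0 mN.
have c0 : 0 <= c by apply: le_trans (mc 0%N).
have [[j jN bj]|noblock] := pselect (exists2 j, (j < N)%N & block k j != 0); last first.
  have a0 j : (j < N)%N -> a j = 0.
    move=> jN; have [//|->] := ab j; apply/eqP/negP => /negP bj.
    by apply: noblock; exists j.
  rewrite big1.
    have V0 : 0 <= \sum_(j < N) block k j ^+ 2 by apply: sumr_ge0 => j _; apply: sqr_ge0.
    have G0 : 0 <= G k.
      by apply: sumr_ge0 => i _; rewrite divr_ge0 ?sqr_ge0// addr_ge0 ?sqr_ge0.
    by rewrite normr0 mulr_ge0 ?mulr_ge0// addr_ge0 ?mulr_ge0.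
  by move=> l _; rewrite dotE big1 ?mulr0// => j _; rewrite a0// mul0r.
apply: le_trans (multiplier_bound L0 (c := (k * n)%:R) u t_gt0 mc dmc m0 mN (a := a) _) _.
  move=> i iN ai; have [a0|abi] := ab i; first by rewrite a0 eqxx in ai.
  rewrite abi in ai; have /andP[ki ik] := block_supp ai.
  by rewrite -natrB// ger0_norm// ler_nat leq_subLR ltnW.
rewrite ler_wpM2l ?mulr_ge0//; apply: lerD.
  rewrite ler_wpM2l//; apply: ler_sum => i _.
  by have [->|->//] := ab i; rewrite expr0n sqr_ge0.
rewrite ler_wpM2r //; apply: ler_sum => i _.
have [->|ui] := eqVneq (u i) 0; first by rewrite expr0n !mul0r.
rewrite ler_wpM2l ?sqr_ge0// lef_pV2 ?posrE.
(* [sg] is periodic and dominates [(i / n - k) ^ 2] only near [k * n]. By [uv_near] and [16 <= n],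
   [|i - k * n| <= N / 8], so the angle is at most [pi / 4 <= 1]. *)
- rewrite lerD2l /sg.
  have vj : v j != 0 by move: bj; rewrite /block; case: ifP; rewrite ?eqxx.
  have /andP[kj jk] := block_supp bj.
  have near_ij := uv_near (ltn_ord i) jN ui vj.
  have pi4 : pi <= 4 :> R by have := @pihalf_lt2 R; lra.
  have pi2 := @pi_ge2 R.
  have jc : `|j%:R - (k * n)%:R| <= n%:R :> R.
    by rewrite -natrB// ger0_norm// ler_nat leq_subLR ltnW.
  have nN : 16 * n%:R <= N%:R :> R by rewrite -natrM ler_nat /N leq_mul2r n_ge16 orbT.
  have ic : `|th * (i%:R - (k * n)%:R)| <= 1.
    rewrite normrM /th ger0_norm ?divr_ge0 ?mulr_ge0 ?pi_ge0//.
    rewrite mulrAC ler_pdivrMr// mul1r.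
    have := ler_normD (i%:R - j%:R : R) (j%:R - (k * n)%:R); rewrite addrA subrK => tri.
    have := normr_ge0 (i%:R - (k * n)%:R : R); nra.
  have := cos_defect_ge ic; move/(ler_wpM2l (sqr_ge0 n%:R))/(le_trans _); apply.
  have -> : n%:R ^+ 2 * ((th * (i%:R - (k * n)%:R)) ^+ 2 / 4) =
     (pi ^+ 2) * (i%:R / n%:R - k%:R) ^+ 2.
    by rewrite /th /N !natrM; field; rewrite gt_eqF.
  rewrite ler_peMl ?sqr_ge0//; nra.
- by rewrite ltr_pwDl.
- by rewrite ltr_pwDl ?sqr_ge0.
Qed.

Let sum_blocks (F : nat -> R) : \sum_(j < N) v j * F j =
  \sum_(k < n) \sum_(j < N) block k j * F j.
Proof.
rewrite exchange_big; apply: eq_bigr => j _ /=.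
have jn : (j %/ n < n)%N by rewrite ltn_divLR.
rewrite (bigD1 (Ordinal jn))//= big1 ?addr0; first by rewrite /block eqxx.
move=> k kj; rewrite /block ifN ?mul0r//; apply: contra kj => /eqP jk.
by apply/eqP/val_inj; rewrite /= jk.
Qed.

(** On each block the multiplier frozen at the left end contributes [33]; the [n] tails contribute
    [33] together, since their multipliers are [n] times smaller, in size by the difference in [j]
    and in variation by the mixed difference. Hence [66]. *)
Lemma discrete_calderon_vaillancourt :
  `|\sum_(j < N) \sum_(l < N) Q j l * v j *
     \sum_(i < N) u i * cos (th * (j%:R - i%:R) * (l%:R - L0))|
  <= 66 * mu * N%:R * (t * (\sum_(j < N) v j ^+ 2) + 8 * (\sum_(i < N) u i ^+ 2) / t).
Proof.
have mu0 : 0 <= mu by apply: le_trans (Q_le 0 0).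
pose K j l := \sum_(i < N) u i * cos (th * (j%:R - i%:R) * (l%:R - L0)).
have -> : \sum_(j < N) \sum_(l < N) Q j l * v j * K j l =
    \sum_(k < n) (\sum_(l < N) Q (k * n)%N l * dot (block k) k l
     + \sum_(r < n) \sum_(l < N) (Q (k * n + r).+1 l - Q (k * n + r)%N l) * dot (tail k r) k l).
  transitivity (\sum_(j < N) v j * \sum_(l < N) Q j l * K j l).
    by apply: eq_bigr => j _; rewrite mulr_sumr; apply: eq_bigr => l _; ring.
  rewrite (sum_blocks (fun j => \sum_(l < N) Q j l * K j l)); apply: eq_bigr => k _ /=.
  under eq_bigr do rewrite mulr_sumr.
  rewrite exchange_big /= [X in _ = _ + X]exchange_big -big_split; apply: eq_bigr => l _ /=.
  rewrite dotE mulr_sumr.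
  under [X in _ = _ + X]eq_bigr do rewrite dotE mulr_sumr.
  rewrite [X in _ = _ + X]exchange_big -big_split; apply: eq_bigr => j _ /=.
  rewrite mulrA blockD mulrDl mulr_suml; congr (_ + _); first by rewrite /K; ring.
  by apply: eq_bigr => r _; rewrite -/(K j l); ring.
apply: le_trans (ler_norm_sum _ _ _) _.
pose V k := \sum_(j < N) block k j ^+ 2.
apply: (@le_trans _ _ (\sum_(k < n) 66 * mu * N%:R * (t * V k + G k / t))).
  apply: ler_sum => k _; apply: le_trans (ler_normD _ _) _.
  have h1 : `|\sum_(l < N) Q (k * n)%N l * dot (block k) k l| <= 33 * mu * N%:R * (t * V k + G k / t).
    by apply: piece_bound => //; right.
  have h2 : `|\sum_(r < n) \sum_(l < N) (Q (k * n + r).+1 l - Q (k * n + r)%N l) * dot (tail k r) k l|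
     <= 33 * mu * N%:R * (t * V k + G k / t).
    apply: le_trans (ler_norm_sum _ _ _) _.
    apply: (@le_trans _ _ (\sum_(r < n) 33 * (mu / n%:R) * N%:R * (t * V k + G k / t))).
      apply: ler_sum => r _.
      apply: (piece_bound (m := fun l => Q (k * n + r).+1 l - Q (k * n + r)%N l)) => //.
      - by move=> j; rewrite /tail; case: ifP => _; [right|left].
      - by rewrite !Q0 subrr.
      - by rewrite !QN subrr.
    rewrite sumr_const card_ord -mulr_natr le_eqVlt; apply/orP; left; apply/eqP.
    by field; rewrite !gt_eqF.
  by lra.
rewrite -mulr_sumr ler_wpM2l ?mulr_ge0// big_split /= -mulr_sumr -mulr_suml.
apply: lerD.
  rewrite ler_wpM2l// /V exchange_big; apply: ler_sum => j _ /=.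
  have jn : (j %/ n < n)%N by rewrite ltn_divLR.
  rewrite (bigD1 (Ordinal jn))//= big1 ?addr0; first by rewrite /block eqxx.
  move=> k kj; rewrite /block ifN ?expr0n//; apply: contra kj => /eqP jk.
  by apply/eqP/val_inj; rewrite /= jk.
rewrite ler_wpM2r // /G exchange_big mulr_sumr; apply: ler_sum => i _ /=.
by rewrite -mulr_sumr mulrC ler_wpM2r ?sqr_ge0// sum_inv_sqr_le.
Qed.

End Blocks.
End DiscreteFourier.

(** * Smooth functions, grids and test functions *)

Section SmoothFunctions.
Context {R : realType}.
Implicit Types (f g : R -> R) (p : {poly R}) (x : R).
Local Open Scope classical_set_scope.

Definition smooth f := forall n x, derivable (derive1n n f) x 1.

(** Iterated derivatives are never computed: it is enough to name a class of functions stable under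
    one differentiation. *)
Lemma smooth_ind (P : (R -> R) -> Prop) :
  (forall f, P f -> exists2 g, P g & forall x, is_derive x 1 f (g x)) ->
  forall f, P f -> smooth f.
Proof.
move=> HP f Pf n; have [g Pg gE] : exists2 g, P g & derive1n n f = g.
  elim: n => [|n [g Pg gE]]; first by exists f.
  have [h Ph hE] := HP g Pg; exists h => //.
  rewrite derive1nS gE; apply/funext => x; rewrite derive1E.
  by have := hE x => ?; rewrite derive_val.
have [h _ hE] := HP g Pg.
by move=> x; rewrite gE; have := hE x => -[].
Qed.

Lemma smooth_derive f x : smooth f -> is_derive x 1 f ((derive1 f) x).
Proof. by move=> sf; rewrite derive1E; apply: derivableP; exact: (sf 0). Qed.

Lemma smooth_derive1 f : smooth f -> smooth (derive1 f).
Proof. by move=> sf n x; rewrite -derive1Sn; exact: sf. Qed.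

Lemma smooth_antiderivative f g : (forall x, is_derive x 1 f (g x)) -> smooth g -> smooth f.
Proof.
move=> fg sg; apply: (@smooth_ind (fun h => smooth h \/ h = f)); last by right.
move=> h [sh|->]; last by exists g => //; left.
by exists h^`(); [left; exact: smooth_derive1|move=> x; exact: smooth_derive].
Qed.

Lemma smooth_cvg f : smooth f -> continuous f.
Proof.
by move=> sf x; apply/differentiable_continuous/derivable1_diffP; exact: (sf 0).
Qed.

Lemma smooth_cst (c : R) : smooth (fun=> c).
Proof.
apply: (@smooth_ind (fun f => exists c, f = fun=> c)); last by exists c.
by move=> f [k ->]; exists (fun=> 0) => [|x]; [exists 0|exact: is_derive_cst].
Qed.

Lemma smoothD f g : smooth f -> smooth g -> smooth (fun x => f x + g x).
Proof.
move=> sf sg.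
apply: (@smooth_ind (fun h => exists f g, [/\ smooth f, smooth g & h = fun x => f x + g x]));
  last by exists f, g.
move=> h {f g sf sg} [f [g [sf sg ->]]].
exists (fun x => (derive1 f) x + (derive1 g) x).
  by exists (derive1 f), (derive1 g); split; [exact: smooth_derive1|exact: smooth_derive1|].
by move=> x; apply: is_deriveD; exact: smooth_derive.
Qed.

Lemma smooth_affine f (c a b : R) : smooth f -> smooth (fun x => c * f (a * x + b)).
Proof.
move=> sf.
apply: (@smooth_ind (fun h => exists f c, smooth f /\ h = fun x => c * f (a * x + b)));
  last by exists f, c.
move=> h {f sf c} [f [c [sf ->]]].
exists (fun x => c * a * (derive1 f) (a * x + b)).
  by exists (derive1 f), (c * a); split; [exact: smooth_derive1|].
move=> x; have fD := smooth_derive (a * x + b) sf.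
have aD : is_derive x 1 (fun y => a * y + b) a.
  have -> : (fun y => a * y + b) = (a *: (id : R -> R)) \+ cst b by [].
  by apply: is_derive_eq; rewrite addr0 [LHS]mulr1.
have H := is_derive1_comp (g := fun y => a * y + b) fD aD.
have Z := @is_deriveZ _ _ _ _ c x 1 _ H.
have -> : c * a * (derive1 f) (a * x + b) = c *: ((derive1 f) (a * x + b) * a).
  by rewrite /GRing.scale /=; ring.
exact: Z.
Qed.

Lemma derive1nD n f g : (forall k x, (k < n)%N -> derivable (derive1n k f) x 1) ->
  (forall k x, (k < n)%N -> derivable (derive1n k g) x 1) ->
  derive1n n (fun x => f x + g x) = fun x => derive1n n f x + derive1n n g x.
Proof.
elim: n => // n IH fD gD; rewrite derive1nS IH; first last.
- by move=> k x kn; apply: gD; rewrite ltnS ltnW.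
- by move=> k x kn; apply: fD; rewrite ltnS ltnW.
apply/funext => x; rewrite derive1E.
have h1 := derivableP (fD n x (ltnSn n)); have h2 := derivableP (gD n x (ltnSn n)).
by rewrite derive_val !derive1nS !derive1E.
Qed.

(** Products alone are not stable under differentiation, so the induction is on the order: the
    derivative is a sum of two products, each handled at the order below. *)
Lemma smoothM f g : smooth f -> smooth g -> smooth (fun x => f x * g x).
Proof.
move=> sf sg.
suff H n : forall k, (k <= n)%N -> forall f g, smooth f -> smooth g ->
    forall x, derivable (derive1n k (fun x => f x * g x)) x 1.
  by move=> n; exact: (H n).
have base f0 g0 : smooth f0 -> smooth g0 -> forall x, derivable (derive1n 0 (fun x => f0 x * g0 x)) x 1.
  move=> sf0 sg0 x; rewrite derive1n0.
  by have := is_deriveM (smooth_derive x sf0) (smooth_derive x sg0) => -[].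
elim: n => [|n IH] k kn f0 g0 sf0 sg0.
  by move: kn; rewrite leqn0 => /eqP ->; exact: base.
move: f0 g0 sf0 sg0 => {f g sf sg} f g sf sg x.
case: k kn => [_|k kn]; first exact: base.
have fD := smooth_derive1 sf; have gD := smooth_derive1 sg.
rewrite derive1Sn.
have -> : derive1 (fun x => f x * g x) = (fun x => f x * (derive1 g) x + g x * (derive1 f) x).
  apply/funext => y; rewrite derive1E.
  have h1 := smooth_derive y sf; have h2 := smooth_derive y sg.
  by rewrite derive_val.
rewrite derive1nD.
- by apply: derivableD; apply: IH.
- by move=> j y jk; apply: IH => //; exact: leq_trans (ltnW jk) kn.
- by move=> j y jk; apply: IH => //; exact: leq_trans (ltnW jk) kn.
Qed.

(** For [p = 1] the classical flat function [exp (- 1 / x)]. The polynomial in [1 / x] makes the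
    family stable under differentiation, [p] becoming [X ^ 2 * (p - p')]. *)
Definition flat p x := if x <= 0 then 0 else p.[x^-1] * expR (- x^-1).

(** With [y = 1 / x >= 1] and [d] the size of [p], [exp y >= y ^ (d + 2) / (d + 2)!] beats
    [|p y| <= B * y ^ d] with two powers to spare. The quadratic bound makes the derivative at [0]
    vanish. *)
Lemma flat_small p : exists2 K : R, 0 < K & forall x, `|x| <= 1 -> `|flat p x| <= K * x ^+ 2.
Proof.
pose B : R := \sum_(i < size p) `|p`_i|.
have B0 : 0 <= B by apply: sumr_ge0.
pose d := size p.
exists (B * (d.+2)`!%:R + 1); first by rewrite ltr_pwDr ?mulr_ge0.
move=> x x1; rewrite /flat; case: (leP x 0) => x0.
  by rewrite normr0 mulr_ge0 ?sqr_ge0// addr_ge0 ?mulr_ge0.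
rewrite gtr0_norm// in x1.
set y := x^-1; have y1 : 1 <= y by rewrite invf_ge1.
have y0 : 0 < y by rewrite invr_gt0.
have pB : `|p.[y]| <= B * y ^+ d.
  rewrite horner_coef; apply: le_trans (ler_norm_sum _ _ _) _.
  rewrite mulr_suml; apply: ler_sum => i _; rewrite normrM ler_wpM2l//.
  rewrite ger0_norm ?(exprn_ge0 _ (ltW y0))// ler_weXn2l//; exact: ltnW.
have eB : expR (- y) <= (d.+2)`!%:R / y ^+ d.+2.
  rewrite expRN -[X in _ <= X]invrK lef_pV2 ?posrE ?expR_gt0//; last first.
    by rewrite invr_gt0 divr_gt0 ?exprn_gt0// ltr0n fact_gt0.
  rewrite invf_div; apply: le_trans (expR_ge1Dxn d.+1 (ltW y0)).
  by rewrite lerDr.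
rewrite normrM [X in _ * X]ger0_norm ?expR_ge0//.
apply: le_trans (ler_pM (normr_ge0 _) (expR_ge0 _) pB eB) _.
have -> : B * y ^+ d * ((d.+2)`!%:R / y ^+ d.+2) = B * (d.+2)`!%:R * x ^+ 2.
  rewrite -[d.+2]addn2 exprD /y; field.
  by rewrite !gt_eqF ?exprn_gt0.
by rewrite ler_wpM2r ?sqr_ge0// lerDl.
Qed.

Lemma is_derive_flat p x : is_derive x 1 (flat p) (flat ('X^2 * (p - p^`())) x).
Proof.
have [x0|x0|->] := ltgtP x 0.
- rewrite /flat (ltW x0).
  apply: (near_eq_is_derive (f := cst (0 : R))).
  near=> y; rewrite /= ifT//; near: y; exact: lt_le_nbhsl.
- apply: (near_eq_is_derive (f := fun y => (horner p \o (@GRing.inv R)) y * (expR \o (fun z => - z^-1)) y)).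
    near=> y; rewrite /flat ifF//; apply/negbTE; rewrite -ltNge; near: y.
    by exists x => //= r; rewrite /ball /= ltr_norml => /andP[_]; lra.
  have iD : is_derive x 1 (@GRing.inv R) (- x ^- 2 *: 1).
    by apply: (@is_deriveV _ (id : R -> R)); rewrite gt_eqF.
  have pD := is_derive1_comp (is_derive_poly p x^-1) iD.
  have nD : is_derive x 1 (fun z : R => - z^-1) (- (- x ^- 2 *: 1)) by apply: is_deriveN.
  have eD := is_derive1_comp (g := fun z : R => - z^-1) (is_derive_expR (- x^-1)) nD.
  have MD := is_deriveM pD eD.
  have -> : flat ('X^2 * (p - p^`())) x =
      (horner p \o (@GRing.inv R)) x *: (expR (- x^-1) * - (- x ^- 2 *: 1)) +
      (expR \o (fun z : R => - z^-1)) x *: (p^`().[x^-1] * (- x ^- 2 *: 1)).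
    rewrite /flat leNgt x0 /= hornerM hornerXn hornerD hornerN exprVn [_ *: 1]mulr1.
    by rewrite /GRing.scale /=; ring.
  exact: MD.
- have [K K0 HK] := flat_small p.
  have f0 : flat p 0 = 0 by rewrite /flat lexx.
  rewrite {2}/flat lexx.
  have H : (fun h : R => h^-1 *: (((flat p) \o shift 0) (h *: 1) - flat p 0)) @ 0^' --> (0:R).
    apply/cvgrPdist_le => e e0.
    near=> h; rewrite sub0r normrN f0 subr0 /= addr0.
    have h0 : h != 0 by near: h; exact: nbhs_dnbhs_neq.
    have h1 : `|h| <= 1.
      near: h; apply: dnbhs0_le => //.
    have h2 : `|h| <= e / K.
      near: h; apply: dnbhs0_le; by rewrite divr_gt0.
    rewrite [h *: 1]mulr1 normrM normfV.
    apply: le_trans (_ : `|h|^-1 * (K * h ^+ 2) <= _).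
      by rewrite ler_wpM2l ?invr_ge0// HK.
    rewrite -[h ^+ 2]real_normK ?num_real//.
    have -> : `|h|^-1 * (K * `|h| ^+ 2) = `|h| * K by field; rewrite normr_eq0.
    by rewrite -ler_pdivlMr.
  by apply: DeriveDef; [apply/cvg_ex; exists 0|exact/cvg_lim].
Unshelve. all: by end_near. Qed.

Lemma smooth_flat p : smooth (flat p).
Proof.
apply: (@smooth_ind (fun f => exists p, f = flat p)); last by exists p.
move=> f [q ->]; exists (flat ('X^2 * (q - q^`()))); first by eexists.
exact: is_derive_flat.
Qed.

Lemma mvt f g a b : a < b -> (forall x, is_derive x 1 f (g x)) ->
  exists2 c, a < c < b & f b - f a = g c * (b - a).
Proof.
move=> ab fg.
have cf : continuous f.
  by move=> x; apply/differentiable_continuous/derivable1_diffP; have := fg x => -[].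
have [c] := @MVT R f g a b ab (fun x _ => fg x) (continuous_subspaceT cf).
by rewrite in_itv /= => cab ->; exists c.
Qed.

(** Integrating from [-oo] makes the primitive vanish on the negative axis, while the vanishing of
    [f] there reduces integrability to a segment. *)
Lemma smooth_primitive f : smooth f -> (forall x, x <= 0 -> f x = 0) ->
  exists F, [/\ smooth F, (forall x, is_derive x 1 F (f x)) & forall x, x <= 0 -> F x = 0].
Proof.
move=> sf f0; pose mu := @lebesgue_measure R.
pose F x := (\int[mu]_(t in [set` Interval -oo%O (BRight x)]) (f t))%R.
have fc := smooth_cvg sf.
have fi u : mu.-integrable [set` Interval -oo%O (BRight u)] (EFin \o f).
  apply/integrable_mkcond => //=.
  have -> : (EFin \o f) \_ [set` Interval -oo%O (BRight u)] = (EFin \o f) \_ `[0, u].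
    apply/funext => x; rewrite !patchE; have [x0|x0] := leP x 0.
      have -> : (EFin \o f) x = point by rewrite /= f0.
      by rewrite !if_same.
    congr (if _ then _ else _).
    by apply/idP/idP; rewrite !inE /= !in_itv /= (ltW x0).
  apply: (iffLR (integrable_mkcond _ _)) => //=; apply: continuous_compact_integrable.
    exact: segment_compact.
  exact: continuous_subspaceT.
have FD x : is_derive x 1 F (f x).
  have [|d dE] := @continuous_FTC1 R f -oo%O x (x + 1) (ltr_pwDr ltr01 (lexx _)) (fi _) _ (fc x).
    exact: ltNyr.
  by rewrite -dE derive1E; exact: derivableP.
exists F; split; [exact: (smooth_antiderivative FD)|exact: FD|].
move=> x x0; rewrite /F /Rintegral integral0_eq// => y /=; rewrite in_itv /= => yx.
by rewrite f0// (le_trans yx).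
Qed.

(** [S] is the normalised primitive of the bump [flat 1 x * flat 1 (1 - x)]. The second primitive
    [S1] is there so that differences of neighbouring grid bumps have compactly supported
    primitives. *)
Lemma smooth_ramp : exists S S1 : R -> R, [/\ smooth S, smooth S1,
  (forall x, is_derive x 1 S1 (S x)), (forall x, x <= 0 -> S x = 0 /\ S1 x = 0) &
  [/\ (forall x, 1 <= x -> S x = 1), {homo S : x y / x <= y} & forall x, 0 <= S x <= 1]].
Proof.
pose b x := flat 1 x * flat 1 (-1 * x + 1).
have sb : smooth b.
  apply: smoothM; first exact: smooth_flat.
  have -> : (fun x => flat 1 (-1 * x + 1)) = (fun x => 1 * flat 1 (-1 * x + 1)).
    by apply/funext => x; rewrite mul1r.
  by apply: smooth_affine; exact: smooth_flat.
have b_le0 x : x <= 0 -> b x = 0 by move=> x0; rewrite /b {1}/flat x0 mul0r.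
have b_ge1 x : 1 <= x -> b x = 0.
  by move=> x1; rewrite /b [X in _ * X]/flat ifT ?mulr0//; lra.
have flat_ge0 x : 0 <= flat 1 x by rewrite /flat; case: ifP => // _; rewrite hornerC mul1r expR_ge0.
have b_ge0 x : 0 <= b x by rewrite mulr_ge0.
have b_gt0 x : 0 < x < 1 -> 0 < b x.
  move=> /andP[x0 x1]; rewrite /b /flat leNgt x0 /= ifF.
    by rewrite !hornerC !mul1r mulr_gt0 ?expR_gt0.
  by apply/negbTE; rewrite -ltNge; lra.
have [T [sT TD T0]] := smooth_primitive sb b_le0.
have T1 : 0 < T 1.
  have [c c01] := mvt ltr01 TD; rewrite (T0 0)// !subr0 mulr1 => ->.
  exact: b_gt0.
have Th : {homo T : x y / x <= y}.
  move=> x y; rewrite le_eqVlt => /orP[/eqP->//|xy].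
  have [c _ E] := mvt xy TD; rewrite -subr_ge0 E mulr_ge0// subr_ge0 ltW//.
have TE x : 1 <= x -> T x = T 1.
  rewrite le_eqVlt => /orP[/eqP<-//|x1].
  have [c /andP[c1 _] E] := mvt x1 TD; apply/eqP; rewrite -subr_eq0 E b_ge1 ?mul0r// ltW//.
pose S x := (T 1)^-1 * T (1 * x + 0).
have SE x : S x = T x / T 1 by rewrite /S mul1r addr0 mulrC.
have sS : smooth S by exact: smooth_affine.
have S0 x : x <= 0 -> S x = 0 by move=> x0; rewrite SE T0// mul0r.
have [S1 [sS1 S1D S10]] := smooth_primitive sS S0.
have Sh : {homo S : x y / x <= y} by move=> x y xy; rewrite !SE ler_pM2r ?invr_gt0// Th.
have Sone x : 1 <= x -> S x = 1 by move=> x1; rewrite SE TE// divff// gt_eqF.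
exists S, S1; split => //; first by move=> x x0; split; [exact: S0|exact: S10].
split => // x; apply/andP; split.
  by case: (leP x 0) => x0; [rewrite S0|rewrite -(S0 0)//; apply: Sh; exact: ltW].
by case: (leP 1 x) => x1; [rewrite Sone|rewrite -(Sone 1)//; apply: Sh; exact: ltW].
Qed.

End SmoothFunctions.

(** * Integrals of dominated and boundedly supported functions *)

Section IntegralDomination.
Context {d : measure_display} {T : measurableType d} {R : realType}.
Variable m : {measure set T -> \bar R}.
Implicit Types (f g : T -> R) (A : set T).
Local Open Scope classical_set_scope.

Lemma ae_dominated f g : measurable_fun setT f -> m.-integrable setT (EFin \o g) ->
  {ae m, forall x, `|f x| <= g x} ->
  m.-integrable setT (EFin \o f) /\ `|Rintegral m setT f| <= Rintegral m setT g.
Proof.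
move=> mf ig fg.
have mg : measurable_fun setT g by apply/measurable_EFinP; case/integrableP : ig.
have g0 : {ae m, forall x, 0 <= g x}.
  by apply: filterS fg => x; apply: le_trans.
have le1 : (\int[m]_x `|f x|%:E <= \int[m]_x `|g x|%:E)%E.
  apply: ae_ge0_le_integral => //.
  - by apply/measurable_EFinP; apply: measurableT_comp.
  - by apply/measurable_EFinP; apply: measurableT_comp.
  - by apply: filterS fg => x fgx _; rewrite lee_fin (le_trans fgx)// ler_norm.
have iF : m.-integrable setT (EFin \o f).
  apply/integrableP; split; first exact/measurable_EFinP.
  by apply: le_lt_trans le1 _; case/integrableP : ig.
split=> //; apply: le_trans (le_normr_Rintegral _ iF) _ => //.
have -> : Rintegral m setT g = Rintegral m setT (fun x => `|g x|).
  congr fine; apply: ae_eq_integral => //.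
  - by case/integrableP : ig.
  - by apply/measurable_EFinP; apply: measurableT_comp.
  - by apply: filterS g0 => x gx _; rewrite ger0_norm.
rewrite /Rintegral fine_le//.
- by apply: integrable_fin_num => //; exact: (integrable_abse iF).
- by apply: integrable_fin_num => //; exact: (integrable_abse ig).
Qed.

Lemma integrable_cst_indic A (c : R) : measurable A -> (m A < +oo)%E ->
  m.-integrable setT (EFin \o (fun x => c * \1_A x)) /\
  Rintegral m setT (fun x => c * \1_A x) = c * fine (m A).
Proof.
move=> mA mAoo.
have iA : m.-integrable setT (EFin \o \1_A).
  apply/integrableP; split; first exact/measurable_EFinP/measurable_indic.
  under eq_integral do rewrite /= ger0_norm//.
  by rewrite integral_indic// setIT.
split.
  have -> : EFin \o (fun x => c * \1_A x) = (fun x => c%:E * (EFin \o \1_A) x)%E by [].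
  exact: integrableZl.
by rewrite RintegralZl// /Rintegral integral_indic// setIT.
Qed.

Lemma ae_bounded_support f A (c : R) : measurable_fun setT f -> measurable A ->
  (m A < +oo)%E -> {ae m, forall x, `|f x| <= c} -> (forall x, ~ A x -> f x = 0) ->
  m.-integrable setT (EFin \o f) /\ `|Rintegral m setT f| <= c * fine (m A).
Proof.
move=> mf mA mAoo fc fA; have [iA <-] := integrable_cst_indic c mA mAoo.
apply: ae_dominated => //; apply: filterS fc => x fx.
rewrite indicE; case: (boolP (x \in A)); first by rewrite mulr1.
by move=> /negP xA; rewrite fA ?normr0 ?mulr0// => Ax; apply: xA; rewrite inE.
Qed.

Lemma integrable_add f g : m.-integrable setT (EFin \o f) -> m.-integrable setT (EFin \o g) ->
  m.-integrable setT (EFin \o (fun x => f x + g x)).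
Proof. by move=> iF ig; rewrite (_ : _ \o _ = (EFin \o f) \+ (EFin \o g))%E//; exact: integrableD. Qed.

Lemma integrable_sub f g : m.-integrable setT (EFin \o f) -> m.-integrable setT (EFin \o g) ->
  m.-integrable setT (EFin \o (fun x => f x - g x)).
Proof. by move=> iF ig; rewrite (_ : _ \o _ = (EFin \o f) \- (EFin \o g))%E//; exact: integrableB. Qed.

Lemma integrable_scale (c : R) f : m.-integrable setT (EFin \o f) ->
  m.-integrable setT (EFin \o (fun x => c * f x)).
Proof. by move=> iF; rewrite (_ : _ \o _ = (fun x => c%:E * (EFin \o f) x)%E)//; exact: integrableZl. Qed.

Lemma integrable_sum_ord (F : nat -> T -> R) (k : nat) :
  (forall i, m.-integrable setT (EFin \o F i)) ->
  m.-integrable setT (EFin \o (fun x => \sum_(i < k) F i x)) /\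
  Rintegral m setT (fun x => \sum_(i < k) F i x) = \sum_(i < k) Rintegral m setT (F i).
Proof.
move=> iF; elim: k => [|k [IH1 IH2]].
  have -> : (fun x => \sum_(i < 0) F i x) = cst 0 by apply/funext => x; rewrite big_ord0.
  by split; [exact: integrable0|rewrite big_ord0 /Rintegral integral0].
have -> : (fun x => \sum_(i < k.+1) F i x) = (fun x => \sum_(i < k) F i x + F k x).
  by apply/funext => x; rewrite big_ord_recr.
by split; [exact: integrable_add|rewrite RintegralD// IH2 big_ord_recr].
Qed.

End IntegralDomination.

Section RealLine.
Context {R : realType}.
Local Notation mu := (@lebesgue_measure R).
Local Notation mu2 := (mu \x mu)%E.
Implicit Types (f g : R -> R) (a b c x r : R).
Local Open Scope classical_set_scope.

Lemma lebesgue_measure_segment a b : a <= b -> mu `[a, b] = (b - a)%:E.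
Proof.
move=> ab; rewrite lebesgue_measure_itv/= lte_fin; case: ltP => //.
move=> ba; have /eqP -> : a == b by rewrite eq_le ab.
by rewrite subrr.
Qed.

Definition supported f r := forall x, r < `|x| -> f x = 0.

Lemma supported_integral f r c : 0 <= r -> measurable_fun setT f ->
  (forall x, `|f x| <= c) -> supported f r ->
  mu.-integrable setT (EFin \o f) /\ `|Rintegral mu setT f| <= c * (2 * r).
Proof.
move=> r0 mf fc fr.
pose A := `[(- r), r]%classic.
have mE : mu A = (2 * r)%:E.
  by rewrite /A lebesgue_measure_segment; [congr EFin; ring|lra].
have Aoo : (mu A < +oo)%E by rewrite mE ltry.
have [|||I J] := @ae_bounded_support _ _ _ mu f A c mf _ Aoo.
- exact: measurable_itv.
- exact: aeW.
- move=> x; rewrite /A /= in_itv /= -ler_norml => /negP; rewrite -ltNge; exact: fr.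
- have K : fine (mu A) = 2 * r by rewrite mE.
  by split=> //; rewrite -[2 * r]K.
Qed.

Lemma box_integral (F : R * R -> R) a b a' b' c : a <= b -> a' <= b' ->
  measurable_fun setT F -> {ae mu2, forall z, `|F z| <= c} ->
  (forall z, ~~ [&& a <= z.1, z.1 <= b, a' <= z.2 & z.2 <= b'] -> F z = 0) ->
  mu2.-integrable setT (EFin \o F) /\
  `|Rintegral mu2 setT F| <= c * ((b - a) * (b' - a')).
Proof.
move=> ab ab' mF Fc F0; pose A := `[a, b]%classic `*` `[a', b']%classic.
have mA : measurable A by apply: measurableX; exact: measurable_itv.
have mE : (mu2 A = ((b - a) * (b' - a'))%:E)%E.
  rewrite product_measure1E; [|exact: measurable_itv|exact: measurable_itv].
  exact: (congr2 mule (lebesgue_measure_segment ab) (lebesgue_measure_segment ab')).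
have Aoo : (mu2 A < +oo)%E by rewrite mE ltry.
have [|I J] := @ae_bounded_support _ _ _ mu2 F A c mF mA Aoo Fc.
  move=> z zA; apply: F0; apply/negP => /and4P[z1 z2 z3 z4]; apply: zA.
  by split; rewrite /= in_itv /= ?z1 ?z2 ?z3 ?z4.
have K : fine (mu2 A) = (b - a) * (b' - a') by rewrite mE.
by split=> //; rewrite -[(b - a) * (b' - a')]K.
Qed.

End RealLine.

(** * Smooth partition of unity on a grid *)

Section Grid.
Context {R : realType}.
Local Notation mu := (@lebesgue_measure R).
Implicit Types (x y c e r : R) (n : nat).
Local Open Scope classical_set_scope.

Definition ramp : R -> R := sval (cid (@smooth_ramp R)).
Definition ramp1 : R -> R := sval (cid (svalP (cid (@smooth_ramp R)))).

Lemma rampP : [/\ smooth ramp, smooth ramp1,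
  (forall x, is_derive x 1 ramp1 (ramp x)), (forall x, x <= 0 -> ramp x = 0 /\ ramp1 x = 0) &
  [/\ (forall x, 1 <= x -> ramp x = 1), {homo ramp : x y / x <= y} & forall x, 0 <= ramp x <= 1]].
Proof. exact: svalP (cid (svalP (cid (@smooth_ramp R)))). Qed.

(** A smooth bump on [[-1, 1]] whose integer translates add up to [1]. Next come its primitive
    [step], and [notch], a compactly supported primitive of the difference of two neighbouring
    bumps. *)
Definition hat x := ramp (x + 1) - ramp x.
Definition step x := ramp1 (x + 1) - ramp1 x.
Definition notch x := step (x - 1) - step x.

Lemma smooth_shift (f : R -> R) c : smooth f -> smooth (fun x => f (x + c)).
Proof.
move=> sf; have -> : (fun x => f (x + c)) = (fun x => 1 * f (1 * x + c)).
  by apply/funext => x; rewrite !mul1r.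
exact: smooth_affine.
Qed.

Lemma smoothB (f g : R -> R) : smooth f -> smooth g -> smooth (fun x => f x - g x).
Proof.
move=> sf sg; have -> : (fun x => f x - g x) = (fun x => f x + (-1) * g (1 * x + 0)).
  by apply/funext => x; rewrite mulN1r mul1r addr0.
by apply: smoothD; [exact: sf|exact: smooth_affine].
Qed.

Lemma is_derive_affine (f g : R -> R) a b x : (forall x, is_derive x 1 f (g x)) ->
  is_derive x 1 (fun x => f (a * x + b)) (a * g (a * x + b)).
Proof.
move=> fg; rewrite mulrC.
have aD : is_derive x 1 (fun y => a * y + b) a.
  have -> : (fun y => a * y + b) = (a *: (id : R -> R)) \+ cst b by [].
  by apply: is_derive_eq; rewrite addr0 [LHS]mulr1.
exact: (is_derive1_comp (g := fun y => a * y + b) (fg _) aD).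
Qed.

Lemma smooth_hat : smooth hat.
Proof. by have [sr *] := rampP; apply: smoothB; [exact: smooth_shift|exact: sr]. Qed.

Lemma smooth_step : smooth step.
Proof. by have [_ sr *] := rampP; apply: smoothB; [exact: smooth_shift|exact: sr]. Qed.

Lemma smooth_notch : smooth notch.
Proof. by apply: smoothB; [apply: smooth_shift|]; exact: smooth_step. Qed.

Lemma is_derive_step x : is_derive x 1 step (hat x).
Proof.
have [_ _ D _ _] := rampP.
have := is_derive_affine 1 1 x D; rewrite mul1r.
have -> : (fun x => ramp1 (1 * x + 1)) = (fun x => ramp1 (x + 1)).
  by apply/funext => y; rewrite mul1r.
by rewrite mul1r => D1; apply: is_deriveB.
Qed.

Lemma is_derive_notch x : is_derive x 1 notch (hat (x - 1) - hat x).
Proof.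
have := is_derive_affine 1 (-1) x is_derive_step; rewrite mul1r.
have -> : (fun x => step (1 * x - 1)) = (fun x => step (x - 1)).
  by apply/funext => y; rewrite mul1r.
by rewrite mul1r => D1; have := is_derive_step x => D2; apply: is_deriveB.
Qed.

Lemma hat_bound x : 0 <= hat x <= 1.
Proof.
have [_ _ _ _ [_ h b]] := rampP; rewrite /hat subr_ge0 h ?lerDl//=.
by have := b x; have := b (x + 1); lra.
Qed.

Lemma hat_supp x : 1 <= `|x| -> hat x = 0.
Proof.
have [_ _ _ r0 [r1 _ _]] := rampP; rewrite /hat; case: (leP 0 x) => x0 xx.
  by rewrite ger0_norm// in xx; rewrite !r1 ?subrr//; lra.
rewrite ltr0_norm// in xx.
by rewrite (r0 x _).1 ?(r0 (x + 1) _).1 ?subrr//; lra.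
Qed.

Lemma step_bound x : 0 <= step x <= 1.
Proof.
have [_ _ D _ [_ _ b]] := rampP; rewrite /step.
have xx : x < x + 1 by rewrite ltrDl.
by have [c _ ->] := mvt xx D; have := b c; lra.
Qed.

Lemma step_le x : x <= -1 -> step x = 0.
Proof.
move=> x1; have [_ _ _ r0 _] := rampP.
by rewrite /step (r0 x _).2 ?(r0 (x + 1) _).2 ?subrr//; lra.
Qed.

Lemma step_ge x : 1 <= x -> step x = 1.
Proof.
move=> x1; have [_ _ D _ [r1 _ _]] := rampP; rewrite /step.
have xx : x < x + 1 by rewrite ltrDl.
by have [c /andP[cx _] ->] := mvt xx D; rewrite r1; lra.
Qed.

Lemma notch_bound x : `|notch x| <= 1.
Proof.
by rewrite /notch ler_norml; have := step_bound x; have := step_bound (x - 1); lra.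
Qed.

Lemma notch_supp x : ~~ (-1 <= x <= 2) -> notch x = 0.
Proof.
rewrite negb_and -!ltNge => /orP[x1|x2]; rewrite /notch.
  by rewrite !step_le ?subrr//; lra.
by rewrite !step_ge ?subrr//; lra.
Qed.

(* The [n * n] nodes fill [-n/2, n/2] with mesh [1/n]; as the square of the mesh is the inverse
   of their number, phases at the nodes are those of the Fourier transform on [Z/(n * n)]. *)
Definition node n (j : nat) : R := (j%:R - (n * n)%:R / 2) / n%:R.
Definition tent n (j : nat) x := hat (n%:R * x + ((n * n)%:R / 2 - j%:R)).
Definition prim n (j : nat) x := notch (n%:R * x + ((n * n)%:R / 2 - j%:R)).

Section GridLemmas.
Variables (n : nat) (n_gt0 : (0 < n)%N).
Let nR_gt0 : 0 < n%:R :> R. Proof. by rewrite ltr0n. Qed.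

Lemma nodeE x j : n%:R * x + ((n * n)%:R / 2 - j%:R) = n%:R * (x - node n j).
Proof. by rewrite /node; field; rewrite gt_eqF. Qed.

Lemma smooth_tent j : smooth (tent n j).
Proof.
have -> : tent n j = (fun x => 1 * hat (n%:R * x + ((n * n)%:R / 2 - j%:R))).
  by apply/funext => x; rewrite mul1r.
by apply: smooth_affine; exact: smooth_hat.
Qed.

Lemma smooth_prim j : smooth (prim n j).
Proof.
have -> : prim n j = (fun x => 1 * notch (n%:R * x + ((n * n)%:R / 2 - j%:R))).
  by apply/funext => x; rewrite mul1r.
by apply: smooth_affine; exact: smooth_notch.
Qed.

(* Testing a derivative of [q] against [prim] therefore differences the averages of [q]
   against [tent]. *)
Lemma is_derive_prim j x : is_derive x 1 (prim n j) (n%:R * (tent n j.+1 x - tent n j x)).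
Proof.
have := is_derive_affine n%:R ((n * n)%:R / 2 - j%:R) x is_derive_notch.
rewrite /tent; set s := n%:R * x + _; have -> // : n%:R * x + ((n * n)%:R / 2 - j.+1%:R) = s - 1.
by rewrite /s -[j.+1%:R]natr1; ring.
Qed.

Lemma tent_bound j x : 0 <= tent n j x <= 1. Proof. exact: hat_bound. Qed.
Lemma prim_bound j x : `|prim n j x| <= 1. Proof. exact: notch_bound. Qed.

Lemma tent_supp j x : n%:R^-1 <= `|x - node n j| -> tent n j x = 0.
Proof.
move=> h; rewrite /tent nodeE hat_supp// normrM gtr0_norm//.
by rewrite -ler_pdivrMl// mulr1.
Qed.

Lemma prim_supp j x : ~~ ((node n j - n%:R^-1 <= x) && (x <= node n j + 2 / n%:R)) -> prim n j x = 0.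
Proof.
move=> h; rewrite /prim nodeE notch_supp//; apply: contra h => /andP[h1 h2]; apply/andP; split.
  have ni : n%:R * n%:R^-1 = 1 :> R by rewrite divff// gt_eqF.
  by move: (n%:R^-1) ni nR_gt0 h1 => i ni n0 h1; nra.
have ni : n%:R * n%:R^-1 = 1 :> R by rewrite divff// gt_eqF.
by move: (n%:R^-1) ni nR_gt0 h2 => i ni n0 h2; nra.
Qed.

Lemma tent_supp_box j x :
  ~~ ((node n j - n%:R^-1 <= x) && (x <= node n j + 2 / n%:R)) -> tent n j x = 0.
Proof.
move=> h; apply: tent_supp; rewrite leNgt; apply: contra h; rewrite ltr_norml => /andP[h1 h2].
have : 0 < n%:R^-1 :> R by rewrite invr_gt0.
by move=> i0; apply/andP; split; lra.
Qed.

(** [hat] is a difference of ramps, so the sum telescopes to the ramps at the two ends of the grid;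
    away from the ends these are [1] and [0]. *)
Lemma sum_tent x : \sum_(j < n * n) tent n j x =
  ramp (n%:R * x + (n * n)%:R / 2 + 1) - ramp (n%:R * x + (n * n)%:R / 2 - (n * n)%:R + 1).
Proof.
set s := n%:R * x + (n * n)%:R / 2.
transitivity (\sum_(j < n * n) - (ramp (s - j.+1%:R + 1) - ramp (s - j%:R + 1))).
  apply: eq_bigr => j _; rewrite /tent /hat addrA -/s -[j.+1%:R]natr1.
  have -> : s - (j%:R + 1) + 1 = s - j%:R by ring.
  ring.
rewrite sumrN -(big_mkord xpredT (fun j => ramp (s - j.+1%:R + 1) - ramp (s - j%:R + 1))).
by rewrite (telescope_sumr (fun j => ramp (s - j%:R + 1)))// opprB subr0.
Qed.

Lemma sum_tent_bound x : 0 <= \sum_(j < n * n) tent n j x <= 1.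
Proof.
rewrite sumr_ge0/=; last by move=> j _; case/andP: (tent_bound j x).
rewrite sum_tent; have [_ _ _ _ [_ _ b]] := rampP.
by move: (b (n%:R * x + (n * n)%:R / 2 + 1)) (b (n%:R * x + (n * n)%:R / 2 - (n * n)%:R + 1)); lra.
Qed.

Lemma sum_tent_eq1 x : `|x| <= n%:R / 2 - 1 -> \sum_(j < n * n) tent n j x = 1.
Proof.
rewrite ler_norml => /andP[x1 x2]; rewrite sum_tent; have [_ _ _ r0 [r1 _ _]] := rampP.
have n1 : 1 <= n%:R :> R by rewrite ler1n.
by rewrite r1 ?(r0 _ _).1 ?subr0// natrM; nra.
Qed.

(** Tents weigh only nodes within [1 / n] of [x], and with total weight [1] wherever [F] may be
    nonzero. [F] is a number, the value at the fixed point [x], so that the node values [g] may come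
    from a different, discretised function. *)
Lemma interpolation_error1 (g : nat -> R) (F e r x : R) : r <= n%:R / 2 - 1 -> 0 <= e ->
  (forall j, (j < n * n)%N -> `|x - node n j| < n%:R^-1 -> `|g j - F| <= e) ->
  (r < `|x| -> F = 0) ->
  `|\sum_(j < n * n) g j * tent n j x - F| <= e.
Proof.
move=> rn e0 gF F0.
have -> : \sum_(j < n * n) g j * tent n j x - F =
  \sum_(j < n * n) (g j - F) * tent n j x - F * (1 - \sum_(j < n * n) tent n j x).
  under [X in _ = X - _]eq_bigr do rewrite mulrBl.
  by rewrite sumrB -mulr_sumr; ring.
have -> : F * (1 - \sum_(j < n * n) tent n j x) = 0.
  have [xr|xr] := ltP r `|x|; first by rewrite F0// mul0r.
  by rewrite sum_tent_eq1 ?subrr ?mulr0// (le_trans xr).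
rewrite subr0; apply: le_trans (ler_norm_sum _ _ _) _.
apply: (@le_trans _ _ (\sum_(j < n * n) e * tent n j x)).
  apply: ler_sum => j _; have /andP[t0 _] := tent_bound j x.
  rewrite normrM (ger0_norm t0); have [h|h] := ltP `|x - node n j| n%:R^-1.
    by rewrite ler_wpM2r// gF.
  by rewrite tent_supp// !mulr0.
by rewrite -mulr_sumr ler_piMr//; case/andP: (sum_tent_bound x).
Qed.

Lemma interpolation_error2 (g : nat -> nat -> R) (F e r x y : R) : r <= n%:R / 2 - 1 -> 0 <= e ->
  (forall j l, (j < n * n)%N -> (l < n * n)%N ->
     `|x - node n j| < n%:R^-1 -> `|y - node n l| < n%:R^-1 -> `|g j l - F| <= e) ->
  (r < `|x| -> F = 0) -> (r < `|y| -> F = 0) ->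
  `|\sum_(j < n * n) \sum_(l < n * n) g j l * (tent n j x * tent n l y) - F| <= e.
Proof.
move=> rn e0 gF F0 F0'.
have -> : \sum_(j < n * n) \sum_(l < n * n) g j l * (tent n j x * tent n l y) =
  \sum_(j < n * n) (\sum_(l < n * n) g j l * tent n l y) * tent n j x.
  apply: eq_bigr => j _; rewrite mulr_suml; apply: eq_bigr => l _; ring.
apply: (interpolation_error1 (r := r) (g := fun j => \sum_(l < n * n) g j l * tent n l y)) => // j jn xj.
by apply: (interpolation_error1 (r := r)) => // l ln yl; exact: gF.
Qed.

Lemma tent_integral j : mu.-integrable setT (EFin \o tent n j) /\
  Rintegral mu setT (tent n j) = n%:R^-1.
Proof.
pose a := node n j - n%:R^-1; pose b := node n j + n%:R^-1.
have iV : 0 < n%:R^-1 :> R by rewrite invr_gt0.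
have ab : a < b by rewrite /a /b; lra.
have ct : continuous (tent n j) by exact: smooth_cvg (@smooth_tent j).
have tE : tent n j = tent n j \_ `[a, b].
  apply/funext => x; rewrite patchE.
  have [//|/negP] := boolP (x \in `[a, b]%classic); rewrite inE /= in_itv /= => /negP h.
  apply: tent_supp; rewrite leNgt; apply: contra h; rewrite ltr_norml /a /b; lra.
have iab : mu.-integrable `[a, b] (EFin \o tent n j).
  by apply: continuous_compact_integrable; [exact: segment_compact|exact: continuous_subspaceT].
split.
  rewrite tE -restrict_EFin.
  by apply: (iffLR (integrable_mkcond _ _)) => //=.
rewrite tE -Rintegral_mkcond /Rintegral.
pose G x := n%:R^-1 * step (n%:R * x + ((n * n)%:R / 2 - j%:R)).
have GD x : is_derive x 1 G (tent n j x).
  have D := is_derive_affine n%:R ((n * n)%:R / 2 - j%:R) x is_derive_step.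
  have Z := @is_deriveZ _ _ _ _ n%:R^-1 x 1 _ D.
  have -> : tent n j x = n%:R^-1 *: (n%:R * hat (n%:R * x + ((n * n)%:R / 2 - j%:R))).
    by rewrite /GRing.scale /= mulKf// gt_eqF.
  exact: Z.
have cG : continuous G.
  by move=> x; apply/differentiable_continuous/derivable1_diffP; have := GD x => -[].
rewrite (continuous_FTC2 (F := G) ab).
- rewrite /= /G !nodeE /a /b.
  have -> : n%:R * (node n j + n%:R^-1 - node n j) = 1 by field; rewrite gt_eqF.
  have -> : n%:R * (node n j - n%:R^-1 - node n j) = -1 by field; rewrite gt_eqF.
  by rewrite step_ge// step_le// mulr0 subr0 mulr1.
- exact: continuous_subspaceT.
- split.
  + by move=> x _; have := GD x => -[].
  + exact: (cvg_at_right_filter (cG a)).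
  + exact: (cvg_at_left_filter (cG b)).
- by move=> x _; rewrite derive1E; have := GD x => ?; rewrite derive_val.
Qed.

End GridLemmas.
End Grid.

(** * Weak derivatives of order zero *)

Section DominatedConvergence.
Context {d : measure_display} {T : measurableType d} {R : realType}.
Variable m : {measure set T -> \bar R}.
Local Open Scope classical_set_scope.

Lemma Rintegral_dominated_cvg (f_ : nat -> T -> R) (f g : T -> R) :
  (forall n, measurable_fun setT (f_ n)) -> measurable_fun setT f ->
  {ae m, forall x, f_ ^~ x @ \oo --> f x} ->
  m.-integrable setT (EFin \o g) ->
  {ae m, forall x, forall n, `|f_ n x| <= g x} ->
  m.-integrable setT (EFin \o f) /\ Rintegral m setT (f_ n) @[n --> \oo] --> Rintegral m setT f.
Proof.
move=> mf_ mf f_f ig f_g.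
have [||||i _ c] := @dominated_convergence _ _ _ m setT measurableT
  (fun n => EFin \o f_ n) (EFin \o f) (EFin \o g) _ _ _ ig.
- by move=> n; exact/measurable_EFinP.
- exact/measurable_EFinP.
- by apply: filterS f_f => x fx _; apply: cvg_EFin fx; exact: nearW.
- by apply: filterS f_g => x fx n _; rewrite lee_fin.
split=> //; rewrite /Rintegral; apply: fine_cvg.
by rewrite fineK ?(integrable_fin_num _ i).
Qed.

End DominatedConvergence.

Section Density.
Context {d : measure_display} {T : measurableType d} {R : realType}.
Variable m : {measure set T -> \bar R}.
Variable f : T -> \bar R.
Hypotheses (mf : measurable_fun setT f) (f0 : forall x, (0 <= f x)%E).

(** The two proofs are arguments of the definition so that the measure structure can be attached to
    it. *)
Definition density_measure of measurable_fun setT f & (forall x, (0 <= f x)%E) :=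
  fun A => (\int[m]_(x in A) f x)%E.
Local Notation nu := (density_measure mf f0).

Let nu0 : nu set0 = 0%E. Proof. exact: integral_set0. Qed.
Let nu_ge0 A : (0 <= nu A)%E. Proof. by apply: integral_ge0 => x _; exact: f0. Qed.
Let nu_sigma : semi_sigma_additive nu.
Proof. exact: semi_sigma_additive_nng_induced. Qed.

HB.instance Definition _ := isMeasure.Build d T R nu nu0 nu_ge0 nu_sigma.

End Density.

(** * Functions whose integrals over rectangles vanish *)

Section Plane.
Context {R : realType}.
Local Notation mu := (@lebesgue_measure R).
Local Notation mu2 := (mu \x mu)%E.
Local Open Scope classical_set_scope.
Implicit Types (a b : R).

(** Half-open intervals generate the line. The whole line is added so that strips, and the plane
    itself, are among the products; the uniqueness of measures needs such a cover. *)
Let C : set (set (measurableTypeR R)) := [set A | A = setT \/ ocitv A].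

Lemma measurable_plane_generated :
  @measurable _ (measurableTypeR R * measurableTypeR R)%type =
  <<s [set A `*` B | A in C & B in C] >>.
Proof.
rewrite eqEsubset; split; last first.
  apply: smallest_sub; first exact: sigma_algebra_measurable.
  have mC A : C A -> measurable A by case=> [->//|oA]; apply: sub_sigma_algebra.
  by move=> _ [A CA [B CB <-]]; apply: measurableX; exact: mC.
set G := [set A `*` B | A in C & B in C].
apply: smallest_sub; first exact: smallest_sigma_algebra.
rewrite subUset; split.
- rewrite -g_sigma_preimageE; apply: smallest_sub; first exact: smallest_sigma_algebra.
  move=> _ [A oA <-]; apply: sub_sigma_algebra; exists A; first by right.
  by exists setT; [left|apply/seteqP; split => [z []//|z []]].
- rewrite -g_sigma_preimageE; apply: smallest_sub; first exact: smallest_sigma_algebra.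
  move=> _ [A oA <-]; apply: sub_sigma_algebra; exists setT; first by left.
  by exists A; [right|apply/seteqP; split => [z []//|z []]].
Qed.

Let plane : {measure set (measurableTypeR R * measurableTypeR R) -> \bar R} := mu2.

Lemma ae2S (P Q : R * R -> Prop) : (forall z, P z -> Q z) ->
  {ae mu2, forall z, P z} -> {ae mu2, forall z, Q z}.
Proof.
by move=> PQ; exact: (@filterS _ (almost_everywhere plane) _ [set z | P z] [set z | Q z]).
Qed.

Lemma ae2S2 (P Q S : R * R -> Prop) : (forall z, P z -> Q z -> S z) ->
  {ae mu2, forall z, P z} -> {ae mu2, forall z, Q z} -> {ae mu2, forall z, S z}.
Proof.
move=> PQ; exact: (@filterS2 _ (almost_everywhere plane) _ [set z | P z] [set z | Q z] [set z | S z]).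
Qed.

Lemma ae2_forall (P : nat -> R * R -> Prop) : (forall n, {ae mu2, forall z, P n z}) ->
  {ae mu2, forall z, forall n, P n z}.
Proof. exact: (@ae_foralln _ _ _ plane). Qed.

(** The positive and negative parts of the function are densities of two finite measures that agree
    on rectangles, a generating class stable under intersection. Hence the measures coincide, and so
    do the densities almost everywhere. *)
Lemma rectangle_vanishing_ae (F0 : R * R -> R) (r : R) :
  mu2.-integrable (`]-r, r] `*` `]-r, r]) (EFin \o F0) ->
  (forall a b a' b', Rintegral mu2 (`]a, b] `*` `]a', b']) F0 = 0) ->
  {ae mu2, forall z, (`]-r, r] `*` `]-r, r]) z -> F0 z = 0}.
Proof.
set K : set (R * R) := `]-r, r] `*` `]-r, r] => iF0 F00; pose F := F0 \_ K.
have mK : measurable K by apply: measurableX; exact: measurable_itv.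
have iF : mu2.-integrable setT (EFin \o F).
  by rewrite /F -restrict_EFin; apply: (iffLR (integrable_mkcond _ _)).
suff : {ae mu2, forall z, F z = 0}.
  by apply: ae2S => z; rewrite /F patchE => + Kz; rewrite mem_set.
have mF := measurable_int _ iF.
have mp := measurable_funepos mF; have mn := measurable_funeneg mF.
pose m1 := density_measure mu2 mp (@funepos_ge0 _ _ (EFin \o F)).
pose m2 := density_measure mu2 mn (@funeneg_ge0 _ _ (EFin \o F)).
have finp A : measurable A -> (\int[mu2]_(x in A) (EFin \o F)^\+ x)%E \is a fin_num.
  move=> mA; apply: integrable_fin_num => //; apply: integrable_funepos => //.
  exact: integrableS iF.
have finn A : measurable A -> (\int[mu2]_(x in A) (EFin \o F)^\- x)%E \is a fin_num.
  move=> mA; apply: integrable_fin_num => //; apply: integrable_funeneg => //.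
  exact: integrableS iF.
(* Intersection with []-r, r]] turns every generator, the whole line included, into a half-open
   interval, where the hypothesis applies. *)
have ocE A : C A -> exists a b, A `&` `]-r, r] = `]a, b].
  move=> CA; have [|->|[x _ ->]] := (ocitvP (A `&` `]-r, r])).1.
  - case: CA => [->|oA]; first by rewrite setTI; exact: is_ocitv.
    by apply: ocitvI => //; exact: is_ocitv.
  - by exists 0, 0; rewrite set_itvxx//.
  - by exists x.1, x.2.
have m12 A : [set A `*` B | A in C & B in C] A -> m1 A = m2 A.
  move=> GA; have mA : measurable A.
    by rewrite measurable_plane_generated; exact: sub_sigma_algebra.
  case: GA mA => X CX [Y CY <-] mA.
  have [a [b Xab]] := ocE X CX; have [a' [b' Yab]] := ocE Y CY.
  have : Rintegral mu2 (X `*` Y) F = 0.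
    rewrite -[RHS](F00 a b a' b') -Xab -Yab Rintegral_mkcond [RHS]Rintegral_mkcond.
    apply: eq_Rintegral => z _; rewrite /F !patchE.
    have [zK|zK] := boolP (z \in K).
      congr (if _ then _ else _); move: zK; rewrite inE => -[z1 z2].
      by apply/idP/idP; rewrite !inE /= => -[]; [split; split|move=> [? _] [? _]].
    rewrite if_same ifF//; apply/negP; rewrite inE => -[[_ z1] [_ z2]].
    by move/negP: zK; apply; rewrite inE; split.
  rewrite /Rintegral integralE => fine0.
  rewrite /m1 /m2 /density_measure -[LHS]fineK ?finp// -[RHS]fineK ?finn//; congr EFin.
  by apply/eqP; rewrite -subr_eq0 -fineB ?finp ?finn// fine0.
have GT : [set A `*` B | A in C & B in C] [set: R * R].
  by exists setT; [left|exists setT; [left|rewrite setXTT]].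
have m1E A : measurable A -> m1 A = m2 A.
  apply: (measure_unique [set A `*` B | A in C & B in C] (fun=> setT)) => //.
  - exact: measurable_plane_generated.
  - move=> _ _ [X CX [Y CY <-]] [X' CX' [Y' CY' <-]].
    have CI (A1 B1 : set (measurableTypeR R)) : C A1 -> C B1 -> C (A1 `&` B1).
      by move=> [->|oA] [->|oB]; rewrite ?setTI ?setIT; [left|right|right|right; exact: ocitvI].
    exists (X `&` X'); first exact: CI.
    exists (Y `&` Y'); first exact: CI.
    by rewrite setXI.
  - by rewrite bigcup_const//; exists 0%N.
  - by move=> _; rewrite -ge0_fin_numE ?finp// /m1.
have : ae_eq mu2 setT (EFin \o F)^\+%E (EFin \o F)^\-%E.
  apply: integral_ae_eq => //; first exact: integrable_funepos.
  by move=> E _ mE; exact: m1E.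
apply: filterS => z /= /(_ I) pn; have := congr1 (@^~ z) (funeposneg (EFin \o F)).
rewrite /= pn; case: ((EFin \o F)^\-%E z) => [p||] //=.
by rewrite -EFinB subrr => -[].
Qed.

End Plane.

(** * Tensor products of test functions *)

Section TestFunctions.
Context {R : realType}.
Local Notation mu := (@lebesgue_measure R).
Local Notation mu2 := (mu \x mu)%E.
Local Open Scope classical_set_scope.
Implicit Types (alpha beta : R -> R) (a b c : R) (q g : R -> R -> R).

Definition tensor alpha beta (x xi : R) := alpha x * beta xi.

Lemma dx_tensor alpha beta : smooth alpha ->
  dx (tensor alpha beta) = tensor (derive1 alpha) beta.
Proof.
move=> sa; apply/funext => x; apply/funext => xi; rewrite /dx /tensor derive1E.
have D := smooth_derive x sa.
have Z := @is_deriveZ _ _ _ _ (beta xi) x 1 _ D.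
have -> : (fun x => alpha x * beta xi) = beta xi \*: alpha.
  by apply/funext => y; rewrite mulrC.
by rewrite derive_val /GRing.scale /= mulrC.
Qed.

Lemma dxi_tensor alpha beta : smooth beta ->
  dxi (tensor alpha beta) = tensor alpha (derive1 beta).
Proof.
move=> sb; apply/funext => x; apply/funext => xi; rewrite /dxi /tensor derive1E.
have D := smooth_derive xi sb.
have Z := @is_deriveZ _ _ _ _ (alpha x) xi 1 _ D.
have -> : (fun y => alpha x * beta y) = alpha x \*: beta by [].
by rewrite derive_val.
Qed.

Lemma test2_tensor alpha beta r : smooth alpha -> smooth beta ->
  supported alpha r -> supported beta r -> test2 (tensor alpha beta).
Proof.
move=> sa sb ra rb; split; last first.
  by exists r => x xi [xr|xr]; rewrite /tensor ?(ra _ xr) ?(rb _ xr) ?mul0r ?mulr0.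
move=> w.
have [alpha' [beta' [sa' sb' ->]]] : exists alpha' beta',
    [/\ smooth alpha', smooth beta' & iterpd w (tensor alpha beta) = tensor alpha' beta'].
  elim: w => [|[] w [a' [b' [sa' sb' E]]]] /=; first by exists alpha, beta.
    exists (derive1 a'), b'; split; [exact: smooth_derive1|exact: sb'|].
    by rewrite E dx_tensor.
  exists a', (derive1 b'); split; [exact: sa'|exact: smooth_derive1|].
  by rewrite E dxi_tensor.
split.
  move=> z; apply: cvgM.
    by apply: (@cvg_comp _ _ _ fst alpha'); [exact: cvg_fst|exact: smooth_cvg].
  by apply: (@cvg_comp _ _ _ snd beta'); [exact: cvg_snd|exact: smooth_cvg].
move=> x xi; split.
  have D := smooth_derive x sa'.
  have Z := @is_deriveZ _ _ _ _ (beta' xi) x 1 _ D.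
  have -> : tensor alpha' beta' ^~ xi = beta' xi \*: alpha'.
    by apply/funext => y; rewrite /tensor mulrC.
  by case: Z.
have D := smooth_derive xi sb'.
have Z := @is_deriveZ _ _ _ _ (alpha' x) xi 1 _ D.
have -> : tensor alpha' beta' x = alpha' x \*: beta' by [].
by case: Z.
Qed.

Lemma smooth_measurable alpha : smooth alpha -> measurable_fun setT alpha.
Proof. by move=> sa; apply: continuous_measurable_fun; exact: smooth_cvg. Qed.

Lemma measurable_tensor alpha beta : measurable_fun setT alpha -> measurable_fun setT beta ->
  measurable_fun setT (fun z : R * R => tensor alpha beta z.1 z.2).
Proof.
move=> ma mb; apply: measurable_funM.
  exact: (measurableT_comp ma measurable_fst).
exact: (measurableT_comp mb measurable_snd).
Qed.

Definition box_integrable (F : R * R -> R) := measurable_fun setT F /\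
  forall r, mu2.-integrable (`[(- r), r] `*` `[(- r), r]) (EFin \o F).

Lemma locint2_box q : locint2 q -> box_integrable (fun z => q z.1 z.2).
Proof.
by move=> [mq iq]; split=> // r; apply: iq; apply: compact_setX; exact: segment_compact.
Qed.

Lemma box_integrableM (F phi : R * R -> R) r : box_integrable F ->
  measurable_fun setT phi -> (forall z, `|phi z| <= 1) ->
  (forall z, r < `|z.1| \/ r < `|z.2| -> phi z = 0) ->
  mu2.-integrable setT (EFin \o (fun z => F z * phi z)).
Proof.
move=> [mq iq] mphi phi1 phi0.
pose K : set (R * R) := `[(- r), r] `*` `[(- r), r].
have mK : measurable K by apply: measurableX; exact: measurable_itv.
have iK : mu2.-integrable setT ((EFin \o F) \_ K).
  by apply: (iffLR (integrable_mkcond _ _)) => //; exact: iq.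
apply: (le_integrable _ _ _ iK) => //.
  by apply/measurable_EFinP; exact: measurable_funM.
move=> z _ /=; rewrite patchE; case: ifPn => [_|zK].
  by rewrite /= lee_fin normrM ler_piMr.
suff -> : phi z = 0 by rewrite mulr0 normr0 abse_ge0.
apply: phi0; have [z1|z1] := ltP r `|z.1|; first by left.
have [z2|z2] := ltP r `|z.2|; first by right.
by exfalso; move/negP: zK; apply; rewrite inE; split; rewrite /= in_itv /= -ler_norml.
Qed.

(** Smooth approximation of the indicator of []a, b]]: two ramps of steepness [n + 1] starting at
    [a] and at [b]. A ramp is zero at its starting point, whence the half-open interval. *)
Definition window a b (n : nat) (x : R) : R :=
  ramp (n.+1%:R * x + - (n.+1%:R * a)) - ramp (n.+1%:R * x + - (n.+1%:R * b)).

Lemma smooth_window a b n : smooth (window a b n).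
Proof.
have [sr *] := @rampP R.
have H c : smooth (fun x => ramp (n.+1%:R * x + - (n.+1%:R * c)) : R).
  have -> : (fun x => ramp (n.+1%:R * x + - (n.+1%:R * c))) =
      (fun x => 1 * ramp (n.+1%:R * x + - (n.+1%:R * c))).
    by apply/funext => x; rewrite mul1r.
  by apply: smooth_affine; exact: sr.
by apply: smoothB; exact: H.
Qed.

Lemma window_bound a b n x : a <= b -> 0 <= window a b n x <= 1.
Proof.
move=> ab; have [_ _ _ _ [_ h k]] := @rampP R.
have n0 : 0 < n.+1%:R :> R by rewrite ltr0n.
rewrite /window subr_ge0 h /=; last by rewrite lerD2l lerN2 ler_pM2l.
by have := k (n.+1%:R * x + - (n.+1%:R * a)); have := k (n.+1%:R * x + - (n.+1%:R * b)); lra.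
Qed.

Lemma window_supp a b n x : a <= b -> x <= a \/ b + 1 <= x -> window a b n x = 0.
Proof.
move=> ab; have [_ _ _ r0 [r1 _ _]] := @rampP R.
have n1 : 1 <= n.+1%:R :> R by rewrite ler1n.
rewrite /window => -[xa|bx].
  by rewrite (r0 _ _).1 1?(r0 _ _).1 ?subrr//; nra.
by rewrite !r1 ?subrr//; nra.
Qed.

Lemma window_cvg a b (x : R) : a <= b -> window a b n x @[n --> \oo] --> (\1_`]a, b] x : R).
Proof.
move=> ab.
have [_ _ _ r0 [r1 _ _]] := @rampP R.
have H c : ramp (n.+1%:R * x + - (n.+1%:R * c)) @[n --> \oo] --> ((c < x)%R%:R : R).
  have [cx|xc] := ltP c x; last first.
    apply: cvg_near_cst; apply: nearW => n; rewrite (r0 _ _).1//.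
    by rewrite -mulrBr mulr_ge0_le0// subr_le0.
  apply: cvg_near_cst; near=> n; rewrite r1// -mulrBr.
  have : (x - c)^-1 <= n%:R by near: n; exact: nbhs_infty_ger.
  by move=> xn; rewrite -ler_pdivrMr ?subr_gt0// div1r (le_trans xn)// ler_nat.
have -> : \1_`]a, b] x = (a < x)%R%:R - (b < x)%R%:R :> R.
  rewrite indicE (_ : (x \in `]a, b]%classic) = (a < x <= b)); last first.
    by apply/idP/idP; rewrite inE /= in_itv.
  rewrite leNgt; have [|] := ltP b x => bx /=.
    by rewrite andbF (le_lt_trans ab bx) subrr.
  by rewrite andbT subr0.
exact: cvgB.
Unshelve. all: by end_near. Qed.

(** Tensor products of windows tend to the indicator of the rectangle and all live in one box, on
    which [F] is integrable; dominated convergence concludes. *)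
Lemma rectangle_eq0 (F : R * R -> R) : box_integrable F ->
  (forall alpha beta r, smooth alpha -> smooth beta -> supported alpha r -> supported beta r ->
    (forall x, `|alpha x| <= 1) -> (forall x, `|beta x| <= 1) ->
    Rintegral mu2 setT (fun z => F z * tensor alpha beta z.1 z.2) = 0) ->
  forall a b a' b', Rintegral mu2 (`]a, b] `*` `]a', b']) F = 0.
Proof.
move=> lF F0 a b a' b'.
have [ab|ba] := leP a b; last first.
  by rewrite set_itv_ge ?set0X ?Rintegral_set0// bnd_simp -leNgt ltW.
have [ab'|ba'] := leP a' b'; last first.
  have -> : `]a', b']%classic = set0 by rewrite set_itv_ge// bnd_simp -leNgt ltW.
  by rewrite setX0 Rintegral_set0.
pose r := `|a| + `|b| + `|a'| + `|b'| + 1.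
pose phi n (z : R * R) := tensor (window a b n) (window a' b' n) z.1 z.2.
have supw c e n : c <= e -> `|c| + `|e| + 1 <= r -> supported (window c e n) r.
  move=> ce cer x xr; apply: window_supp => //.
  have [|xc] := leP x c; first by left.
  right; rewrite leNgt; apply/negP => xe; move: xr; apply/negP; rewrite -leNgt.
  have := ler_norm e; have := ler_norm (- c); rewrite normrN.
  have := normr_ge0 c; have := normr_ge0 e.
  by rewrite ler_norml => *; apply/andP; split; lra.
have na := normr_ge0 a; have nb := normr_ge0 b; have na' := normr_ge0 a'; have nb' := normr_ge0 b'.
have sa n : supported (window a b n) r by apply: supw => //; rewrite /r; lra.
have sb n : supported (window a' b' n) r by apply: supw => //; rewrite /r; lra.
have sw c e n := @smooth_window c e n.
have phi1 n z : `|phi n z| <= 1.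
  have /andP[p0 p1] := window_bound n z.1 ab; have /andP[p2 p3] := window_bound n z.2 ab'.
  by rewrite /phi /tensor ger0_norm ?mulr_ge0// mulr_ile1.
have phi0 n z : r < `|z.1| \/ r < `|z.2| -> phi n z = 0.
  by rewrite /phi /tensor => -[zr|zr]; rewrite ?(sa _ _ zr) ?(sb _ _ zr) ?mul0r ?mulr0.
have mphi n : measurable_fun setT (phi n).
  by apply: measurable_tensor; apply: smooth_measurable; exact: sw.
pose K : set (R * R) := `[(- r), r] `*` `[(- r), r].
have mK : measurable K by apply: measurableX; exact: measurable_itv.
have iK : mu2.-integrable setT (EFin \o (fun z => `|F z| * \1_K z)).
  have -> : EFin \o (fun z => `|F z| * \1_K z) = (abse \o (EFin \o F)) \_ K.
    apply/funext => z; rewrite patchE /= indicE; case: ifPn => _; first by rewrite mulr1.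
    by rewrite mulr0.
  apply: (iffLR (integrable_mkcond _ _)) => //; apply: integrable_abse; exact: lF.2.
have [mF _] := lF.
pose A : set (R * R) := `]a, b] `*` `]a', b'].
have mA : measurable A by apply: measurableX; exact: measurable_itv.
have [||||_ cv] := @Rintegral_dominated_cvg _ _ _ mu2 (fun n z => F z * phi n z)
  (fun z => F z * \1_A z) (fun z => `|F z| * \1_K z) _ _ _ iK.
- by move=> n; exact: (measurable_funM mF (mphi n)).
- exact: (measurable_funM mF (measurable_indic mA)).
- apply: aeW => z; apply: cvgM; first exact: cvg_cst.
  have -> : \1_A z = \1_`]a, b] z.1 * \1_`]a', b'] z.2 :> R.
    by rewrite !indicE -natrM mulnb in_setX.
  by apply: cvgM; exact: window_cvg.
- apply: aeW => z n; rewrite normrM ler_wpM2l// indicE.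
  case: (boolP (z \in K)) => zK /=; first exact: phi1.
  rewrite phi0 ?normr0//; have [z1|z1] := ltP r `|z.1|; first by left.
  have [z2|z2] := ltP r `|z.2|; first by right.
  by exfalso; move/negP: zK; apply; rewrite inE; split; rewrite /= in_itv /= -ler_norml.
have : Rintegral mu2 setT (fun z => F z * \1_A z) = 0.
  rewrite -(cvg_lim _ cv)//; apply: lim_near_cst => //; apply: nearW => n.
  have w1 c e x : c <= e -> `|window c e n x| <= 1.
    by move=> ce; have /andP[w0 w1] := window_bound n x ce; rewrite ger0_norm.
  by apply: F0 (sw _ _ _) (sw _ _ _) (sa _) (sb _) _ _ => x; exact: w1.
move=> <-; rewrite Rintegral_mkcond; apply: eq_Rintegral => z _.
by rewrite patchE indicE -/A; case: ifP => _; rewrite ?mulr1 ?mulr0.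
Qed.

(* The test functions determine the integrals over rectangles, hence [q - g] up to a null set. *)
Lemma weak_deriv0_ae q g : weak_deriv 0 0 q g -> {ae mu2, forall z, q z.1 z.2 = g z.1 z.2}.
Proof.
move=> [lq lg qg].
pose q' (z : R * R) := q z.1 z.2; pose g' (z : R * R) := g z.1 z.2.
have bq : box_integrable q' := locint2_box lq.
have bg : box_integrable g' := locint2_box lg.
pose F z := q' z - g' z.
have bF : box_integrable F.
  split; first exact: (measurable_funB bq.1 bg.1).
  move=> r; rewrite (_ : EFin \o F = (EFin \o q') \- (EFin \o g'))%E//.
  apply: integrableB; [|exact: bq.2|exact: bg.2].
  by apply: measurableX; exact: measurable_itv.
have F0 := rectangle_eq0 bF.
have {}F0 : forall a b a' b', Rintegral mu2 (`]a, b] `*` `]a', b']) F = 0.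
  apply: F0 => alpha beta r sa sb ra rb a1 b1.
  pose phi (z : R * R) := tensor alpha beta z.1 z.2.
  have mphi : measurable_fun setT phi.
    by apply: measurable_tensor; exact: smooth_measurable.
  have phi1 z : `|phi z| <= 1 by rewrite /phi /tensor normrM mulr_ile1.
  have phi0 z : r < `|z.1| \/ r < `|z.2| -> phi z = 0.
    by rewrite /phi /tensor => -[zr|zr]; rewrite ?(ra _ zr) ?(rb _ zr) ?mul0r ?mulr0.
  have iq := box_integrableM bq mphi phi1 phi0.
  have ig := box_integrableM bg mphi phi1 phi0.
  transitivity (Rintegral mu2 setT (fun z => q' z * phi z - g' z * phi z)).
    by apply: eq_Rintegral => z _; rewrite /F mulrBl.
  rewrite RintegralB//.
  have := qg _ (test2_tensor sa sb ra rb); rewrite addn0 expr0 mul1r /= => E.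
  by apply/eqP; rewrite subr_eq0; apply/eqP.
have := ae2_forall (fun n => rectangle_vanishing_ae (r := n%:R) _ F0).
move=> H; apply: ae2S (H _) => [z Hz|n]; last first.
  apply: (integrableS _ _ _ (bF.2 n%:R)).
  - by apply: measurableX; exact: measurable_itv.
  - by apply: measurableX; exact: measurable_itv.
  - by move=> z [z1 z2]; split; [move: z1|move: z2]; rewrite /= !in_itv /= => /andP[/ltW -> ->].
have [n nz] : exists n : nat, `|z.1| + `|z.2| + 1 <= n%:R.
  by exists (Num.truncn (`|z.1| + `|z.2| + 1)).+1; rewrite ltW// truncnS_gt.
apply/eqP; rewrite -subr_eq0; apply/eqP; apply: (Hz n).
have := normr_ge0 z.1; have := normr_ge0 z.2 => z20 z10.
by split; rewrite /= in_itv /=; apply/andP; split;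
  have := ler_norm z.1; have := ler_norm (- z.1); have := ler_norm z.2;
  have := ler_norm (- z.2); rewrite !normrN; lra.
Qed.

End TestFunctions.

(** * Discretised symbols *)

Section Coefficients.
Context {R : realType}.
Local Notation mu := (@lebesgue_measure R).
Local Notation mu2 := (mu \x mu)%E.
Local Open Scope classical_set_scope.
Implicit Types (q g : R -> R -> R) (M : R).

Definition weakly_bounded (a b : nat) q M :=
  exists2 g, weak_deriv a b q g & {ae mu2, forall z, `|g z.1 z.2| <= M}.

(** [Lnorm] at exponent [+oo] is the essential supremum only on a space of positive measure. *)
Lemma plane_measure_gt0 : (0 < mu2 setT)%E.
Proof.
have mI : measurable (`[0, 1] : set (measurableTypeR R)) by exact: measurable_itv.
pose I2 : set (measurableTypeR R * measurableTypeR R) := `[0, 1] `*` `[0, 1].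
have mE : mu2 I2 = 1%E.
  rewrite product_measure1E; [|exact: mI|exact: mI].
  apply: etrans (congr2 mule (lebesgue_measure_segment ler01) (lebesgue_measure_segment ler01)) _.
  by rewrite -EFinM subr0 mulr1.
apply: (@lt_le_trans _ _ 1%E) => //; rewrite -mE.
by apply: le_measure; rewrite ?inE//; exact: measurableX.
Qed.

(** The strict inequality leaves room to choose a representative, since [weak_deriv_sup] is an
    infimum. *)
Lemma symbol_norm_weakly_bounded (a b a' b' : nat) q M : (symbol_norm a b q < M%:E)%E ->
  (a' <= a)%N -> (b' <= b)%N -> weakly_bounded a' b' q M.
Proof.
move=> qM aa bb.
have : (weak_deriv_sup a' b' q < M%:E)%E.
  apply: le_lt_trans qM; apply: ereal_sup_ubound; exists (a', b') => //=.
  by rewrite aa bb.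
move=> /ereal_inf_lt [_ /= [g wg <-]] gM; exists g => //.
move: gM; rewrite unlock /Lnorm plane_measure_gt0 => gM.
have := @ess_supP _ _ _ mu2 (abse \o (fun z : R * R => (g z.1 z.2)%:E)) M%:E.
by move=> /elimT /(_ (ltW gM)); apply: ae2S => z; rewrite /= lee_fin.
Qed.

Lemma weakly_bounded_test (a b : nat) q M (alpha beta : R -> R) (r x1 x2 y1 y2 : R) :
  weakly_bounded a b q M -> smooth alpha -> smooth beta ->
  (forall x, `|alpha x| <= 1) -> (forall x, `|beta x| <= 1) -> x1 <= x2 -> y1 <= y2 ->
  (forall x, ~~ ((x1 <= x) && (x <= x2)) -> alpha x = 0) ->
  (forall y, ~~ ((y1 <= y) && (y <= y2)) -> beta y = 0) ->
  `|Rintegral mu2 setT (fun z => q z.1 z.2 * iter a dx (iter b dxi (tensor alpha beta)) z.1 z.2)|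
    <= M * ((x2 - x1) * (y2 - y1)).
Proof.
move=> [g [lq lg qg] gM] sa sb a1 b1 x12 y12 a0 b0.
pose k := `|x1| + `|x2| + `|y1| + `|y2|.
have supp (f : R -> R) c e : `|c| + `|e| <= k -> (forall x, ~~ ((c <= x) && (x <= e)) -> f x = 0) ->
    supported f k.
  move=> cek f0 x xk; apply: f0; apply/negP => /andP[cx xe]; move: xk; apply/negP; rewrite -leNgt.
  rewrite ler_norml; have := ler_norm e; have := ler_norm (- c); rewrite normrN.
  by have := normr_ge0 c; have := normr_ge0 e => *; apply/andP; split; lra.
have nx1 := normr_ge0 x1; have nx2 := normr_ge0 x2; have ny1 := normr_ge0 y1; have ny2 := normr_ge0 y2.
have sua : supported alpha k by apply: supp a0; rewrite /k; lra.
have sub : supported beta k by apply: supp b0; rewrite /k; lra.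
have := qg _ (test2_tensor sa sb sua sub).
move=> /(congr1 (fun x => `|x|)); rewrite normrM normrX normrN1 expr1n mul1r => <-.
apply: (box_integral x12 y12 _ _ _).2.
- apply: measurable_funM; first exact: lg.1.
  by apply: measurable_tensor; exact: smooth_measurable.
- apply: ae2S gM => z gz; rewrite normrM -[leRHS]mulr1 ler_pM//.
  by rewrite /tensor normrM mulr_ile1.
- move=> z; rewrite /tensor andbA negb_and => /orP[z1|z2].
    by rewrite a0// mul0r mulr0.
  by rewrite b0// !mulr0.
Qed.

Section GridCoefficients.
Variables (q : R -> R -> R) (M : R).
Hypothesis q_le : forall a b, (a <= 1)%N -> (b <= 1)%N -> weakly_bounded a b q M.
Variables (n : nat) (n_gt0 : (0 < n)%N).
Let nR_gt0 : 0 < n%:R :> R. Proof. by rewrite ltr0n. Qed.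

(** A local average of [q] near a pair of nodes, as each tent has integral [1 / n]. Averages, unlike
    point values, have differences that weak derivatives control. *)
Definition coef (j l : nat) : R :=
  n%:R ^+ 2 * Rintegral mu2 setT (fun z => q z.1 z.2 * (tent n j z.1 * tent n l z.2)).

Let J (alpha beta : R -> R) := Rintegral mu2 setT (fun z => q z.1 z.2 * (alpha z.1 * beta z.2)).

Lemma weakly_bounded_box : box_integrable (fun z => q z.1 z.2).
Proof. by have [g [lq _ _] _] := q_le (leq0n _) (leq0n _); exact: locint2_box. Qed.

Let tent_bound1 j (x : R) : `|tent n j x| <= 1.
Proof. by have /andP[t0 t1] := tent_bound n j x; rewrite ger0_norm. Qed.

(** [9 = 3 * 3]: in each variable, [tent] and [prim] both vanish outside an interval of length
    [3 / n]. *)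
Let grid_box (alpha beta : R -> R) (a b : nat) j l : (a <= 1)%N -> (b <= 1)%N ->
  smooth alpha -> smooth beta ->
  (forall x, `|alpha x| <= 1) -> (forall x, `|beta x| <= 1) ->
  (forall x, ~~ ((node n j - n%:R^-1 <= x) && (x <= node n j + 2 / n%:R)) -> alpha x = 0) ->
  (forall x, ~~ ((node n l - n%:R^-1 <= x) && (x <= node n l + 2 / n%:R)) -> beta x = 0) ->
  `|Rintegral mu2 setT (fun z => q z.1 z.2 * iter a dx (iter b dxi (tensor alpha beta)) z.1 z.2)|
   <= 9 * M / n%:R ^+ 2.
Proof.
move=> a1 b1 sa sb alpha1 beta1 alpha0 beta0.
have i0 : 0 < n%:R^-1 :> R by rewrite invr_gt0.
have xx (c : R) : c - n%:R^-1 <= c + 2 / n%:R by lra.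
apply: le_trans (weakly_bounded_test 0 (q_le a1 b1) sa sb alpha1 beta1 (xx _) (xx _) alpha0 beta0) _.
rewrite le_eqVlt; apply/orP; left; apply/eqP.
by field; rewrite gt_eqF.
Qed.

Let derive1_prim j : derive1 (prim n j) = (fun x : R => n%:R * (tent n j.+1 x - tent n j x)).
Proof.
by apply/funext => x; rewrite derive1E; have D := is_derive_prim n j x; rewrite derive_val.
Qed.

Lemma integrable_tents j l :
  mu2.-integrable setT (EFin \o (fun z => q z.1 z.2 * (tent n j z.1 * tent n l z.2))).
Proof.
pose k : R := `|node n j| + `|node n l| + n%:R^-1.
have i0 : 0 < n%:R^-1 :> R by rewrite invr_gt0.
have nj := normr_ge0 (node n j : R); have nl := normr_ge0 (node n l : R).
apply: (box_integrableM (r := k) weakly_bounded_box).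
- by apply: measurable_tensor; apply: smooth_measurable; exact: smooth_tent.
- by move=> z; rewrite normrM mulr_ile1.
- have h i (x : R) : `|node n i| + n%:R^-1 <= k -> k < `|x| -> tent n i x = 0.
    move=> ik kx; apply: tent_supp => //.
    by have := ler_normD (x - node n i) (node n i); rewrite subrK; lra.
  move=> z [z1|z2]; first by rewrite h ?mul0r// /k; lra.
  by rewrite (h l) ?mulr0// /k; lra.
Qed.

Let iT := integrable_tents.

Let JD a1 a2 b : J (fun x : R => n%:R * (tent n a1 x - tent n a2 x)) (tent n b) =
  n%:R * (J (tent n a1) (tent n b) - J (tent n a2) (tent n b)).
Proof.
rewrite /J -RintegralB// -RintegralZl//; last exact: integrable_sub.
by apply: eq_Rintegral => z _; ring.
Qed.

Lemma coef_bound j l : `|coef j l| <= 9 * M.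
Proof.
have := @grid_box (tent n j) (tent n l) 0 0 j l isT isT (@smooth_tent _ _ _) (@smooth_tent _ _ _)
  (tent_bound1 j) (tent_bound1 l) (@tent_supp_box _ n n_gt0 j) (@tent_supp_box _ n n_gt0 l).
rewrite /= ler_pdivlMr ?exprn_gt0// mulrC; apply: le_trans.
by rewrite /coef normrM ger0_norm// exprn_ge0// ltW.
Qed.

Lemma coefDx j l : `|coef j.+1 l - coef j l| <= 9 * M / n%:R.
Proof.
have := @grid_box (prim n j) (tent n l) 1 0 j l isT isT (@smooth_prim _ _ _) (@smooth_tent _ _ _)
  (prim_bound n j) (tent_bound1 l) (@prim_supp _ n n_gt0 j) (@tent_supp_box _ n n_gt0 l).
rewrite /= dx_tensor; last exact: smooth_prim.
rewrite derive1_prim -/(J _ (tent n l)) JD => h.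
rewrite /coef -/(J (tent n j.+1) (tent n l)) -/(J (tent n j) (tent n l)) -mulrBr.
rewrite ler_pdivlMr// -[X in _ * X](ger0_norm (ltW nR_gt0)) -normrM.
move: h; rewrite ler_pdivlMr ?exprn_gt0//; apply: le_trans.
rewrite -[X in _ <= _ * X](ger0_norm (exprn_ge0 2 (ltW nR_gt0))) -normrM.
by rewrite le_eqVlt; apply/orP; left; apply/eqP; congr `|_|; ring.
Qed.

Lemma coefDxi j l : `|coef j l.+1 - coef j l| <= 9 * M / n%:R.
Proof.
have := @grid_box (tent n j) (prim n l) 0 1 j l isT isT (@smooth_tent _ _ _) (@smooth_prim _ _ _)
  (tent_bound1 j) (prim_bound n l) (@tent_supp_box _ n n_gt0 j) (@prim_supp _ n n_gt0 l).
rewrite /= dxi_tensor; last exact: smooth_prim.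
rewrite derive1_prim.
have -> : Rintegral mu2 setT (fun z => q z.1 z.2 *
     tensor (tent n j) (fun x => n%:R * (tent n l.+1 x - tent n l x)) z.1 z.2) =
  n%:R * (J (tent n j) (tent n l.+1) - J (tent n j) (tent n l)).
  rewrite /J -RintegralB// -RintegralZl//; last exact: integrable_sub.
  by apply: eq_Rintegral => z _; rewrite /tensor; ring.
move=> h.
rewrite /coef -/(J (tent n j) (tent n l.+1)) -/(J (tent n j) (tent n l)) -mulrBr.
rewrite ler_pdivlMr// -[X in _ * X](ger0_norm (ltW nR_gt0)) -normrM.
move: h; rewrite ler_pdivlMr ?exprn_gt0//; apply: le_trans.
rewrite -[X in _ <= _ * X](ger0_norm (exprn_ge0 2 (ltW nR_gt0))) -normrM.
by rewrite le_eqVlt; apply/orP; left; apply/eqP; congr `|_|; ring.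
Qed.

Lemma coefDxDxi j l :
  `|(coef j.+1 l.+1 - coef j l.+1) - (coef j.+1 l - coef j l)| <= 9 * M / n%:R / n%:R.
Proof.
have := @grid_box (prim n j) (prim n l) 1 1 j l isT isT (@smooth_prim _ _ _) (@smooth_prim _ _ _)
  (prim_bound n j) (prim_bound n l) (@prim_supp _ n n_gt0 j) (@prim_supp _ n n_gt0 l).
rewrite /= dxi_tensor ?dx_tensor; [|exact: smooth_prim|exact: smooth_prim].
rewrite !derive1_prim.
have -> : Rintegral mu2 setT (fun z => q z.1 z.2 *
     tensor (fun x => n%:R * (tent n j.+1 x - tent n j x))
            (fun x => n%:R * (tent n l.+1 x - tent n l x)) z.1 z.2) =
  n%:R ^+ 2 * ((J (tent n j.+1) (tent n l.+1) - J (tent n j) (tent n l.+1))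
             - (J (tent n j.+1) (tent n l) - J (tent n j) (tent n l))).
  have iB a b c e : mu2.-integrable setT (EFin \o (fun z : R * R =>
      q z.1 z.2 * (tent n a z.1 * tent n b z.2) - q z.1 z.2 * (tent n c z.1 * tent n e z.2))).
    exact: integrable_sub.
  rewrite /J -!RintegralB//.
  rewrite -RintegralZl//; last exact: integrable_sub.
  by apply: eq_Rintegral => z _; rewrite /tensor; ring.
rewrite /coef -/(J (tent n j) (tent n l.+1)) -/(J (tent n j) (tent n l)).
rewrite -/(J (tent n j.+1) (tent n l.+1)) -/(J (tent n j.+1) (tent n l)) -!mulrBr.
rewrite ler_pdivlMr ?exprn_gt0// => h.
rewrite -mulrA -invfM -expr2 ler_pdivlMr ?exprn_gt0//; apply: le_trans h.
Qed.

End GridCoefficients.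
End Coefficients.

(** * The bilinear estimate *)

Section CompactSmooth.
Context {R : realType}.
Local Notation mu := (@lebesgue_measure R).
Local Open Scope classical_set_scope.
Implicit Types (f g u v : R -> R) (r K x y t : R).

Lemma cos_lip x y : `|cos x - cos y| <= `|x - y|.
Proof.
wlog xy : x y / x < y.
  move=> H; have [|yx|->] := ltgtP x y; first exact: H.
    by rewrite distrC [leRHS]distrC; exact: H.
  by rewrite !subrr.
have [c _ E] := mvt xy (@is_derive_cos R).
by rewrite distrC [leRHS]distrC E normrM ler_piMl// normrN sin_max.
Qed.

Lemma sin_lip x y : `|sin x - sin y| <= `|x - y|.
Proof.
wlog xy : x y / x < y.
  move=> H; have [|yx|->] := ltgtP x y; first exact: H.
    by rewrite distrC [leRHS]distrC; exact: H.
  by rewrite !subrr.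
have [c _ E] := mvt xy (@is_derive_sin R).
by rewrite distrC [leRHS]distrC E normrM ler_piMl// cos_max.
Qed.

Lemma continuous_supported_bounded f r : continuous f -> supported f r ->
  exists2 K, 0 <= K & forall x, `|f x| <= K.
Proof.
move=> cf fr; pose k := `|r|.
have fk : supported f k by move=> x kx; apply: fr; exact: le_lt_trans (ler_norm _) kx.
have kk : - k <= k by have := normr_ge0 r; rewrite /k; lra.
have cn : {within `[(- k), k], continuous (fun x => `|f x|)}.
  apply: continuous_subspaceT => x.
  by apply: (@continuous_comp _ _ _ f (fun y => `|y|)); [exact: cf|exact: norm_continuous].
have [c _ cM] := EVT_max kk cn.
exists `|f c| => // x; have [kx|xk] := ltP k `|x|; first by rewrite fk// normr0.
by apply: cM; rewrite in_itv /= -ler_norml.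
Qed.

Lemma supported_derive1 f r : supported f r -> supported (derive1 f) r.
Proof.
move=> fr x rx; rewrite derive1E.
rewrite (@near_eq_derive _ _ _ f (cst 0)) ?derive_cst//.
exists (`|x| - r) => /= [|y]; first by rewrite subr_gt0.
rewrite /ball /= => xy; apply: fr.
by have := ler_normD (x - y) y; rewrite subrK; lra.
Qed.

Definition lip f K := forall x y, `|f x - f y| <= K * `|x - y|.

Lemma smooth_supported_lip f r : smooth f -> supported f r ->
  exists2 K, 0 <= K & (forall x, `|f x| <= K) /\ lip f K.
Proof.
move=> sf fr.
have [K1 K10 f1] := continuous_supported_bounded (smooth_cvg sf) fr.
have [K2 K20 f2] := continuous_supported_bounded (smooth_cvg (smooth_derive1 sf)) (supported_derive1 fr).
exists (K1 + K2); first by rewrite addr_ge0.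
split=> [x|x y]; first by rewrite (le_trans (f1 x))// lerDl.
have : `|f x - f y| <= K2 * `|x - y|.
  wlog xy : x y / x < y.
    move=> H; have [|yx|->] := ltgtP x y; first exact: H.
      by rewrite distrC [`|x - y|]distrC; exact: H.
    by rewrite !subrr normr0 mulr0.
  have [c _ E] := mvt xy (fun z => smooth_derive z sf).
  by rewrite distrC [`|x - y|]distrC E normrM ler_wpM2r.
by move/le_trans; apply; rewrite ler_wpM2r// lerDr.
Qed.

Lemma lip_continuous f K : lip f K -> continuous f.
Proof.
move=> fK x; apply/cvgrPdist_le => e e0.
have K1 : 0 < `|K| + 1 by rewrite ltr_pwDr.
near=> y; apply: le_trans (fK x y) _.
apply: (@le_trans _ _ ((`|K| + 1) * `|x - y|)).
  by rewrite ler_wpM2r// (le_trans (ler_norm K))// lerDl.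
rewrite -ler_pdivlMl// mulrC; near: y.
by exists (e / (`|K| + 1)); [exact: divr_gt0|move=> y /= /ltW].
Unshelve. all: by end_near. Qed.

Lemma continuous_supported_integrable f r : continuous f -> supported f r ->
  mu.-integrable setT (EFin \o f).
Proof.
move=> cf fr; have [K K0 fK] := continuous_supported_bounded cf fr.
have fr' : supported f `|r| by move=> x kx; apply: fr; exact: le_lt_trans (ler_norm _) kx.
exact: (supported_integral (normr_ge0 r) (continuous_measurable_fun cf) fK fr').1.
Qed.

(** Since a tent has integral [1 / n], the Riemann sum is the integral of the tent interpolation,
    which is within [K / n] of [f] and vanishes beyond [r + 1]. *)
Lemma riemann_sum f K r n : 0 <= r -> 0 <= K -> r <= n%:R / 2 - 1 -> lip f K -> supported f r ->
  `|Rintegral mu setT f - n%:R^-1 * \sum_(i < n * n) f (node n i)| <= K * (2 * (r + 1)) / n%:R.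
Proof.
move=> r0 K0 rn fK fr.
have n2 : 2 <= n%:R :> R by lra.
have n0 : (0 < n)%N by rewrite -(ltr0n R); lra.
have cf := lip_continuous fK.
pose P x := \sum_(i < n * n) f (node n i) * tent n i x.
have iT i : mu.-integrable setT (EFin \o (fun x => f (node n i) * tent n i x)).
  by apply: integrable_scale; exact: (tent_integral n0 i).1.
have [iP PE] : mu.-integrable setT (EFin \o P) /\
    Rintegral mu setT P = n%:R^-1 * \sum_(i < n * n) f (node n i).
  have [iP PE] := integrable_sum_ord (n * n) iT; split=> //.
  rewrite PE mulr_sumr; apply: eq_bigr => i _.
  by rewrite RintegralZl ?(tent_integral n0 i).2 1?mulrC//; exact: (tent_integral n0 i).1.
rewrite -PE -RintegralB//; last exact: continuous_supported_integrable cf fr.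
have -> : K * (2 * (r + 1)) / n%:R = (K / n%:R) * (2 * (r + 1)) by ring.
have nV0 : 0 < n%:R^-1 :> R by rewrite invr_gt0 ltr0n.
have nV1 : n%:R^-1 <= 1 :> R by rewrite invf_le1 ?ltr0n// ler1n.
have PB x : `|f x - P x| <= K / n%:R.
  rewrite distrC; apply: (interpolation_error1 n0 (r := r) (g := fun i => f (node n i))) => //.
  - by rewrite divr_ge0.
  - move=> j _ xj; rewrite distrC; apply: le_trans (fK _ _) _.
    by rewrite ler_wpM2l// ltW.
  - exact: fr.
have mP : measurable_fun setT P by apply/measurable_EFinP; case/integrableP : iP.
apply: (supported_integral _ _ PB _).2.
- by rewrite addr_ge0.
- exact: (measurable_funB (continuous_measurable_fun cf) mP).
- move=> x rx; rewrite fr; last by lra.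
  rewrite /P big1 ?subrr// => i _.
  have [h|h] := ltP `|x - node n i| n%:R^-1; last by rewrite tent_supp// mulr0.
  rewrite fr ?mul0r//.
  by have := ler_normD (x - node n i) (node n i); rewrite subrK; lra.
Qed.

(** Cosine and sine transforms: the Fourier transform of a real [u] is [ftc u - I * fts u]. *)
Definition ftc u (xi : R) := Rintegral mu setT (fun y => cos (2 * pi * y * xi) * u y).
Definition fts u (xi : R) := Rintegral mu setT (fun y => sin (2 * pi * y * xi) * u y).

Lemma integral_derivative_eq0 f g r : (forall x, is_derive x 1 f (g x)) -> continuous g ->
  supported f r -> supported g r -> Rintegral mu setT g = 0.
Proof.
move=> fg cg fr gr; pose k := `|r| + 1.
have k0 : 0 < k by rewrite ltr_pwDr.
have rk : r < k by rewrite /k (le_lt_trans (ler_norm r))// ltrDl.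
have kk : - k < k by lra.
have cf : continuous f.
  by move=> x; apply/differentiable_continuous/derivable1_diffP; have := fg x => -[].
have fk : f k = 0 by apply: fr; rewrite gtr0_norm.
have fNk : f (- k) = 0 by apply: fr; rewrite normrN gtr0_norm.
have -> : Rintegral mu setT g = Rintegral mu `[(- k), k] g.
  rewrite [RHS]Rintegral_mkcond; apply: eq_Rintegral => x _; rewrite patchE.
  case: ifPn => // /negP; rewrite inE /= in_itv /= -ler_norml => /negP; rewrite -ltNge => kx.
  by rewrite gr// (lt_trans rk).
rewrite /Rintegral (continuous_FTC2 (F := f) kk).
- by rewrite fk fNk sube0.
- exact: continuous_subspaceT.
- split.
  + by move=> x _; have := fg x => -[].
  + exact: (cvg_at_right_filter (cf (- k))).
  + exact: (cvg_at_left_filter (cf k)).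
- by move=> x _; rewrite derive1E; have := fg x => ?; rewrite derive_val.
Qed.

Let is_derive_phase (xi x : R) : is_derive x 1 (fun y => 2 * pi * y * xi) (2 * pi * xi).
Proof.
have -> : (fun y => 2 * pi * y * xi) = (fun y => (2 * pi * xi) * y).
  by apply/funext => y; ring.
rewrite -[X in is_derive _ _ _ X]mulr1.
exact: (@is_deriveZ _ _ _ (id : R -> R) (2 * pi * xi) x 1 1 (is_derive_id _ _)).
Qed.

Let continuous_phase (xi : R) : continuous (fun y : R => 2 * pi * y * xi).
Proof.
by move=> x; apply/differentiable_continuous/derivable1_diffP; have := is_derive_phase xi x => -[].
Qed.

Lemma continuous_cos_phase (xi : R) : continuous (fun y : R => cos (2 * pi * y * xi)).
Proof.
move=> x; apply: (@continuous_comp _ _ _ (fun y : R => 2 * pi * y * xi) (@cos R)).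
  exact: continuous_phase.
exact: continuous_cos.
Qed.

Lemma continuous_sin_phase (xi : R) : continuous (fun y : R => sin (2 * pi * y * xi)).
Proof.
move=> x; apply: (@continuous_comp _ _ _ (fun y : R => 2 * pi * y * xi) (@sin R)).
  exact: continuous_phase.
exact: continuous_sin.
Qed.

Let trig_integrable (h : R -> R) u r : continuous h -> smooth u -> supported u r ->
  mu.-integrable setT (EFin \o (fun y => h y * u y)).
Proof.
move=> ch su ur; apply: (@continuous_supported_integrable _ r).
  by move=> x; apply: cvgM; [exact: ch|exact: smooth_cvg].
by move=> x rx; rewrite ur// mulr0.
Qed.

Lemma integration_by_parts_supported (h h' : R -> R) u r : (forall x, is_derive x 1 h (h' x)) ->
  continuous h' -> smooth u -> supported u r ->
  Rintegral mu setT (fun x => h x * derive1 u x) = - Rintegral mu setT (fun x => h' x * u x).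
Proof.
move=> hD ch' su ur; have su' := smooth_derive1 su; have ur' := supported_derive1 ur.
have ch : continuous h.
  by move=> x; apply/differentiable_continuous/derivable1_diffP; have := hD x => -[].
pose F x := h x * u x; pose G x := h x * derive1 u x + h' x * u x.
have FG x : is_derive x 1 F (G x).
  have -> : G x = h x *: derive1 u x + u x *: h' x by rewrite /G [h' x * _]mulrC.
  exact: is_deriveM (hD x) (smooth_derive x su).
have cG : continuous G.
  by move=> x; apply: cvgD; apply: cvgM; [exact: ch|exact: smooth_cvg|exact: ch'|exact: smooth_cvg].
have Fr : supported F r by move=> x rx; rewrite /F ur// mulr0.
have Gr : supported G r by move=> x rx; rewrite /G ur// ur'// !mulr0 addr0.
have := integral_derivative_eq0 FG cG Fr Gr; rewrite /G RintegralD//.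
- by move/eqP; rewrite addr_eq0 => /eqP.
- exact: trig_integrable su' ur'.
- exact: trig_integrable su ur.
Qed.

Lemma ft_derive1 u r xi : smooth u -> supported u r ->
  ftc (derive1 u) xi = 2 * pi * xi * fts u xi /\ fts (derive1 u) xi = - (2 * pi * xi * ftc u xi).
Proof.
move=> su ur.
have Dc x : is_derive x 1 (fun y => cos (2 * pi * y * xi)) (- sin (2 * pi * x * xi) * (2 * pi * xi)).
  exact: (is_derive1_comp (g := fun y => 2 * pi * y * xi) (is_derive_cos _) (is_derive_phase xi x)).
have Ds x : is_derive x 1 (fun y => sin (2 * pi * y * xi)) (cos (2 * pi * x * xi) * (2 * pi * xi)).
  exact: (is_derive1_comp (g := fun y => 2 * pi * y * xi) (is_derive_sin _) (is_derive_phase xi x)).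
have cc := @continuous_cos_phase xi; have cs := @continuous_sin_phase xi.
split.
- rewrite /ftc (integration_by_parts_supported Dc _ su ur); last first.
    by move=> x; apply: cvgM; [apply: cvgN; exact: cs|exact: cvg_cst].
  rewrite /fts -RintegralZl//; last exact: trig_integrable cs su ur.
  rewrite -mulN1r -RintegralZl//.
    by apply: eq_Rintegral => x _; ring.
  apply: (trig_integrable (h := fun x => - sin (2 * pi * x * xi) * (2 * pi * xi)) _ su ur).
  by move=> x; apply: cvgM; [apply: cvgN; exact: cs|exact: cvg_cst].
- rewrite /fts (integration_by_parts_supported Ds _ su ur); last first.
    by move=> x; apply: cvgM; [exact: cc|exact: cvg_cst].
  rewrite /ftc -RintegralZl//; last exact: trig_integrable cc su ur.
  by congr (- _); apply: eq_Rintegral => x _; ring.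
Qed.

Let ft_bounded u r : smooth u -> supported u r ->
  exists2 K, 0 <= K & forall xi, `|ftc u xi| <= K /\ `|fts u xi| <= K.
Proof.
move=> su ur; have [K K0 uK] := continuous_supported_bounded (smooth_cvg su) ur.
have ur' : supported u `|r| by move=> x kx; apply: ur; exact: le_lt_trans (ler_norm _) kx.
exists (K * (2 * `|r|)); first by rewrite !mulr_ge0.
move=> xi; split; apply: (supported_integral _ _ _ _).2 => //.
- by apply: measurable_funM; apply: continuous_measurable_fun;
    [exact: continuous_cos_phase|exact: smooth_cvg].
- by move=> x; rewrite normrM -[leRHS]mul1r ler_pM// cos_max.
- by move=> x rx; rewrite ur' ?mulr0.
- by apply: measurable_funM; apply: continuous_measurable_fun;
    [exact: continuous_sin_phase|exact: smooth_cvg].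
- by move=> x; rewrite normrM -[leRHS]mul1r ler_pM// sin_max.
- by move=> x rx; rewrite ur' ?mulr0.
Qed.

(** Two integrations by parts bound [xi ^ 2] times the transform; the resulting integrable decay is
    what allows the frequency cutoff to be removed later. *)
Lemma ft_decay u r : smooth u -> supported u r ->
  exists2 K, 0 <= K & forall xi, `|ftc u xi| <= K / (1 + xi ^+ 2) /\ `|fts u xi| <= K / (1 + xi ^+ 2).
Proof.
move=> su ur; have su1 := smooth_derive1 su; have ur1 := supported_derive1 ur.
have [K0 K00 h0] := ft_bounded su ur.
have [K2 K20 h2] := ft_bounded (smooth_derive1 su1) (supported_derive1 ur1).
have pi1 : 1 <= 2 * pi :> R by have := @pi_ge2 R; lra.
exists (K0 + K2) => [|xi]; first by rewrite addr_ge0.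
have [e1 e2] := ft_derive1 xi su ur; have [e3 e4] := ft_derive1 xi su1 ur1.
have [c0 s0] := h0 xi; have [c2 s2] := h2 xi.
have x0 : 0 < 1 + xi ^+ 2 by rewrite ltr_pwDl ?sqr_ge0.
have xp : xi ^+ 2 <= (2 * pi * xi) ^+ 2.
  by rewrite [leRHS]exprMn ler_peMl ?sqr_ge0// exprn_ege1.
have key (w : R) : `|w| <= K0 -> `|(2 * pi * xi) ^+ 2 * w| <= K2 -> `|w| <= (K0 + K2) / (1 + xi ^+ 2).
  move=> w0; rewrite normrM ger0_norm ?sqr_ge0// => w2.
  rewrite ler_pdivlMr// mulrDr mulr1 lerD//; apply: le_trans w2.
  by rewrite mulrC ler_wpM2r.
split; apply: key => //.
- by move: c2; rewrite e3 e2 mulrN normrN mulrA -expr2.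
- by move: s2; rewrite e4 e1 normrN mulrA -expr2.
Qed.

Lemma ft_lip u r : smooth u -> supported u r -> exists K, lip (ftc u) K /\ lip (fts u) K.
Proof.
move=> su ur; have [K K0 uK] := continuous_supported_bounded (smooth_cvg su) ur.
have ur' : supported u `|r| by move=> x kx; apply: ur; exact: le_lt_trans (ler_norm _) kx.
exists (2 * pi * `|r| * K * (2 * `|r|)).
have ph0 : 0 <= 2 * pi :> R by rewrite mulr_ge0// pi_ge0.
have main (h : R -> R) : continuous h -> (forall x y, `|h x - h y| <= `|x - y|) ->
    lip (fun xi => Rintegral mu setT (fun y => h (2 * pi * y * xi) * u y)) (2 * pi * `|r| * K * (2 * `|r|)).
  move=> ch hl x y.
  have cht (z : R) : continuous (fun w => h (2 * pi * w * z)).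
    move=> w; apply: (@continuous_comp _ _ _ (fun w : R => 2 * pi * w * z) h).
      exact: continuous_phase.
    exact: ch.
  rewrite -RintegralB//; [|exact: trig_integrable su ur|exact: trig_integrable su ur].
  have -> : 2 * pi * `|r| * K * (2 * `|r|) * `|x - y| = (2 * pi * `|r| * `|x - y| * K) * (2 * `|r|) by ring.
  apply: (supported_integral _ _ _ _).2 => //.
  - by apply: continuous_measurable_fun => w; apply: cvgB; apply: cvgM; try exact: cht;
      exact: smooth_cvg.
  - move=> w; rewrite -mulrBl normrM; have [rw|rw] := ltP `|r| `|w|.
      by rewrite (ur' _ rw) normr0 mulr0 !mulr_ge0// pi_ge0.
    apply: ler_pM => //; apply: le_trans (hl _ _) _.
    have -> : 2 * pi * w * x - 2 * pi * w * y = (2 * pi) * (w * (x - y)) by ring.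
    by rewrite normrM (ger0_norm ph0) normrM -[leRHS]mulrA ler_wpM2l// ler_wpM2r.
  - by move=> w rw; rewrite ur'// !mulr0 subrr.
split; apply: main; [exact: continuous_cos|exact: cos_lip|exact: continuous_sin|exact: sin_lip].
Qed.

End CompactSmooth.

Section RealIntegral.
Context {d : measure_display} {T : measurableType d} {R : realType}.
Variable m : {measure set T -> \bar R}.
Local Open Scope classical_set_scope.

(* Unlike [RintegralZl], no integrability: when both parts of [f] have infinite
   integrals, both sides are the junk value [0]. *)
Lemma RintegralZl_measurable (c : R) (f : T -> R) : measurable_fun setT f ->
  Rintegral m setT (fun x => c * f x) = c * Rintegral m setT f.
Proof.
move=> mf; have fineZ (a : R) (p n : \bar R) : 0 <= a -> (0 <= p)%E -> (0 <= n)%E ->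
    fine (a%:E * p - a%:E * n) = a * fine (p - n).
  rewrite le_eqVlt => /orP[/eqP <-|a0]; first by rewrite !mul0e sube0 mul0r.
  case: p => [p| |] // _; case: n => [n| |] // _; rewrite ?gt0_muley ?lte_fin//= ?mulr0 ?mulrBr//.
have mE : measurable_fun setT (EFin \o f) by exact/measurable_EFinP.
have mp := measurable_funepos mE; have mn := measurable_funeneg mE.
change (fine (\int[m]_x (c%:E * (EFin \o f) x)%E) = c * fine (\int[m]_x (EFin \o f) x)).
rewrite integralE [in RHS]integralE; have [c0|c0] := leP 0 c.
  by rewrite ge0_funeposM// ge0_funenegM// !ge0_integralZl// fineZ// integral_ge0.
have c0' : 0 <= - c by rewrite oppr_ge0 ltW.
rewrite le0_funeposM ?ltW// le0_funenegM ?ltW// -EFinN !ge0_integralZl//.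
rewrite fineZ ?integral_ge0// mulNr -mulrN -fineN; congr (_ * _).
by case: (\int[m]_x _)%E => [a| |]; case: (\int[m]_x _)%E => [b| |]//=; rewrite opprB.
Qed.

End RealIntegral.

(** * Iterated integrals *)

Section PlaneSlices.
Context {R : realType}.
Local Notation mu := (@lebesgue_measure R).
Local Open Scope classical_set_scope.

(** Tonelli's theorem is applied to the positive and negative parts separately, so that slices with
    a divergent integral are covered. *)
Lemma measurable_Rintegral_snd (F : R * R -> R) : measurable_fun setT F ->
  measurable_fun setT (fun x => Rintegral mu setT (fun y => F (x, y))).
Proof.
move=> mF; have mE : measurable_fun setT (EFin \o F) by exact/measurable_EFinP.
have mp := measurable_fun_fubini_tonelli_F (m2 := mu) _ (measurable_funepos mE) (fun z => funepos_ge0 _ z).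
have mn := measurable_fun_fubini_tonelli_F (m2 := mu) _ (measurable_funeneg mE) (fun z => funeneg_ge0 _ z).
have := measurableT_comp (fine_measurable measurableT) (emeasurable_funB mp mn).
congr (measurable_fun _ _); apply/funext => x.
have -> : Rintegral mu setT (fun y => F (x, y)) = fine (\int[mu]_y ((EFin \o F) \o pair x) y) by [].
by rewrite [in RHS]integralE (funepos_comp _ (pair x)) (funeneg_comp _ (pair x)).
Qed.

Lemma measurable_slice (F : R * R -> R) x : measurable_fun setT F -> measurable_fun setT (fun y => F (x, y)).
Proof. by move=> mF; apply: measurableT_comp mF _; exact: measurable_pair1. Qed.

(** Integrability is known for the product with [v] only, and a slice [F x] may fail it where
    [v x = 0]; [v x] therefore enters the inner integral through [RintegralZl_measurable]. *)
Lemma Rintegral_iterated (v : R -> R) (F : R -> R -> R) : measurable_fun setT v ->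
  measurable_fun setT (fun z : R * R => F z.1 z.2) ->
  (mu \x mu)%E.-integrable setT (EFin \o (fun z => v z.1 * F z.1 z.2)) ->
  mu.-integrable setT (EFin \o (fun x => v x * Rintegral mu setT (F x))) /\
  Rintegral mu setT (fun x => v x * Rintegral mu setT (F x)) =
  Rintegral (mu \x mu)%E setT (fun z => v z.1 * F z.1 z.2).
Proof.
move=> mv mF iF.
pose G (x : R) : \bar R := fubini_F mu (EFin \o (fun z : R * R => v z.1 * F z.1 z.2)) x.
have iG : mu.-integrable setT G by exact: integrable_fubini_F.
have mvT : measurable_fun setT (fun x => v x * Rintegral mu setT (F x)).
  by apply: measurable_funM => //; exact: (measurable_Rintegral_snd mF).
have mE : measurable_fun setT (EFin \o (fun x => v x * Rintegral mu setT (F x))) by exact/measurable_EFinP.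
have aeE : ae_eq mu setT (EFin \o (fun x => v x * Rintegral mu setT (F x))) G.
  apply: filterS (ae_integrable1 iF) => x ix _.
  rewrite /= -RintegralZl_measurable; last exact: (measurable_slice x mF).
  by rewrite /Rintegral fineK// (integrable_fin_num _ ix).
have mG : measurable_fun setT G by exact: measurable_int iG.
split.
  apply/integrableP; split=> //.
  apply: (@le_lt_trans _ _ (\int[mu]_x `|G x|)%E); last by case/integrableP: iG.
  rewrite le_eqVlt; apply/orP; left; apply/eqP.
  have maG : measurable_fun setT (abse \o G) by exact: measurableT_comp.
  have maE := measurableT_comp (@abse_measurable R setT) mE.
  exact: (ae_eq_integral (mu := mu) _ _ measurableT maE maG (ae_eq_abse aeE)).
rewrite /Rintegral -(integral12_prod_meas1 iF); congr fine.
exact: (ae_eq_integral (mu := mu) _ _ measurableT mE mG aeE).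
Qed.

End PlaneSlices.

(** * From the grid to the bilinear form *)

Section WeakBound.
Context {R : realType}.
Local Notation mu := (@lebesgue_measure R).
Local Notation mu2 := (mu \x mu)%E.
Local Open Scope classical_set_scope.
Implicit Types (f g u v : R -> R) (r K B x y t : R).

(** A frequency cutoff, affine between [k] and [k + 1] in [|xi|]. It makes the coefficients vanish
    at both ends of the frequency grid, where the summation by parts needs it; only its size and its
    Lipschitz constant enter the bounds. *)
Definition plateau (k : R) (xi : R) : R := Num.max 0 (Num.min 1 (k + 1 - `|xi|)).

Lemma plateau_bound k xi : 0 <= plateau k xi <= 1.
Proof. by rewrite /plateau le_max lexx/= ge_max ler01/= ge_min lexx. Qed.

Lemma plateau_eq1 k xi : `|xi| <= k -> plateau k xi = 1.
Proof.
move=> h; rewrite /plateau (min_idPl _); last by lra.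
by rewrite (max_idPr _).
Qed.

Lemma plateau_eq0 k xi : k + 1 <= `|xi| -> plateau k xi = 0.
Proof.
move=> h; rewrite /plateau; apply/max_idPl; rewrite ge_min; apply/orP; right; lra.
Qed.

Lemma plateau_lip k : lip (plateau k) 1.
Proof.
have clip_lip (a b : R) : a <= b ->
    `|Num.max 0 (Num.min 1 a) - Num.max 0 (Num.min 1 b)| <= b - a.
  move=> ab; have ba : 0 <= b - a by rewrite subr_ge0.
  have m0 (c : R) : 0 <= Num.max 0 c by rewrite le_max lexx.
  rewrite distrC ger0_norm; last by rewrite subr_ge0 le_max2// le_min2.
  rewrite lerBlDr ge_max addr_ge0//=; have [a1|a1] := leP 1 a.
    by rewrite ge_min (max_idPr _)// lerDr ba.
  by rewrite ge_min; apply/orP; right; rewrite -lerBlDl opprB addrC subrK le_max lexx orbT.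
move=> x y; rewrite mul1r /plateau.
apply: le_trans (ler_dist_dist x y).
have [yx|xy] := leP `|y| `|x|.
  by rewrite [leRHS]ger0_norm ?subr_ge0//; apply: le_trans (clip_lip _ _ _) _; lra.
rewrite distrC [leRHS]ler0_norm; last by rewrite subr_le0 ltW.
by apply: le_trans (clip_lip _ _ _) _; lra.
Qed.

(** The real part of [exp (2 * pi * I * x * xi)] times the Fourier transform of [u] at [xi];
    [kernel_sum] is its Riemann sum on the grid. *)
Definition kernel u x (xi : R) := Rintegral mu setT (fun y => cos (2 * pi * (x - y) * xi) * u y).

Definition kernel_sum n u x (xi : R) : R :=
  n%:R^-1 * \sum_(i < n * n) u (node n i) * cos (2 * pi * (x - node n i) * xi).

Lemma lipM f g K L B : 0 <= K -> 0 <= L -> lip f K -> lip g L -> (forall x, `|f x| <= B) ->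
  (forall x, `|g x| <= B) -> lip (fun x => f x * g x) ((K + L) * B).
Proof.
move=> K0 L0 fK gL fB gB x y.
have -> : f x * g x - f y * g y = (f x - f y) * g x + f y * (g x - g y) by ring.
apply: le_trans (ler_normD _ _) _; rewrite !normrM.
have -> : (K + L) * B * `|x - y| = K * `|x - y| * B + B * (L * `|x - y|) by ring.
by apply: lerD; apply: ler_pM.
Qed.

Lemma phase_lip x y xi (eta : R) y0 :
  `|cos (2 * pi * (x - y0) * xi) - cos (2 * pi * (y - y0) * eta)|
   <= 2 * pi * (`|x - y| * `|xi| + `|y - y0| * `|xi - eta|).
Proof.
apply: le_trans (cos_lip _ _) _.
have -> : 2 * pi * (x - y0) * xi - 2 * pi * (y - y0) * eta =
  (2 * pi) * ((x - y) * xi + (y - y0) * (xi - eta)) by ring.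
rewrite normrM ger0_norm ?mulr_ge0 ?pi_ge0// ler_wpM2l ?mulr_ge0 ?pi_ge0//.
by apply: le_trans (ler_normD _ _) _; rewrite !normrM.
Qed.

Section Kernel.
Variables (u : R -> R) (r K : R).
Hypotheses (r0 : 0 <= r) (K0 : 0 <= K) (uK : forall x, `|u x| <= K) (u_lip : lip u K)
  (ur : supported u r).

Let twopi0 : 0 <= 2 * pi :> R. Proof. by rewrite mulr_ge0 ?pi_ge0. Qed.

Let phase_lip1 x xi : lip (fun y => cos (2 * pi * (x - y) * xi)) (2 * pi * `|xi|).
Proof.
move=> y z; apply: le_trans (cos_lip _ _) _.
have -> : 2 * pi * (x - y) * xi - 2 * pi * (x - z) * xi = (2 * pi) * (xi * (z - y)) by ring.
by rewrite normrM (ger0_norm twopi0) normrM mulrA distrC.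
Qed.

Let integrand_lip x xi : lip (fun y => cos (2 * pi * (x - y) * xi) * u y)
  ((2 * pi * `|xi| + K) * (1 + K)).
Proof.
apply: lipM => //; first by rewrite mulr_ge0.
  by move=> y; rewrite (le_trans (cos_max _))// lerDl.
by move=> y; rewrite (le_trans (uK y))// lerDr.
Qed.

Let integrand_supp x xi : supported (fun y => cos (2 * pi * (x - y) * xi) * u y) r.
Proof. by move=> y ry; rewrite ur// mulr0. Qed.

Let integrand_int x xi : mu.-integrable setT (EFin \o (fun y => cos (2 * pi * (x - y) * xi) * u y)).
Proof.
exact: continuous_supported_integrable (lip_continuous (integrand_lip x xi)) (@integrand_supp x xi).
Qed.

Lemma kernel_bound x xi : `|kernel u x xi| <= K * (2 * r).
Proof.
apply: (supported_integral r0 _ _ (@integrand_supp x xi)).2.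
  exact: continuous_measurable_fun (lip_continuous (integrand_lip x xi)).
by move=> y; rewrite normrM -[leRHS]mul1r ler_pM// cos_max.
Qed.

Lemma kernel_lip x y xi (eta : R) B : r <= B -> `|y| <= B -> `|xi| <= B ->
  `|kernel u x xi - kernel u y eta| <= 2 * pi * (2 * B) * K * (2 * r) * (`|x - y| + `|xi - eta|).
Proof.
move=> rB yB xiB; rewrite /kernel -RintegralB//.
have -> : 2 * pi * (2 * B) * K * (2 * r) * (`|x - y| + `|xi - eta|) =
  2 * pi * ((2 * B) * (`|x - y| + `|xi - eta|)) * K * (2 * r) by ring.
have B0 : 0 <= B := le_trans r0 rB.
apply: (supported_integral r0 _ _ _).2.
- by apply: continuous_measurable_fun => z; apply: cvgB;
    exact: (lip_continuous (integrand_lip _ _)).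
- move=> z; rewrite -mulrBl normrM; have [rz|zr] := ltP r `|z|.
    by rewrite ur// normr0 mulr0 !mulr_ge0 ?pi_ge0// addr_ge0.
  apply: ler_pM => //; apply: le_trans (phase_lip _ _ _ _ _) _.
  rewrite ler_wpM2l// mulrDr; apply: lerD.
    by rewrite mulrC ler_wpM2r//; lra.
  by rewrite ler_wpM2r//; have := ler_normB y z; lra.
- by move=> z rz; rewrite ur// !mulr0 subrr.
Qed.

Lemma kernel_sum_error n x xi : r <= n%:R / 2 - 1 ->
  `|kernel u x xi - kernel_sum n u x xi| <= (2 * pi * `|xi| + K) * (1 + K) * (2 * (r + 1)) / n%:R.
Proof.
move=> rn; have L0 : 0 <= (2 * pi * `|xi| + K) * (1 + K).
  by rewrite mulr_ge0// ?addr_ge0// mulr_ge0.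
have := riemann_sum r0 L0 rn (@integrand_lip x xi) (@integrand_supp x xi).
by rewrite /kernel_sum; under eq_bigr do rewrite mulrC.
Qed.

End Kernel.

Lemma kernelE u r x xi : continuous u -> supported u r ->
  kernel u x xi = cos (2 * pi * x * xi) * ftc u xi + sin (2 * pi * x * xi) * fts u xi.
Proof.
move=> cu ur.
have iF (h : R -> R) : continuous h -> mu.-integrable setT (EFin \o (fun y => h y * u y)).
  move=> ch; apply: (@continuous_supported_integrable _ _ r).
    by move=> y; apply: cvgM; [exact: ch|exact: cu].
  by move=> y ry; rewrite ur// mulr0.
have ic := iF _ (@continuous_cos_phase _ xi); have isn := iF _ (@continuous_sin_phase _ xi).
rewrite /ftc /fts -!RintegralZl// -RintegralD//; [|exact: integrable_scale|exact: integrable_scale].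
apply: eq_Rintegral => y _.
have -> : 2 * pi * (x - y) * xi = 2 * pi * x * xi - 2 * pi * y * xi by ring.
by rewrite cosB; ring.
Qed.

Lemma measurable_kernel u r : smooth u -> supported u r ->
  measurable_fun setT (fun z : R * R => kernel u z.1 z.2).
Proof.
move=> su ur; have [K [Kc Ks]] := ft_lip su ur.
have -> : (fun z : R * R => kernel u z.1 z.2) = (fun z =>
    cos (2 * pi * z.1 * z.2) * ftc u z.2 + sin (2 * pi * z.1 * z.2) * fts u z.2).
  by apply/funext => z; exact: kernelE (smooth_cvg su) ur.
have mp : measurable_fun setT (fun z : R * R => 2 * pi * z.1 * z.2).
  by apply: measurable_funM => //; exact: measurable_funM.
have mc := measurableT_comp (continuous_measurable_fun (@continuous_cos R)) mp.
have ms := measurableT_comp (continuous_measurable_fun (@continuous_sin R)) mp.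
have msnd := @measurable_snd _ _ (measurableTypeR R) (measurableTypeR R).
apply: measurable_funD; apply: measurable_funM => //.
- exact: measurableT_comp (continuous_measurable_fun (lip_continuous Kc)) msnd.
- exact: measurableT_comp (continuous_measurable_fun (lip_continuous Ks)) msnd.
Qed.

Lemma ler_add_invn (X Y C : R) n0 : (forall n, (n0 <= n)%N -> X <= Y + C / n%:R) -> X <= Y.
Proof.
move=> H; apply/ler_addgt0Pr => e e0.
pose m := Num.bound (`|C| / e); pose n := maxn n0 m.+1.
apply: (le_trans (H n (leq_maxl _ _))); rewrite lerD2l.
have mn : (m < n)%N by rewrite leq_max ltnSn orbT.
have n0' : 0 < n%:R :> R by rewrite ltr0n (leq_ltn_trans _ mn).
rewrite ler_pdivrMr// (le_trans (ler_norm C))// mulrC -ler_pdivrMr//.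
rewrite ltW// (lt_trans (archi_boundP _))//; first by rewrite divr_ge0// ltW.
by rewrite ltr_nat.
Qed.

Lemma integrable_oneDsqrV : mu.-integrable setT (EFin \o (fun xi : R => (1 + xi ^+ 2)^-1)).
Proof.
have m : measurable_fun setT (fun xi : R => (1 + xi ^+ 2)^-1).
  exact: continuous_measurable_fun (@continuous_oneDsqrV R).
have p (xi : R) : 0 <= (1 + xi ^+ 2)^-1 by rewrite invr_ge0 addr_ge0// sqr_ge0.
apply/integrableP; split; first exact/measurable_EFinP.
under eq_integral do rewrite /= ger0_norm//.
rewrite (ge0_symfun_integralT p (@continuous_oneDsqrV R)); last by move=> x; rewrite /= sqrrN.
by have := integral0y_oneDsqr R; rewrite set_itvcy /oneDsqr => ->; rewrite -EFinM ltry.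
Qed.

Lemma integrable_tensor f g : mu.-integrable setT (EFin \o f) -> mu.-integrable setT (EFin \o g) ->
  mu2.-integrable setT (EFin \o (fun z => f z.1 * g z.2)).
Proof.
move=> iF ig.
have mf : measurable_fun setT f by apply/measurable_EFinP; case/integrableP : iF.
have mg : measurable_fun setT g by apply/measurable_EFinP; case/integrableP : ig.
have mF : measurable_fun setT (EFin \o (fun z : R * R => f z.1 * g z.2)).
  by apply/measurable_EFinP; exact: (measurable_tensor mf mg).
apply/(@integrable12ltyP _ _ _ _ R mu mu _ mF).
have E x : (\int[mu]_y `|(f x * g y)%:E| = `|f x|%:E * \int[mu]_y `|(g y)%:E|)%E.
  under eq_integral do rewrite /= normrM EFinM.
  rewrite ge0_integralZl//.
  by apply/measurable_EFinP; exact: measurableT_comp.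
under eq_integral do rewrite E.
have /integrableP[_ gfin] := ig; have /integrableP[_ ffin] := iF.
rewrite ge0_integralZr//; last 2 first.
- by apply/measurable_EFinP; exact: measurableT_comp.
- exact: integral_ge0.
by apply: lte_mul_pinfty => //; [exact: integral_ge0|rewrite ge0_fin_numE// integral_ge0].
Qed.

Section WeakLimit.
Variables (q : R -> R -> R) (M : R) (u v : R -> R) (r K : R).
Hypothesis q_le : forall a b, (a <= 1)%N -> (b <= 1)%N -> weakly_bounded a b q M.
Hypotheses (r0 : 0 <= r) (K0 : 0 <= K).
Hypotheses (uK : forall x, `|u x| <= K) (u_lip : lip u K) (ur : supported u r).
Hypotheses (vK : forall x, `|v x| <= K) (v_lip : lip v K) (vr : supported v r).

Section Cutoff.
Variables (k : R) (k0 : 0 <= k).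

(** What [q] is integrated against in the form with frequency cutoff; [grid_amplitude] is its value
    at a pair of nodes, with the kernel replaced by its Riemann sum. *)
Definition amplitude x (xi : R) := v x * (plateau k xi * kernel u x xi).

Definition grid_amplitude n j l : R :=
  v (node n j) * (plateau k (node n l) * kernel_sum n u (node n j) (node n l)).

Let B := r + k + 2.

Let rkB : [/\ 0 <= B, r <= B, k + 2 <= B & r + (k + 1) <= B].
Proof. by rewrite /B; move: r0 k0 => r0' k0'; split; lra. Qed.

Let plateau_norm xi : `|plateau k xi| <= 1.
Proof. by have /andP[p0 p1] := plateau_bound k xi; rewrite ger0_norm. Qed.

(** The constant adds up the Riemann-sum error of the kernel, the displacement of the kernel by
    [1 / n] in both variables, and the displacement of [v] and of the cutoff. *)
Lemma grid_amplitude_error : exists2 C, 0 <= C & forall n x xi, (0 < n)%N -> B <= n%:R / 2 - 1 ->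
  `|\sum_(j < n * n) \sum_(l < n * n) grid_amplitude n j l * (tent n j x * tent n l xi)
    - amplitude x xi| <= C / n%:R.
Proof.
have pi0 := @pi_ge0 R.
have [B0 rB kB _] := rkB; move: (B) B0 rB kB => b b0 rb kb.
pose C1 := (2 * pi * b + K) * (1 + K) * (2 * (r + 1)) : R.
pose C2 := 2 * pi * (2 * b) * K * (2 * r) : R.
have C10 : 0 <= C1 by rewrite /C1 !mulr_ge0// ?addr_ge0// !mulr_ge0.
have C20 : 0 <= C2 by rewrite /C2 !mulr_ge0.
have C12 : 0 <= K * C1 + K * (C2 * 2).
  by apply: addr_ge0; apply: mulr_ge0 => //; exact: mulr_ge0.
have C0 : 0 <= K * C1 + K * (C2 * 2) + (K + K) * (K * (2 * r)).
  by apply: addr_ge0 => //; apply: mulr_ge0; [exact: addr_ge0|apply: mulr_ge0 => //; exact: mulr_ge0].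
exists (K * C1 + K * (C2 * 2) + (K + K) * (K * (2 * r))) => // n x xi n0 bn.
have i0 : 0 < n%:R^-1 :> R by rewrite invr_gt0 ltr0n.
have i1 : n%:R^-1 <= 1 :> R by rewrite invf_le1 ?ltr0n// ler1n.
apply: (interpolation_error2 n0 (r := b) (g := grid_amplitude n)) => //.
- by rewrite divr_ge0.
- move=> j l _ _ xj xl; rewrite /grid_amplitude /amplitude.
  set x' := node n j; set xi' := node n l; set ks := kernel_sum n u x' xi'.
  have -> : v x' * (plateau k xi' * ks) - v x * (plateau k xi * kernel u x xi) =
     v x' * plateau k xi' * (ks - kernel u x xi) +
     (v x' * plateau k xi' - v x * plateau k xi) * kernel u x xi by ring.
  rewrite [leRHS]mulrDl; apply: le_trans (ler_normD _ _) _; apply: lerD.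
    (* The kernel estimates need bounded arguments. A nonzero product places the node in the
       supports of [v] and of the cutoff, and [xi] is within [1 / n] of the node. *)
    have [->|nz] := eqVneq (v x' * plateau k xi') 0.
      by rewrite mul0r normr0; apply: mulr_ge0 => //; exact: ltW.
    have x'r : `|x'| <= r by rewrite leNgt; apply: contra nz => /vr ->; rewrite mul0r.
    have xi'k : `|xi'| <= k + 1.
      by rewrite leNgt; apply: contra nz => /ltW/plateau_eq0 ->; rewrite mulr0.
    have xiB : `|xi| <= b by have := ler_normD (xi - xi') xi'; rewrite subrK; lra.
    have x'B : `|x'| <= b by lra.
    rewrite !normrM -mulrDr -[leRHS]mulrA; apply: ler_pM => //.
      by rewrite -[leRHS]mulr1 ler_pM.
    have -> : ks - kernel u x xi = (ks - kernel u x' xi') + (kernel u x' xi' - kernel u x xi) by ring.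
    rewrite [leRHS]mulrDl; apply: le_trans (ler_normD _ _) _; apply: lerD.
      rewrite distrC; apply: le_trans (kernel_sum_error r0 K0 uK u_lip ur _ _ _) _; first lra.
      apply: ler_wpM2r; first exact: ltW.
      apply: ler_wpM2r; first by rewrite mulr_ge0// addr_ge0.
      apply: ler_wpM2r; first exact: addr_ge0.
      by rewrite lerD2r ler_wpM2l ?mulr_ge0//; lra.
    rewrite distrC; apply: le_trans (kernel_lip r0 K0 uK u_lip ur _ _ rb x'B xiB) _.
    rewrite -/C2 -[leRHS]mulrA ler_wpM2l//; lra.
  rewrite normrM mulrAC; apply: ler_pM => //; last exact: kernel_bound r0 K0 uK u_lip ur _ _.
  have -> : v x' * plateau k xi' - v x * plateau k xi =
    (v x' - v x) * plateau k xi' + v x * (plateau k xi' - plateau k xi) by ring.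
  rewrite [leRHS]mulrDl; apply: le_trans (ler_normD _ _) _; rewrite !normrM; apply: lerD.
    rewrite -[leRHS]mulr1; apply: ler_pM => //; apply: le_trans (v_lip _ _) _.
    by rewrite ler_wpM2l// distrC ltW.
  apply: ler_pM => //; apply: le_trans (plateau_lip _ _ _) _.
  by rewrite mul1r distrC ltW.
- by move=> Bx; rewrite /amplitude vr ?mul0r//; lra.
- by move=> Bx; rewrite /amplitude plateau_eq0 ?mul0r ?mulr0//; lra.
Qed.

Hypotheses (su : smooth u).

Lemma measurable_amplitude : measurable_fun setT (fun z : R * R => amplitude z.1 z.2).
Proof.
have mfst := @measurable_fst _ _ (measurableTypeR R) (measurableTypeR R).
have msnd := @measurable_snd _ _ (measurableTypeR R) (measurableTypeR R).
apply: measurable_funM.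
  exact: measurableT_comp (continuous_measurable_fun (lip_continuous v_lip)) mfst.
apply: measurable_funM; last exact: measurable_kernel su ur.
exact: measurableT_comp (continuous_measurable_fun (lip_continuous (@plateau_lip k))) msnd.
Qed.

Let q_bounded : {ae mu2, forall z, `|q z.1 z.2| <= M}.
Proof.
have [g wg gM] := q_le (leq0n _) (leq0n _).
by apply: ae2S2 (weak_deriv0_ae wg) gM => z ->.
Qed.

Let mq : measurable_fun setT (fun z : R * R => q z.1 z.2).
Proof. exact: (weakly_bounded_box q_le).1. Qed.

Section Grid.
Variables (n : nat) (n0 : (0 < n)%N).

Let iT j l : mu2.-integrable setT (EFin \o (fun z => q z.1 z.2 * (tent n j z.1 * tent n l z.2))).
Proof. exact: (integrable_tents q_le n0). Qed.

Lemma grid_integral :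
  mu2.-integrable setT (EFin \o (fun z => q z.1 z.2 *
    \sum_(j < n * n) \sum_(l < n * n) grid_amplitude n j l * (tent n j z.1 * tent n l z.2))) /\
  Rintegral mu2 setT (fun z => q z.1 z.2 *
    \sum_(j < n * n) \sum_(l < n * n) grid_amplitude n j l * (tent n j z.1 * tent n l z.2)) =
  n%:R ^- 2 * \sum_(j < n * n) \sum_(l < n * n) grid_amplitude n j l * coef q n j l.
Proof.
have -> : (fun z => q z.1 z.2 *
    \sum_(j < n * n) \sum_(l < n * n) grid_amplitude n j l * (tent n j z.1 * tent n l z.2)) =
  (fun z => \sum_(j < n * n) \sum_(l < n * n)
     grid_amplitude n j l * (q z.1 z.2 * (tent n j z.1 * tent n l z.2))).
  apply/funext => z; rewrite mulr_sumr; apply: eq_bigr => j _.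
  by rewrite mulr_sumr; apply: eq_bigr => l _; ring.
have iL (j : nat) := integrable_sum_ord (n * n) (fun l =>
  integrable_scale (grid_amplitude n j l) (iT j l)).
have [iJ ->] := integrable_sum_ord (n * n) (fun j => (iL j).1); split=> //.
rewrite mulr_sumr; apply: eq_bigr => j _; rewrite (iL j).2 mulr_sumr; apply: eq_bigr => l _.
have nz : n%:R != 0 :> R by rewrite gt_eqF// ltr0n.
rewrite RintegralZl ?iT// /coef; move: (Rintegral _ _ _) (grid_amplitude n j l) => I a.
by field.
Qed.

(** At the nodes the phase is [th * (j - i) * (l - N / 2)], so this is the discrete form with
    [L0 = N / 2]. Multiplying the coefficients by the cutoff at most doubles their bound [9 * M] and
    that of their differences: [18 = 9 + 9] and [1188 = 66 * 18]. *)
Lemma grid_integral_bound t : 0 < t -> (15 < n)%N -> 32 * r <= n%:R -> k + 1 <= n%:R / 2 ->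
  `|Rintegral mu2 setT (fun z => q z.1 z.2 *
    \sum_(j < n * n) \sum_(l < n * n) grid_amplitude n j l * (tent n j z.1 * tent n l z.2))| <=
  1188 * M * (t * (n%:R^-1 * \sum_(i < n * n) v (node n i) ^+ 2) +
    8 * (n%:R^-1 * \sum_(i < n * n) u (node n i) ^+ 2) / t).
Proof.
move=> t0 n15 rn kn; rewrite grid_integral.2.
have nR : 0 < n%:R :> R by rewrite ltr0n.
have nz : n%:R != 0 :> R by rewrite gt_eqF.
have M0 : 0 <= M.
  by have := le_trans (normr_ge0 _) (coef_bound q_le n0 0 0); rewrite pmulr_rge0.
pose Q j l := coef q n j l * plateau k (node n l).
have -> : \sum_(j < n * n) \sum_(l < n * n) grid_amplitude n j l * coef q n j l =
    n%:R^-1 * \sum_(j < n * n) \sum_(l < n * n) Q j l * v (node n j) *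
      \sum_(i < n * n) u (node n i) * cos (2 * pi / (n * n)%:R * (j%:R - i%:R) * (l%:R - (n * n)%:R / 2)).
  rewrite mulr_sumr; apply: eq_bigr => j _; rewrite mulr_sumr; apply: eq_bigr => l _.
  rewrite /grid_amplitude /kernel_sum /Q.
  under eq_bigr => i _.
    have -> : 2 * pi * (node n j - node n i) * node n l =
      2 * pi / (n * n)%:R * (j%:R - i%:R) * (l%:R - (n * n)%:R / 2) :> R.
      by rewrite /node natrM; field.
    over.
  by ring.
have pn l : `|plateau k (node n l)| <= 1 by exact: plateau_norm.
have nodeS l : node n l.+1 - node n l = n%:R^-1 :> R.
  by rewrite /node -[l.+1%:R]natr1; field.
have pS l : `|plateau k (node n l.+1) - plateau k (node n l)| <= n%:R^-1.
  by apply: le_trans (plateau_lip _ _ _) _; rewrite mul1r nodeS ger0_norm// invr_ge0 ltW.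
have i0 : 0 <= n%:R^-1 :> R by rewrite invr_ge0 ltW.
have Q_le j l : `|Q j l| <= 18 * M.
  by rewrite normrM -[leRHS]mulr1; apply: ler_pM => //; apply: le_trans (coef_bound q_le n0 _ _) _; lra.
have Qx j l : `|Q j.+1 l - Q j l| <= 18 * M / n%:R.
  rewrite -mulrBl normrM -[leRHS]mulr1; apply: ler_pM => //.
  by apply: le_trans (coefDx q_le n0 _ _) _; rewrite ler_wpM2r//; lra.
have Qxi j l : `|Q j l.+1 - Q j l| <= 18 * M / n%:R.
  have -> : Q j l.+1 - Q j l = (coef q n j l.+1 - coef q n j l) * plateau k (node n l.+1)
     + coef q n j l * (plateau k (node n l.+1) - plateau k (node n l)) by rewrite /Q; ring.
  have -> : 18 * M / n%:R = 9 * M / n%:R * 1 + 9 * M * n%:R^-1 by ring.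
  apply: le_trans (ler_normD _ _) _; apply: lerD; rewrite normrM; apply: ler_pM => //.
    exact: coefDxi.
  exact: coef_bound.
have Qxxi j l : `|Q j.+1 l.+1 - Q j l.+1 - (Q j.+1 l - Q j l)| <= 18 * M / n%:R / n%:R.
  have -> : Q j.+1 l.+1 - Q j l.+1 - (Q j.+1 l - Q j l) =
    (coef q n j.+1 l.+1 - coef q n j l.+1 - (coef q n j.+1 l - coef q n j l)) * plateau k (node n l.+1)
     + (coef q n j.+1 l - coef q n j l) * (plateau k (node n l.+1) - plateau k (node n l)).
    by rewrite /Q; ring.
  have -> : 18 * M / n%:R / n%:R = 9 * M / n%:R / n%:R * 1 + 9 * M / n%:R * n%:R^-1 by ring.
  apply: le_trans (ler_normD _ _) _; apply: lerD; rewrite normrM; apply: ler_pM => //.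
    exact: coefDxDxi.
  exact: coefDx.
have Q0 j : Q j 0 = 0.
  rewrite /Q plateau_eq0 ?mulr0// /node sub0r natrM mulNr normrN.
  have -> : n%:R * n%:R / 2 / n%:R = n%:R / 2 :> R by field.
  by rewrite ger0_norm// divr_ge0// ltW.
have QN j : Q j (n * n)%N = 0.
  rewrite /Q plateau_eq0 ?mulr0// /node natrM.
  have -> : (n%:R * n%:R - n%:R * n%:R / 2) / n%:R = n%:R / 2 :> R by field.
  by rewrite ger0_norm// divr_ge0// ltW.
have uv i j : (i < n * n)%N -> (j < n * n)%N -> u (node n i) != 0 -> v (node n j) != 0 ->
    16 * `|i%:R - j%:R| <= (n * n)%:R :> R.
  move=> _ _ ui vj.
  have ir : `|node n i| <= r by rewrite leNgt; apply: contra ui => /ur ->.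
  have jr : `|node n j| <= r by rewrite leNgt; apply: contra vj => /vr ->.
  have -> : i%:R - j%:R = n%:R * (node n i - node n j) :> R by rewrite /node; field.
  rewrite normrM (ger0_norm (ltW nR)) natrM mulrCA ler_pM2l//.
  by have := ler_normB (node n i : R) (node n j); lra.
have := discrete_calderon_vaillancourt n0 ((n * n)%:R / 2) t0 Q_le Qx Qxi Qxxi Q0 QN uv n15.
set S := \sum_(j < n * n) _; set V := \sum_(j < n * n) _; set U := \sum_(i < n * n) _ => h.
rewrite !normrM ger0_norm ?invr_ge0 ?exprn_ge0 ?(ltW nR)// (ger0_norm i0) mulrA.
have -> : 1188 * M * (t * (n%:R^-1 * V) + 8 * (n%:R^-1 * U) / t) =
  n%:R ^- 2 * n%:R^-1 * (66 * (18 * M) * (n * n)%:R * (t * V + 8 * U / t)).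
  by rewrite natrM; field; rewrite nz gt_eqF.
by rewrite ler_wpM2l// mulr_ge0// invr_ge0 exprn_ge0// ltW.
Qed.

End Grid.

Let square_sum_error f n : (forall x, `|f x| <= K) -> lip f K -> supported f r -> r <= n%:R / 2 - 1 ->
  n%:R^-1 * \sum_(i < n * n) f (node n i) ^+ 2 <=
    Rintegral mu setT (fun x => f x ^+ 2) + (K + K) * K * (2 * (r + 1)) / n%:R.
Proof.
move=> fK f_lip fr rn.
have sq_lip : lip (fun x => f x ^+ 2) ((K + K) * K) by exact: lipM.
have sq_supp : supported (fun x => f x ^+ 2) r by move=> x /fr ->; rewrite expr0n.
have KK0 : 0 <= (K + K) * K by rewrite mulr_ge0// addr_ge0.
by have := riemann_sum r0 KK0 rn sq_lip sq_supp; rewrite ler_norml => /andP[]; lra.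
Qed.

Lemma cutoff_weak_bound t : 0 < t ->
  `|Rintegral mu2 setT (fun z => q z.1 z.2 * amplitude z.1 z.2)| <=
  1188 * M * (t * Rintegral mu setT (fun x => v x ^+ 2) + 8 * Rintegral mu setT (fun x => u x ^+ 2) / t).
Proof.
move=> t0; have [C C0 HC] := grid_amplitude_error.
have [B0 rB kB rkB'] := rkB; have r0' := r0; have k0' := k0.
have M0 : 0 <= M.
  by have := le_trans (normr_ge0 _) (coef_bound q_le (ltn0Sn 0) 0 0); rewrite pmulr_rge0.
set V := Rintegral mu setT (fun x => v x ^+ 2); set U := Rintegral mu setT (fun x => u x ^+ 2).
pose Cs := (K + K) * K * (2 * (r + 1)) : R.
pose b := B + 1.
(* [16] is required by the blocks, [32 * r] by the closeness of the supports, and the rest keeps the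
   supports inside the grid. The error of order [1 / n] below gathers the interpolation error on a
   box of side [2 * b] and the Riemann-sum errors of the two square integrals. *)
pose n0 := maxn 16 (Num.bound (32 * r + 2 * B + 4)).
apply: (@ler_add_invn _ _ (M * C * ((b - - b) * (b - - b)) + 1188 * M * (t * Cs + 8 * Cs / t)) n0) => n.
rewrite geq_max => /andP[n16 nb].
have n_gt0 : (0 < n)%N by exact: leq_trans n16.
have nR : 32 * r + 2 * B + 4 <= n%:R.
  apply: le_trans (ltW (archi_boundP _)) _; last by rewrite ler_nat.
  by rewrite !addr_ge0// mulr_ge0.
have Bn : B <= n%:R / 2 - 1 by lra.
pose Psi z := \sum_(j < n * n) \sum_(l < n * n) grid_amplitude n j l * (tent n j z.1 * tent n l z.2).
have [iPsi _] := grid_integral n_gt0.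
have PsiB : `|Rintegral mu2 setT (fun z => q z.1 z.2 * Psi z)| <=
    1188 * M * (t * (V + Cs / n%:R) + 8 * (U + Cs / n%:R) / t).
  apply: le_trans (grid_integral_bound n_gt0 t0 n16 _ _) _.
  - by lra.
  - by lra.
  - have rn : r <= n%:R / 2 - 1 by lra.
    apply: ler_wpM2l; first by apply: mulr_ge0 M0; exact: ler0n.
    apply: lerD; first by rewrite ler_pM2l//; exact: (square_sum_error vK v_lip vr rn).
    by rewrite ler_pM2r ?invr_gt0// ler_pM2l//; exact: (square_sum_error uK u_lip ur rn).
have i1 : n%:R^-1 <= 1 :> R by rewrite invf_le1 ?ltr0n// ler1n.
pose D z := q z.1 z.2 * amplitude z.1 z.2 - q z.1 z.2 * Psi z.
have bb : - b <= b by rewrite /b; lra.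
have [iD DB] : mu2.-integrable setT (EFin \o D) /\
    `|Rintegral mu2 setT D| <= M * (C / n%:R) * ((b - - b) * (b - - b)).
  apply: box_integral => //.
  - apply: measurable_funB; first exact: (measurable_funM mq measurable_amplitude).
    by apply/measurable_EFinP; case/integrableP : iPsi.
  - apply: ae2S q_bounded => z qM; rewrite /D -mulrBr normrM; apply: ler_pM => //.
    by rewrite distrC; exact: HC.
  - move=> z; rewrite andbA negb_and -!ler_norml -!ltNge => h.
    have out : r + 1 < `|z.1| \/ k + 2 < `|z.2| by case/orP: h => h; [left|right]; rewrite /b in h; lra.
    rewrite /D; have -> : Psi z = 0.
      rewrite /Psi big1// => j _; rewrite big1// => l _.
      have [tj|tj] := leP n%:R^-1 `|z.1 - node n j|; first by rewrite tent_supp// mul0r mulr0.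
      have [tl|tl] := leP n%:R^-1 `|z.2 - node n l|; first by rewrite [tent n l _]tent_supp// !mulr0.
      have h1 := ler_normD (z.1 - node n j) (node n j); have h2 := ler_normD (z.2 - node n l) (node n l).
      rewrite !subrK in h1 h2; rewrite /grid_amplitude; case: out => out.
        by rewrite vr ?mul0r//; lra.
      by rewrite plateau_eq0 ?mul0r ?mulr0 ?mul0r//; lra.
    rewrite mulr0 subr0 /amplitude; case: out => out; first by rewrite vr ?mul0r ?mulr0//; lra.
    by rewrite plateau_eq0 ?mul0r ?mulr0//; lra.
have -> : (fun z => q z.1 z.2 * amplitude z.1 z.2) = (fun z => D z + q z.1 z.2 * Psi z).
  by apply/funext => z; rewrite /D subrK.
rewrite RintegralD//; apply: le_trans (ler_normD _ _) _; apply: le_trans (lerD DB PsiB) _.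
rewrite le_eqVlt; apply/orP; left; apply/eqP; ring.
Qed.

End Cutoff.

Hypothesis su : smooth u.

Lemma kernel_decay : exists2 C, 0 <= C & forall x xi, `|kernel u x xi| <= C * (1 + xi ^+ 2)^-1.
Proof.
have [C C0 dec] := ft_decay su ur; exists (C + C) => [|x xi]; first exact: addr_ge0.
rewrite (kernelE _ _ (smooth_cvg su) ur); apply: le_trans (ler_normD _ _) _.
have [dc ds] := dec xi; rewrite [leRHS]mulrDl !normrM; apply: lerD.
  by rewrite -[leRHS]mul1r; apply: ler_pM => //; exact: cos_max.
by rewrite -[leRHS]mul1r; apply: ler_pM => //; exact: sin_max.
Qed.

(** The bound with cutoff does not involve [k]. At each point the integrand is eventually constant
    as [k] grows, and [kernel_decay] dominates it by an integrable tensor product. *)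
Lemma plane_weak_bound t : 0 < t ->
  mu2.-integrable setT (EFin \o (fun z => q z.1 z.2 * (v z.1 * kernel u z.1 z.2))) /\
  `|Rintegral mu2 setT (fun z => q z.1 z.2 * (v z.1 * kernel u z.1 z.2))| <=
  1188 * M * (t * Rintegral mu setT (fun x => v x ^+ 2) + 8 * Rintegral mu setT (fun x => u x ^+ 2) / t).
Proof.
move=> t0; have [C C0 dec] := kernel_decay.
pose G z := M * (`|v z.1| * (C * (1 + z.2 ^+ 2)^-1)) : R.
have iv := continuous_supported_integrable (lip_continuous v_lip) vr.
have iG : mu2.-integrable setT (EFin \o G).
  apply: integrable_scale; apply: (@integrable_tensor (fun x => `|v x|) (fun xi => C * (1 + xi ^+ 2)^-1)).
    exact: integrable_norm iv.
  by apply: integrable_scale; exact: integrable_oneDsqrV.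
have mq := (weakly_bounded_box q_le).1.
have mA (n : nat) : measurable_fun setT (fun z => q z.1 z.2 * amplitude n%:R z.1 z.2).
  by apply: measurable_funM mq _; exact: measurable_amplitude.
have mF : measurable_fun setT (fun z => q z.1 z.2 * (v z.1 * kernel u z.1 z.2)).
  apply: measurable_funM mq _; apply: measurable_funM; last exact: measurable_kernel su ur.
  have mfst := @measurable_fst _ _ (measurableTypeR R) (measurableTypeR R).
  exact: measurableT_comp (continuous_measurable_fun (lip_continuous v_lip)) mfst.
have [g wg gM] := q_le (leq0n _) (leq0n _).
have qM : {ae mu2, forall z, `|q z.1 z.2| <= M} by apply: ae2S2 (weak_deriv0_ae wg) gM => z ->.
have cA : {ae mu2, forall z, (fun n : nat => q z.1 z.2 * amplitude n%:R z.1 z.2) @ \oo -->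
    q z.1 z.2 * (v z.1 * kernel u z.1 z.2)}.
  apply: ae2S qM => z _; apply: cvg_near_cst; near=> n.
  by rewrite /amplitude plateau_eq1 ?mul1r//; near: n; exact: nbhs_infty_ger.
have AG : {ae mu2, forall z, forall n : nat, `|q z.1 z.2 * amplitude n%:R z.1 z.2| <= G z}.
  apply: ae2S qM => z qz n; rewrite normrM; apply: ler_pM => //.
  rewrite /amplitude !normrM; apply: ler_pM => //; have /andP[p0 p1] := plateau_bound n%:R z.2.
  by rewrite (ger0_norm p0) -[leRHS]mul1r; apply: ler_pM.
pose plane : {measure set (measurableTypeR R * measurableTypeR R) -> \bar R} := mu2.
have [iF F_cvg] := @Rintegral_dominated_cvg _ _ _ plane _ _ _ mA mF cA iG AG.
split=> //; apply: (cvgr_to_le (cvg_norm F_cvg)); apply: nearW => n.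
exact: cutoff_weak_bound.
Unshelve. all: by end_near. Qed.

Lemma weak_bound t : 0 < t ->
  mu.-integrable setT (EFin \o (fun x => v x * Rintegral mu setT (fun xi => q x xi * kernel u x xi))) /\
  `|Rintegral mu setT (fun x => v x * Rintegral mu setT (fun xi => q x xi * kernel u x xi))| <=
  1188 * M * (t * Rintegral mu setT (fun x => v x ^+ 2) + 8 * Rintegral mu setT (fun x => u x ^+ 2) / t).
Proof.
move=> /plane_weak_bound[].
have -> : (fun z : R * R => q z.1 z.2 * (v z.1 * kernel u z.1 z.2)) =
    (fun z => v z.1 * (q z.1 z.2 * kernel u z.1 z.2)) by apply/funext => z; ring.
move=> iF bF; have mv := continuous_measurable_fun (lip_continuous v_lip).
have mF : measurable_fun setT (fun z : R * R => q z.1 z.2 * kernel u z.1 z.2).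
  by apply: measurable_funM; [exact: (weakly_bounded_box q_le).1|exact: measurable_kernel su ur].
by have [iT ->] := @Rintegral_iterated _ v (fun x xi => q x xi * kernel u x xi) mv mF iF.
Qed.

End WeakLimit.

End WeakBound.

(** * Square integrable functions *)

Section SquareIntegrable.
Context {R : realType}.
Local Notation mu := (@lebesgue_measure R).
Local Open Scope classical_set_scope.
Implicit Types (f g h : R -> R).

Let line : {measure set (measurableTypeR R) -> \bar R} := mu.

Lemma aeS (P Q : R -> Prop) : (forall x, P x -> Q x) ->
  {ae mu, forall x, P x} -> {ae mu, forall x, Q x}.
Proof.
by move=> PQ; exact: (@filterS _ (almost_everywhere line) _ [set x | P x] [set x | Q x]).
Qed.

Lemma aeS2 (P Q S : R -> Prop) : (forall x, P x -> Q x -> S x) ->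
  {ae mu, forall x, P x} -> {ae mu, forall x, Q x} -> {ae mu, forall x, S x}.
Proof.
move=> PQ; exact: (@filterS2 _ (almost_everywhere line) _ [set x | P x] [set x | Q x] [set x | S x]).
Qed.

(** Real-valued counterpart of [L2norm], meaningful on [L2]; this is why memberships in [L2]
    accompany the bounds below. *)
Definition norm2 f : R := Num.sqrt (Rintegral mu setT (fun x => f x ^+ 2)).

Lemma norm2_ge0 f : 0 <= norm2 f. Proof. exact: sqrtr_ge0. Qed.

Lemma Rintegral_sqr_ge0 f : 0 <= Rintegral mu setT (fun x => f x ^+ 2).
Proof. by apply: fine_ge0; apply: integral_ge0 => x _; rewrite lee_fin sqr_ge0. Qed.

Lemma norm2_sqr f : norm2 f ^+ 2 = Rintegral mu setT (fun x => f x ^+ 2).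
Proof. by rewrite sqr_sqrtr// Rintegral_sqr_ge0. Qed.

Lemma L2norm_poweR f : L2norm f = ((\int[mu]_x (f x ^+ 2)%:E) `^ 2^-1)%E.
Proof.
rewrite /L2norm unlock /=; congr poweR; apply: eq_integral => x _.
by rewrite powR_mulrn// real_normK// num_real.
Qed.

Lemma L2P f : L2 f <-> measurable_fun setT f /\ mu.-integrable setT (EFin \o (fun x => f x ^+ 2)).
Proof.
split=> [Lf|[mf isq]].
  split; last exact: Lfun2_integrable_sqr.
  by move: (sub_Lfun_mfun Lf); rewrite inE.
rewrite /L2 /= inE /=; apply/andP; split; first by rewrite inE.
rewrite inE /= /finite_norm -/(L2norm f) L2norm_poweR.
have /integrableP[_ fin] := isq; apply: poweR_lty.
by move: fin; under eq_integral do rewrite /= ger0_norm ?sqr_ge0//.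
Qed.

Lemma L2_measurable f : L2 f -> measurable_fun setT f. Proof. by case/L2P. Qed.

Lemma L2normE f : L2 f -> L2norm f = (norm2 f)%:E.
Proof.
case/L2P => mf isq; rewrite L2norm_poweR -(fineK (integrable_fin_num measurableT isq)).
by rewrite poweR_EFin powR12_sqrt// Rintegral_sqr_ge0.
Qed.

Lemma L2M f g : L2 f -> L2 g -> mu.-integrable setT (EFin \o (fun x => f x * g x)).
Proof. by move=> Lf Lg; apply/Lfun1_integrable; exact: Lfun2_mul_Lfun1. Qed.

Lemma L2D f g : L2 f -> L2 g -> L2 (fun x => f x + g x).
Proof.
move=> Lf Lg; have [mf sf] := (L2P f).1 Lf; have [mg sg] := (L2P g).1 Lg.
apply/L2P; split; first exact: measurable_funD.
have -> : (fun x => (f x + g x) ^+ 2) = (fun x => (f x ^+ 2 + g x ^+ 2) + 2 * (f x * g x)).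
  by apply/funext => x; ring.
apply: integrable_add; first exact: integrable_add.
by apply: integrable_scale; exact: L2M.
Qed.

Lemma L2Z (c : R) f : L2 f -> L2 (fun x => c * f x).
Proof.
case/L2P => mf sf; apply/L2P; split; first exact: measurable_funM.
have -> : (fun x => (c * f x) ^+ 2) = (fun x => c ^+ 2 * f x ^+ 2) by apply/funext => x; ring.
exact: integrable_scale.
Qed.

Lemma L2B f g : L2 f -> L2 g -> L2 (fun x => f x - g x).
Proof.
move=> Lf Lg; have -> : (fun x => f x - g x) = (fun x => f x + (-1) * g x).
  by apply/funext => x; ring.
by apply: L2D => //; exact: L2Z.
Qed.

Lemma L2_0 : L2 (fun=> 0 : R).
Proof.
apply/L2P; split; first exact: measurable_cst.
by rewrite (_ : EFin \o _ = cst 0%E) ?integrable0//; apply/funext => x; rewrite /= expr0n.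
Qed.

Lemma norm2Z (c : R) f : L2 f -> norm2 (fun x => c * f x) = `|c| * norm2 f.
Proof.
case/L2P => mf sf; rewrite /norm2.
have -> : (fun x => (c * f x) ^+ 2) = (fun x => c ^+ 2 * f x ^+ 2) by apply/funext => x; ring.
by rewrite RintegralZl// sqrtrM ?sqr_ge0// sqrtr_sqr.
Qed.

Lemma norm2_ae f g : measurable_fun setT f -> measurable_fun setT g ->
  {ae mu, forall x, f x = g x} -> norm2 f = norm2 g.
Proof.
move=> mf mg fg; rewrite /norm2; congr Num.sqrt; rewrite /Rintegral; congr fine.
apply: (ae_eq_integral (mu := mu) (fun x => (g x ^+ 2)%:E) (fun x => (f x ^+ 2)%:E)) => //.
- by apply/measurable_EFinP; exact: measurable_funX.
- by apply/measurable_EFinP; exact: measurable_funX.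
- by apply: aeS fg => x -> _.
Qed.

Lemma Rintegral_ae f g : measurable_fun setT f -> measurable_fun setT g ->
  {ae mu, forall x, f x = g x} -> Rintegral mu setT f = Rintegral mu setT g.
Proof.
move=> mf mg fg; rewrite /Rintegral; congr fine.
apply: (ae_eq_integral (mu := mu) (EFin \o g) (EFin \o f)) => //; try exact/measurable_EFinP.
by apply: aeS fg => x /= -> _.
Qed.

Lemma cauchy_schwarz f g : L2 f -> L2 g ->
  `|Rintegral mu setT (fun x => f x * g x)| <= norm2 f * norm2 g.
Proof.
move=> Lf Lg; have iF := L2M Lf Lg.
have [_ sf] := (L2P f).1 Lf; have [_ sg] := (L2P g).1 Lg.
rewrite -(ler_pXn2r (ltn0Sn 1)) ?nnegrE ?mulr_ge0 ?norm2_ge0//.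
rewrite real_normK ?num_real// exprMn !norm2_sqr.
set A := Rintegral mu setT (fun x => f x ^+ 2); set B := Rintegral mu setT (fun x => g x ^+ 2).
set P := Rintegral mu setT _.
have Q (s t : R) : 0 <= s ^+ 2 * A + 2 * (s * t) * P + t ^+ 2 * B.
  have := Rintegral_sqr_ge0 (fun x => s * f x + t * g x).
  have -> : (fun x => (s * f x + t * g x) ^+ 2) =
    (fun x => (s ^+ 2 * f x ^+ 2 + 2 * (s * t) * (f x * g x)) + t ^+ 2 * g x ^+ 2).
    by apply/funext => x; ring.
  rewrite RintegralD//; [|by apply: integrable_add; exact: integrable_scale|exact: integrable_scale].
  rewrite RintegralD//; [|exact: integrable_scale|exact: integrable_scale].
  by rewrite !RintegralZl.
have A0 : 0 <= A := Rintegral_sqr_ge0 f.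
have B0 : 0 <= B := Rintegral_sqr_ge0 g.
have [Bp|] := ltP 0 B.
  have := Q B (- P); have -> : B ^+ 2 * A + 2 * (B * - P) * P + (- P) ^+ 2 * B = B * (A * B - P ^+ 2) by ring.
  by rewrite pmulr_rge0// subr_ge0.
move=> Bn; have B00 : B = 0 by apply/eqP; rewrite eq_le B0 Bn.
have [->|P0] := eqVneq P 0; first by rewrite expr0n B00 mulr0.
(* With [B = 0] the quadratic form is affine in its second argument, and this choice gives it the
   value [-1]. *)
have := Q 1 (- (A + 1) / (2 * P)).
rewrite B00 mulr0 addr0 expr1n mul1r mul1r.
have -> : A + 2 * (- (A + 1) / (2 * P)) * P = -1 by field.
by rewrite leNgt ltrN10.
Qed.

Lemma norm2D f g : L2 f -> L2 g -> norm2 (fun x => f x + g x) <= norm2 f + norm2 g.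
Proof.
move=> Lf Lg; have [_ sf] := (L2P f).1 Lf; have [_ sg] := (L2P g).1 Lg.
rewrite -(ler_pXn2r (ltn0Sn 1)) ?nnegrE ?addr_ge0 ?norm2_ge0//.
have -> : norm2 (fun x => f x + g x) ^+ 2 = norm2 f ^+ 2 + norm2 g ^+ 2 + 2 * Rintegral mu setT (fun x => f x * g x).
  rewrite !norm2_sqr.
  have -> : (fun x => (f x + g x) ^+ 2) = (fun x => (f x ^+ 2 + g x ^+ 2) + 2 * (f x * g x)).
    by apply/funext => x; ring.
  rewrite RintegralD//; [|exact: integrable_add|by apply: integrable_scale; exact: L2M].
  by rewrite RintegralD// RintegralZl//; exact: L2M.
have := cauchy_schwarz Lf Lg; have := ler_norm (Rintegral mu setT (fun x => f x * g x)).
by rewrite sqrrD mulr_natl -mulr_natl; move: (norm2 f ^+ 2) (norm2 g ^+ 2) (norm2 f * norm2 g) => a b c; lra.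
Qed.

Lemma norm2_eq0 f : L2 f -> norm2 f = 0 -> {ae mu, forall x, f x = 0}.
Proof.
move=> Lf f0; have [mf sf] := (L2P f).1 Lf.
have : (\int[mu]_x `|(f x ^+ 2)%:E|)%E = 0%E.
  under eq_integral do rewrite gee0_abs ?lee_fin ?sqr_ge0//.
  rewrite -(fineK (integrable_fin_num measurableT sf)) -/(Rintegral _ _ _) -norm2_sqr f0.
  by rewrite expr0n.
have msq : measurable_fun setT (fun x => (f x ^+ 2)%:E) by apply/measurable_EFinP; exact: measurable_funX.
move/(ae_eq_integral_abs mu measurableT msq).1; apply: aeS => x /(_ I) /= [] /eqP.
by rewrite expf_eq0 => /andP[_ /eqP].
Qed.

Lemma L2_dominated f g : measurable_fun setT g -> L2 f -> (forall x, `|g x| <= `|f x|) ->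
  L2 g /\ norm2 g <= norm2 f.
Proof.
move=> mg Lf gf; have [mf sf] := (L2P f).1 Lf.
have m2 : measurable_fun setT (fun x => g x ^+ 2) by exact: (measurable_funX _ mg).
have le2 x : `|g x ^+ 2| <= f x ^+ 2.
  by rewrite normrX -(real_normK (num_real (f x))) lerXn2r ?nnegrE.
have [|i2 le_int] := @ae_dominated _ _ _ mu (fun x => g x ^+ 2) (fun x => f x ^+ 2) m2 sf.
  by apply: aeW => x; exact: le2.
split; first exact/L2P.
rewrite /norm2 ler_wsqrtr//; exact: le_trans (ler_norm _) le_int.
Qed.

End SquareIntegrable.

(** * Density of smooth compactly supported functions *)

Section Density.
Context {R : realType}.
Local Notation mu := (@lebesgue_measure R).
Local Open Scope classical_set_scope.
Implicit Types (f g h : R -> R).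

Lemma smooth_sum (n : nat) (c : nat -> R) (F : nat -> R -> R) : (forall i, smooth (F i)) ->
  smooth (fun x => \sum_(i < n) c i * F i x).
Proof.
move=> sF; elim: n => [|n IH].
  have -> : (fun x => \sum_(i < 0) c i * F i x) = (fun=> 0) by apply/funext => x; rewrite big_ord0.
  exact: smooth_cst.
have -> : (fun x => \sum_(i < n.+1) c i * F i x) = (fun x => \sum_(i < n) c i * F i x + c n * F n x).
  by apply/funext => x; rewrite big_ord_recr.
apply: smoothD; first exact: IH.
by apply: smoothM; [exact: smooth_cst|exact: sF].
Qed.

Lemma norm2_le f (e : R) : 0 <= e -> Rintegral mu setT (fun x => f x ^+ 2) <= e ^+ 2 -> norm2 f <= e.
Proof. by move=> e0; rewrite -norm2_sqr ler_pXn2r// nnegrE norm2_ge0. Qed.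

Lemma bounded_supported_L2 f (r K : R) : measurable_fun setT f -> (forall x, `|f x| <= K) ->
  supported f r -> L2 f.
Proof.
move=> mf fK fr; apply/L2P; split=> //.
have fr' : supported (fun x => f x ^+ 2) `|r|.
  by move=> x kx; rewrite fr ?expr0n//; exact: le_lt_trans (ler_norm _) kx.
apply: (supported_integral (normr_ge0 r) _ _ fr').1; first exact: measurable_funX.
by move=> x; rewrite normrX; apply: lerXn2r => //; rewrite nnegrE// (le_trans _ (fK x)).
Qed.

Definition approximable f := forall e : R, 0 < e -> exists phi,
  [/\ smooth phi, exists r, supported phi r, L2 (fun x => phi x - f x) &
      norm2 (fun x => phi x - f x) <= e].

Lemma small_of_cvg0 (a : nat -> R) (e : R) : a @ \oo --> (0 : R) -> 0 < e -> exists n, `|a n| <= e.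
Proof.
by move=> /cvgr0_norm_le a0 /a0[n _ /(_ n (leqnn n)) ?]; exists n.
Qed.

(** The grid serves again: interpolation by tents is smooth, boundedly supported and converges
    pointwise, with a squared error at most [(K + K) ^ 2] on a fixed segment. *)
Lemma approximable_continuous h r : continuous h -> supported h r -> approximable h.
Proof.
move=> ch hr e e0; have [K K0 hK] := continuous_supported_bounded ch hr.
pose phi n x := \sum_(i < n.+1 * n.+1) h (node n.+1 i) * tent n.+1 i x.
have sphi n : smooth (phi n).
  by apply: (@smooth_sum _ (fun i => h (node n.+1 i)) (tent n.+1)); exact: smooth_tent.
have phir n : supported (phi n) (r + 1).
  move=> x rx; rewrite /phi big1// => i _.
  have [tx|tx] := leP n.+1%:R^-1 `|x - node n.+1 i|; first by rewrite tent_supp// mulr0.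
  have i1 : n.+1%:R^-1 <= 1 :> R by rewrite invf_le1 ?ltr0n// ler1n.
  have := ler_normD (x - node n.+1 i) (node n.+1 i); rewrite subrK => tri.
  by rewrite hr ?mul0r//; move: (n.+1%:R^-1) tx i1 => w tx i1; lra.
have phiK n x : `|phi n x| <= K.
  apply: le_trans (ler_norm_sum _ _ _) _.
  apply: (@le_trans _ _ (\sum_(i < n.+1 * n.+1) K * tent n.+1 i x)).
    apply: ler_sum => i _; have /andP[t0 t1] := tent_bound n.+1 i x.
    by rewrite normrM (ger0_norm t0) ler_wpM2r.
  by rewrite -mulr_sumr ler_piMr//; have /andP[] := @sum_tent_bound R n.+1 x.
have LB n : L2 (fun x => phi n x - h x).
  apply: (@bounded_supported_L2 _ (r + 1) (K + K)).
  - exact: measurable_funB (smooth_measurable (sphi n)) (continuous_measurable_fun ch).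
  - by move=> x; apply: le_trans (ler_normB _ _) _; apply: lerD.
  - by move=> x rx; rewrite phir// hr ?subrr//; lra.
have cvg0 : Rintegral mu setT (fun x => (phi n x - h x) ^+ 2) @[n --> \oo] --> (0 : R).
  pose A := `[(- (`|r| + 1)), (`|r| + 1)]%classic : set (measurableTypeR R).
  have mA : measurable A by exact: measurable_itv.
  have r1 : - (`|r| + 1) <= `|r| + 1 by have := normr_ge0 r; lra.
  have fA : (mu A < +oo)%E by rewrite /A lebesgue_measure_segment// ltry.
  have [iG _] := @integrable_cst_indic _ _ _ mu A ((K + K) ^+ 2) mA fA.
  have -> : (0 : R) = Rintegral mu setT (fun=> 0 : R) by rewrite Rintegral_cst// mul0r.
  apply: (Rintegral_dominated_cvg _ _ _ iG _).2.
  - by move=> n; exact: measurable_funX (L2_measurable (LB n)).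
  - exact: measurable_cst.
  - apply: aeW => x; apply/cvgr0Pnorm_le => d d0 /=.
    have d1 : 0 < Num.min d 1 by rewrite lt_min d0 ltr01.
    have /cvgrPdist_le/(_ _ d1) [del /= del0 hdel] := ch x.
    near=> n; rewrite ger0_norm ?sqr_ge0//.
    have hn : `|phi n x - h x| <= Num.min d 1.
      apply: (interpolation_error1 (ltn0Sn n) (r := r) (g := fun i => h (node n.+1 i))).
      + have : r * 2 + 2 <= n%:R by near: n; exact: nbhs_infty_ger.
        by rewrite -[n.+1%:R]natr1; lra.
      + exact: (ltW d1).
      + move=> j _ xj; rewrite distrC; apply: hdel; rewrite /ball /=; apply: lt_le_trans xj _.
        rewrite invf_ple ?posrE ?ltr0n//.
        have : del^-1 <= n%:R by near: n; exact: nbhs_infty_ger.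
        by rewrite -[n.+1%:R]natr1; lra.
      + exact: hr.
    rewrite -real_normK ?num_real//; move: hn; rewrite le_min => /andP[hd h1].
    by rewrite expr2 (le_trans _ hd)// ler_piMr.
  - apply: aeW => x n; rewrite ger0_norm ?sqr_ge0// indicE; case: (boolP (x \in A)) => xA.
      rewrite mulr1 -real_normK ?num_real// lerXn2r ?nnegrE ?addr_ge0//.
      by apply: le_trans (ler_normB _ _) _; apply: lerD.
    have rx : `|r| + 1 < `|x|.
      by rewrite ltNge; apply: contra xA => xr; rewrite inE /A /= in_itv /= -ler_norml.
    by rewrite phir ?hr ?subrr ?expr0n ?mulr0//; have := ler_norm r; lra.
have [n hn] := small_of_cvg0 cvg0 (exprn_gt0 2 e0).
exists (phi n); split; [exact: sphi|by exists (r + 1); exact: phir|exact: LB|].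
by apply: norm2_le; [exact: ltW|exact: le_trans (ler_norm _) hn].
Unshelve. all: by end_near. Qed.

Lemma approximable_trans f : (forall e : R, 0 < e -> exists g, [/\ approximable g,
  L2 (fun x => g x - f x) & norm2 (fun x => g x - f x) <= e]) -> approximable f.
Proof.
move=> H e e0; have e2 : 0 < e / 2 by rewrite divr_gt0.
have [g [ag Lg ge]] := H _ e2; have [phi [sphi rphi Lp pe]] := ag _ e2.
have E : (fun x => phi x - f x) = (fun x => (phi x - g x) + (g x - f x)).
  by apply/funext => x; ring.
exists phi; split=> //; rewrite E; first exact: L2D.
by apply: le_trans (norm2D Lp Lg) _; lra.
Qed.

(** L^1 approximation is upgraded to L^2 by clipping the approximant to [[-K, K]]: the error is then
    at most [2 * K], so its square is at most [2 * K] times the L^1 error. *)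
Lemma norm2_approx_bounded f (k K e : R) : 0 <= k -> 0 <= K -> 0 < e -> measurable_fun setT f ->
  (forall x, `|f x| <= K) -> supported f k -> exists h, [/\ continuous h,
    supported h (k + 1), L2 (fun x => h x - f x) & norm2 (fun x => h x - f x) <= e].
Proof.
move=> k0 K0 e0 mf fK fk.
pose E := `[(- (k + 1)), (k + 1)]%classic : set (measurableTypeR R).
have mE : measurable E by exact: measurable_itv.
have kk : - (k + 1) <= k + 1 by lra.
have fE : (mu E < +oo)%E by rewrite /E lebesgue_measure_segment// ltry.
have iF : mu.-integrable setT (EFin \o f) by exact: (supported_integral k0 mf fK fk).1.
have iFE : mu.-integrable E (EFin \o f) by exact: integrableS iF.
have [g_ [cg ig g_cvg]] := approximation_continuous_integrable mE fE iFE.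
(* The added [1] keeps the denominator positive when [K = 0]. *)
pose del := e ^+ 2 / (K + K + 1).
have K1 : 0 < K + K + 1 by lra.
have del0 : 0 < del by rewrite divr_gt0// exprn_gt0.
have [n gn] : exists n, (\int[mu]_(x in E) `|(f x - g_ n x)%:E| <= del%:E)%E.
  have /fine_cvgP[[n1 _ fin1] /cvgr0_norm_le/(_ _ del0)[n2 _ small]] := g_cvg.
  exists (maxn n1 n2); rewrite -(fineK (fin1 _ _)) ?lee_fin; last by rewrite /= leq_maxl.
  by apply: le_trans (ler_norm _) _; apply: small; rewrite /= leq_maxr.
pose c x := Num.max (- K) (Num.min K (g_ n x)).
pose h x := plateau k x * c x.
have cK x : `|c x| <= K by rewrite /c ler_norml le_max lexx /= ge_max ge_min lexx/= andbT; lra.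
have cf x : `|c x - f x| <= `|f x - g_ n x|.
  rewrite distrC; have := fK x; rewrite /c /Num.max /Num.min ler_norml => /andP[f1 f2].
  have a1 := ler_norm (f x - g_ n x); have a2 := ler_norm (- (f x - g_ n x)); rewrite normrN in a2.
  by case: (ltP K (g_ n x)) => h1; case: ltP => h2; rewrite ler_norml; apply/andP; split; lra.
have cc : continuous c.
  move=> x; apply: (@continuous_max _ _ (cst (- K)) _ x); first exact: cvg_cst.
  by apply: (@continuous_min _ _ (cst K) _ x); [exact: cvg_cst|exact: cg].
have ch : continuous h.
  move=> x; apply: cvgM; last exact: cc.
  exact: (lip_continuous (@plateau_lip _ k)).
have hk : supported h (k + 1) by move=> x kx; rewrite /h plateau_eq0 ?mul0r// ltW.
have hf x : `|h x - f x| <= `|c x - f x|.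
  have -> : h x - f x = plateau k x * (c x - f x).
    rewrite /h; have [xk|kx] := leP `|x| k; first by rewrite plateau_eq1// !mul1r.
    by rewrite fk// !subr0.
  by have /andP[p0 p1] := plateau_bound k x; rewrite normrM ger0_norm// ler_piMl.
have hfk : supported (fun x => h x - f x) (k + 1) by move=> x kx; rewrite hk// fk ?subrr//; lra.
have hf2 x : `|h x - f x| <= K + K.
  by apply: le_trans (hf x) _; apply: le_trans (ler_normB _ _) _; apply: lerD.
have mh : measurable_fun setT (fun x => h x - f x).
  exact: measurable_funB (continuous_measurable_fun ch) mf.
have L : L2 (fun x => h x - f x) by exact: (@bounded_supported_L2 _ (k + 1) (K + K)).
exists h; split=> //; apply: norm2_le; first exact: ltW.
rewrite -lee_fin fineK ?(integrable_fin_num _ ((L2P _).1 L).2)//.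
pose G x := ((K + K)%:E * (`|(f x - g_ n x)%:E|) )%E.
have mg : measurable_fun setT (fun x => f x - g_ n x).
  by apply: measurable_funB => //; exact: continuous_measurable_fun.
have mG : measurable_fun setT (fun x => `|(f x - g_ n x)%:E|%E).
  by apply: measurableT_comp => //; exact/measurable_EFinP.
apply: (@le_trans _ _ (\int[mu]_(x in E) G x)%E).
  have -> : (\int[mu]_x ((h x - f x) ^+ 2)%:E = \int[mu]_(x in E) ((h x - f x) ^+ 2)%:E)%E.
    rewrite [RHS]integral_mkcond; apply: eq_integral => x _; rewrite patchE.
    case: (boolP (x \in E)) => // xE; rewrite hfk ?expr0n//.
    by rewrite ltNge; apply: contra xE => xr; rewrite inE /E /= in_itv /= -ler_norml.
  apply: ge0_le_integral => //.
  - by move=> x _; rewrite lee_fin sqr_ge0.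
  - by apply/measurable_EFinP; apply: measurable_funTS; exact: measurable_funX.
  - by apply: measurable_funTS; exact: measurable_funeM.
  - move=> x _; rewrite /G /= -EFinM lee_fin -real_normK ?num_real// expr2.
    by apply: ler_pM => //; exact: le_trans (hf x) (cf x).
rewrite /G ge0_integralZl//; [|exact: measurable_funTS|by rewrite lee_fin addr_ge0].
apply: (@le_trans _ _ ((K + K)%:E * del%:E)%E); first by apply: lee_wpmul2l => //; rewrite lee_fin addr_ge0.
rewrite -EFinM lee_fin /del mulrCA ler_piMr ?sqr_ge0// ler_pdivrMr// mul1r; lra.
Qed.

(** Truncating to the set where [|x|] and [|f x|] are both at most [n] yields bounded functions of
    bounded support, and the error is dominated by [f ^ 2]. *)
Lemma approximable_L2 f : L2 f -> approximable f.
Proof.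
move=> Lf; apply: approximable_trans => e e0.
have [mf sf] := (L2P f).1 Lf.
pose A (n : nat) := [set x : measurableTypeR R | Num.max `|x| `|f x| <= n%:R].
have mA n : measurable (A n).
  have mm : measurable_fun setT (fun x : measurableTypeR R => Num.max `|x| `|f x|).
    by apply: measurable_maxr; [exact: normr_measurable|exact: measurableT_comp].
  have mI : measurable (`]-oo, (n%:R : R)] : set (measurableTypeR R)) by exact: measurable_itv.
  have := mm measurableT _ mI; rewrite setTI.
  by congr measurable; apply/seteqP; split=> x; rewrite /A /= in_itv.
pose F n x := f x * \1_(A n) x.
have mF n : measurable_fun setT (F n) by exact: (measurable_funM mf (measurable_indic (mA n))).
have FE n x : F n x = if x \in A n then f x else 0.
  by rewrite /F indicE; case: ifP; rewrite ?mulr1 ?mulr0.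
have mB n : measurable_fun setT (fun x => F n x - f x) by exact: measurable_funB.
have cvg0 : Rintegral mu setT (fun x => (F n x - f x) ^+ 2) @[n --> \oo] --> (0 : R).
  have -> : (0 : R) = Rintegral mu setT (fun=> 0 : R) by rewrite Rintegral_cst// mul0r.
  apply: (Rintegral_dominated_cvg _ _ _ sf _).2.
  - by move=> n; exact: (measurable_funX _ (mB n)).
  - exact: measurable_cst.
  - apply: aeW => x; apply: cvg_near_cst; near=> n.
    rewrite FE ifT ?subrr ?expr0n//; rewrite inE /A /=.
    by near: n; exact: nbhs_infty_ger.
  - apply: aeW => x n; rewrite ger0_norm ?sqr_ge0// FE; case: ifP; last by rewrite sub0r sqrrN.
    by rewrite subrr expr0n sqr_ge0.
have LB n : L2 (fun x => F n x - f x).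
  apply: (L2_dominated (mB n) Lf _).1 => x; rewrite FE; case: ifP; last by rewrite sub0r normrN.
  by rewrite subrr normr0.
have e2 : 0 < e ^+ 2 by exact: exprn_gt0.
have [n hn] := small_of_cvg0 cvg0 e2.
exists (F n); split; [|exact: LB|by apply: norm2_le; [exact: ltW|exact: le_trans (ler_norm _) hn]].
apply: approximable_trans => d d0.
have [|x|h [ch hk Lh hd]] := @norm2_approx_bounded (F n) n%:R n%:R d (ler0n _ _) (ler0n _ _) d0 (mF n).
- move=> x; rewrite FE; case: ifPn => [|_]; last by rewrite normr0.
  by rewrite inE /A /= ge_max => /andP[].
- rewrite FE => nx; rewrite ifF//; apply/negbTE; apply/negP; rewrite inE /A /= ge_max => /andP[].
  by rewrite leNgt nx.
by exists h; split=> //; exact: approximable_continuous ch hk.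
Unshelve. all: by end_near. Qed.

End Density.

(** * Pseudo-differential operators on L^2 *)

Section PseudoDifferentialOperators.
Context {R : realType}.
Local Notation mu := (@lebesgue_measure R).
Local Open Scope classical_set_scope.
Implicit Types (f g h phi u v : R -> R) (p q : R -> R -> R).

Lemma cabs_ge_Re (z : R[i]) : `|complex.Re z| <= cabs z.
Proof. by rewrite -sqrtr_sqr ler_wsqrtr// lerDl sqr_ge0. Qed.

Lemma cabsZ (c : R) (z : R[i]) : cabs (Complex (c * complex.Re z) (c * complex.Im z)) = `|c| * cabs z.
Proof.
rewrite /cabs /=; have -> : (c * complex.Re z) ^+ 2 + (c * complex.Im z) ^+ 2 =
  c ^+ 2 * (complex.Re z ^+ 2 + complex.Im z ^+ 2) by ring.
by rewrite sqrtrM ?sqr_ge0// sqrtr_sqr.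
Qed.

Lemma measurable_swap (F : R * R -> R) : measurable_fun setT F ->
  measurable_fun setT (fun z : R * R => F (z.2, z.1)).
Proof.
move=> mF; apply: (measurableT_comp mF).
by apply: measurable_fun_pair; [exact: measurable_snd|exact: measurable_fst].
Qed.

Let phase_measurable : measurable_fun setT (fun z : R * R => 2 * pi * z.1 * z.2).
Proof. by apply: measurable_funM => //; exact: measurable_funM. Qed.

Let measurable_cos_phase : measurable_fun setT (fun z : R * R => cos (2 * pi * z.1 * z.2)).
Proof. exact: measurableT_comp (continuous_measurable_fun (@continuous_cos R)) phase_measurable. Qed.

Let measurable_sin_phase : measurable_fun setT (fun z : R * R => sin (2 * pi * z.1 * z.2)).
Proof. exact: measurableT_comp (continuous_measurable_fun (@continuous_sin R)) phase_measurable. Qed.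

Let measurable_trig (w : R * R -> R) f : measurable_fun setT w -> measurable_fun setT f ->
  measurable_fun setT (fun xi => Rintegral mu setT (fun y => w (y, xi) * f y)).
Proof.
move=> mw mf; apply: (@measurable_Rintegral_snd _ (fun z : R * R => w (z.2, z.1) * f z.2)).
apply: measurable_funM; first exact: measurable_swap.
exact: (measurableT_comp mf measurable_snd).
Qed.

Lemma measurable_ftc f : measurable_fun setT f -> measurable_fun setT (ftc f).
Proof. exact: measurable_trig measurable_cos_phase. Qed.

Lemma measurable_fts f : measurable_fun setT f -> measurable_fun setT (fts f).
Proof. exact: measurable_trig measurable_sin_phase. Qed.

Lemma fourierE f (xi : R) : measurable_fun setT f -> fourier f xi = Complex (ftc f xi) (- fts f xi).
Proof.
move=> mf; rewrite /fourier /cintegral; congr Complex.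
  by apply: eq_Rintegral => y _; rewrite /= mulr0 subr0 cosN.
have ms : measurable_fun setT (fun y => sin (2 * pi * y * xi) * f y).
  apply: measurable_funM => //.
  exact: continuous_measurable_fun (@continuous_sin_phase _ xi).
rewrite -mulN1r -RintegralZl_measurable//; apply: eq_Rintegral => y _.
by rewrite /= mulr0 add0r sinN mulN1r mulNr.
Qed.

Definition Op_re p f x := Rintegral mu setT (fun xi =>
  p x xi * (cos (2 * pi * x * xi) * ftc f xi + sin (2 * pi * x * xi) * fts f xi)).

Definition Op_im p f x := Rintegral mu setT (fun xi =>
  p x xi * (sin (2 * pi * x * xi) * ftc f xi - cos (2 * pi * x * xi) * fts f xi)).

Lemma Op_schwartzE p f x : measurable_fun setT f ->
  Op_schwartz p f x = Complex (Op_re p f x) (Op_im p f x).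
Proof.
move=> mf; rewrite /Op_schwartz /cintegral; congr Complex; apply: eq_Rintegral => xi _;
  by rewrite fourierE//= !mulr0; ring.
Qed.

Section Measurable.
Variables (p : R -> R -> R) (mp : measurable_fun setT (fun z : R * R => p z.1 z.2)).
Variables (f : R -> R) (mf : measurable_fun setT f).

Let mc2 : measurable_fun setT (fun z : R * R => ftc f z.2).
Proof. exact: (measurableT_comp (measurable_ftc mf) measurable_snd). Qed.

Let ms2 : measurable_fun setT (fun z : R * R => fts f z.2).
Proof. exact: (measurableT_comp (measurable_fts mf) measurable_snd). Qed.

Let mre : measurable_fun setT (fun z : R * R =>
  p z.1 z.2 * (cos (2 * pi * z.1 * z.2) * ftc f z.2 + sin (2 * pi * z.1 * z.2) * fts f z.2)).
Proof.
apply: measurable_funM mp _; apply: measurable_funD.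
  exact: measurable_funM measurable_cos_phase mc2.
exact: measurable_funM measurable_sin_phase ms2.
Qed.

Let mim : measurable_fun setT (fun z : R * R =>
  p z.1 z.2 * (sin (2 * pi * z.1 * z.2) * ftc f z.2 - cos (2 * pi * z.1 * z.2) * fts f z.2)).
Proof.
apply: measurable_funM mp _; apply: measurable_funB.
  exact: measurable_funM measurable_sin_phase mc2.
exact: measurable_funM measurable_cos_phase ms2.
Qed.

Lemma measurable_Op_re : measurable_fun setT (Op_re p f).
Proof. exact: measurable_Rintegral_snd mre. Qed.

Lemma measurable_Op_im : measurable_fun setT (Op_im p f).
Proof. exact: measurable_Rintegral_snd mim. Qed.

Let ftcZ (c xi : R) : ftc (fun x => c * f x) xi = c * ftc f xi.
Proof.
rewrite /ftc -RintegralZl_measurable; first by apply: eq_Rintegral => y _; ring.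
by apply: measurable_funM mf; exact: continuous_measurable_fun (@continuous_cos_phase _ xi).
Qed.

Let ftsZ (c xi : R) : fts (fun x => c * f x) xi = c * fts f xi.
Proof.
rewrite /fts -RintegralZl_measurable; first by apply: eq_Rintegral => y _; ring.
by apply: measurable_funM mf; exact: continuous_measurable_fun (@continuous_sin_phase _ xi).
Qed.

(** Measurability is enough: the default value of a divergent integral is [0], which scales as
    well. *)
Lemma Op_reZ (c x : R) : Op_re p (fun x => c * f x) x = c * Op_re p f x.
Proof.
rewrite /Op_re -RintegralZl_measurable; last exact: (measurable_slice x mre).
by apply: eq_Rintegral => xi _; rewrite ftcZ ftsZ; ring.
Qed.

Lemma Op_imZ (c x : R) : Op_im p (fun x => c * f x) x = c * Op_im p f x.
Proof.
rewrite /Op_im -RintegralZl_measurable; last exact: (measurable_slice x mim).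
by apply: eq_Rintegral => xi _; rewrite ftcZ ftsZ; ring.
Qed.

End Measurable.

Lemma Op_re_kernel p u r x : smooth u -> supported u r ->
  Op_re p u x = Rintegral mu setT (fun xi => p x xi * kernel u x xi).
Proof.
move=> su ur; apply: eq_Rintegral => xi _.
by rewrite (kernelE _ _ (smooth_cvg su) ur).
Qed.

Definition Op_error p f g x := cabs (Op_schwartz p f x - (g x)%:C%C).

Lemma Op_errorE p f g x : measurable_fun setT f ->
  Op_error p f g x = cabs (Complex (Op_re p f x - g x) (Op_im p f x)).
Proof. by move=> mf; rewrite /Op_error Op_schwartzE//= /cabs/= subr0. Qed.

Lemma measurable_Op_error p f g : measurable_fun setT (fun z : R * R => p z.1 z.2) ->
  measurable_fun setT f -> measurable_fun setT g -> measurable_fun setT (Op_error p f g).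
Proof.
move=> mp mf mg; have -> : Op_error p f g = (fun x =>
    Num.sqrt ((Op_re p f x - g x) ^+ 2 + Op_im p f x ^+ 2)).
  by apply/funext => x; rewrite Op_errorE.
have mre := measurable_funB (measurable_Op_re mp mf) mg.
have mim := measurable_Op_im mp mf.
have ms := measurable_funD (measurable_funX 2 mre) (measurable_funX 2 mim).
exact: (measurableT_comp (continuous_measurable_fun (@sqrt_continuous R)) ms).
Qed.

Lemma Op_error_ge p f g x : measurable_fun setT f -> `|Op_re p f x - g x| <= Op_error p f g x.
Proof.
move=> mf; rewrite Op_errorE//.
exact: (cabs_ge_Re (Complex (Op_re p f x - g x) (Op_im p f x))).
Qed.

End PseudoDifferentialOperators.

(** * Extension by density, uniqueness and homogeneity *)

Section Extension.
Context {R : realType}.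
Local Notation mu := (@lebesgue_measure R).
Local Open Scope classical_set_scope.
Implicit Types (f g h phi u v : R -> R) (p q : R -> R -> R).

Lemma L2_fin f : measurable_fun setT f -> (L2norm f < +oo)%E -> L2 f.
Proof.
by move=> mf fin; rewrite /L2 /= inE /=; apply/andP; split; rewrite inE.
Qed.

(** Convergence of extended norms forces finiteness only from some index on, so membership in [L2]
    is part of the eventual statement. *)
Lemma L2norm_cvg0P (h : nat -> R -> R) : (forall n, measurable_fun setT (h n)) ->
  ((fun n => L2norm (h n)) @ \oo --> 0%E <->
   forall e : R, 0 < e -> \forall n \near \oo, L2 (h n) /\ norm2 (h n) <= e).
Proof.
move=> mh; split=> [/fine_cvgP[fin small] e e0|H].
  have small_e : \forall n \near \oo, `|fine (L2norm (h n))| <= e by exact: (cvgr0_norm_le _ small).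
  near=> n.
  have Ln : L2 (h n).
    by apply: L2_fin => //; rewrite ltey_eq; apply/orP; left; near: n.
  split=> //; have : `|fine (L2norm (h n))| <= e by near: n.
  by rewrite L2normE//= ger0_norm// norm2_ge0.
apply/fine_cvgP; split.
  by have := H 1 ltr01; apply: filterS => n [Ln _]; rewrite L2normE.
apply/cvgr0Pnorm_le => e e0; have := H e e0; apply: filterS => n [Ln ne].
by rewrite /= L2normE//= ger0_norm// norm2_ge0.
Unshelve. all: by end_near. Qed.

Lemma derive1nZ n (c : R) f : smooth f ->
  derive1n n (fun x => c * f x) = (fun x => c * derive1n n f x).
Proof.
elim: n f => [//|n IH] f sf; rewrite derive1Sn.
have -> : derive1 (fun x => c * f x) = (fun x => c * derive1 f x).
  apply/funext => x; rewrite derive1E.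
  have D := smooth_derive x sf; have Z := @is_deriveZ _ _ _ _ c x 1 _ D.
  have -> : (fun x => c * f x) = c \*: f by [].
  by rewrite derive_val.
by rewrite IH ?derive1Sn; [|exact: smooth_derive1].
Qed.

Lemma schwartzZ (c : R) f : schwartz f -> schwartz (fun x => c * f x).
Proof.
move=> [sf bf]; split=> [n x|m n].
  have sc : smooth (fun x => c * f x) by apply: smoothM; [exact: smooth_cst|exact: sf].
  exact: sc.
have [M hM] := bf m n; exists (`|c| * M) => x.
by rewrite (derive1nZ _ _ sf) mulrCA normrM ler_wpM2l.
Qed.

Lemma schwartz_measurable f : schwartz f -> measurable_fun setT f.
Proof. by case=> sf _; exact: smooth_measurable sf. Qed.

Lemma supported_schwartz f r : smooth f -> supported f r -> schwartz f.
Proof.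
move=> sf fr; split=> [|m n]; first exact: sf.
have [sn rn] : smooth (derive1n n f) /\ supported (derive1n n f) r.
  elim: n f sf fr => [//|n IH] f sf fr; rewrite derive1Sn.
  by apply: IH; [exact: smooth_derive1|exact: supported_derive1].
have cF : continuous (fun x : R => x ^+ m * derive1n n f x).
  by move=> x; apply: cvgM; [exact: exprn_continuous|exact: (smooth_cvg sn)].
have rF : supported (fun x => x ^+ m * derive1n n f x) r by move=> x /rn ->; rewrite mulr0.
by have [K _ hK] := continuous_supported_bounded cF rF; exists K.
Qed.

Lemma test_sequence f : L2 f -> exists phi : nat -> R -> R,
  [/\ forall n, smooth (phi n), forall n, exists r, supported (phi n) r,
      forall n, L2 (fun x => phi n x - f x) &
      forall e : R, 0 < e -> \forall n \near \oo, norm2 (fun x => phi n x - f x) <= e].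
Proof.
move=> Lf; have H (n : nat) : exists phi, [/\ smooth phi, exists r, supported phi r,
    L2 (fun x => phi x - f x) & norm2 (fun x => phi x - f x) <= n.+1%:R^-1].
  by apply: (approximable_L2 Lf); rewrite invr_gt0 ltr0n.
have [phi hphi] := choice H; exists phi; split=> [n|n|n|e e0]; try by have [] := hphi n.
near=> n; have [_ _ _ h] := hphi n; apply: le_trans h _.
rewrite invf_ple ?posrE ?ltr0n//.
have : e^-1 <= n%:R by near: n; exact: nbhs_infty_ger.
by move=> en; rewrite (le_trans en)// ler_nat.
Unshelve. all: by end_near. Qed.

(** Compactly supported smooth functions are Schwartz functions, and the complex error controls its
    real part. *)
Lemma is_Op_at_test p f g (phi : nat -> R -> R) : measurable_fun setT (fun z : R * R => p z.1 z.2) ->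
  is_Op_at p f g -> (forall n, smooth (phi n)) -> (forall n, exists r, supported (phi n) r) ->
  (forall n, L2 (fun x => phi n x - f x)) ->
  (forall e : R, 0 < e -> \forall n \near \oo, norm2 (fun x => phi n x - f x) <= e) ->
  forall e : R, 0 < e -> \forall n \near \oo,
    L2 (fun x => Op_re p (phi n) x - g x) /\ norm2 (fun x => Op_re p (phi n) x - g x) <= e.
Proof.
move=> mp [Lg H] sphi rphi Lphi phif e e0.
have mphi n := smooth_measurable (sphi n).
have mE n := measurable_Op_error mp (mphi n) (L2_measurable Lg).
have conv : (fun n => L2norm (Op_error p (phi n) g)) @ \oo --> 0%E.
  apply: H; first by move=> n; have [r hr] := rphi n; exact: supported_schwartz (sphi n) hr.
  apply/L2norm_cvg0P; first by move=> n; exact: L2_measurable (Lphi n).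
  by move=> d /phif; apply: filterS => n hn; split=> //; exact: Lphi.
have := (L2norm_cvg0P mE).1 conv e e0; apply: filterS => n [LE Ee].
have mB := measurable_funB (measurable_Op_re mp (mphi n)) (L2_measurable Lg).
have [|L le] := @L2_dominated _ (Op_error p (phi n) g) (fun x => Op_re p (phi n) x - g x) mB LE.
  by move=> x; rewrite (le_trans (Op_error_ge _ _ _ (mphi n)))// ler_norm.
by split=> //; exact: le_trans le Ee.
Qed.

(** [is_Op_at] quantifies over approximating sequences and would say nothing if there were none;
    [test_sequence] provides one, along which both candidates are limits. *)
Lemma is_Op_at_unique p f g1 g2 : measurable_fun setT (fun z : R * R => p z.1 z.2) -> L2 f ->
  is_Op_at p f g1 -> is_Op_at p f g2 -> {ae mu, forall x, g1 x = g2 x}.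
Proof.
move=> mp Lf H1 H2; have [phi [sphi rphi Lphi phif]] := test_sequence Lf.
have Lg := L2B H1.1 H2.1.
suff : norm2 (fun x => g1 x - g2 x) = 0.
  by move/(norm2_eq0 Lg); apply: aeS => x /eqP; rewrite subr_eq0 => /eqP.
apply/eqP; rewrite eq_le norm2_ge0 andbT; apply/ler_addgt0Pr => e e0; rewrite add0r.
have e2 : 0 < e / 2 by rewrite divr_gt0.
have n1 := is_Op_at_test mp H1 sphi rphi Lphi phif e2.
have n2 := is_Op_at_test mp H2 sphi rphi Lphi phif e2.
have [n [[L1 h1] [L2' h2]]] := filter_ex (filterI n1 n2).
have -> : (fun x => g1 x - g2 x) =
    (fun x => (Op_re p (phi n) x - g2 x) + (-1) * (Op_re p (phi n) x - g1 x)).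
  by apply/funext => x; ring.
apply: le_trans (norm2D L2' (L2Z _ L1)) _.
by rewrite norm2Z// normrN1 mul1r; lra.
Qed.

(** Dividing by [c] turns sequences approximating [f'] into sequences approximating [f]. The
    relation between [f'] and [f] is only almost everywhere so that it can be iterated: the
    composition feeds [Op] with functions known up to null sets. *)
Lemma is_Op_at_homogeneous p f f' g (c : R) : measurable_fun setT (fun z : R * R => p z.1 z.2) ->
  c != 0 -> L2 f -> L2 f' -> {ae mu, forall x, f' x = c * f x} ->
  is_Op_at p f g -> is_Op_at p f' (fun x => c * g x).
Proof.
move=> mp c0 Lf Lf' ff' [Lg H]; split=> [|phi sphi phif]; first exact: L2Z.
have mphi n := schwartz_measurable (sphi n).
pose psi n x := c^-1 * phi n x.
have spsi n : schwartz (psi n) by exact: schwartzZ.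
have mpsi n := schwartz_measurable (spsi n).
have mB n := measurable_funB (mphi n) (L2_measurable Lf').
have mB' n := measurable_funB (mpsi n) (L2_measurable Lf).
have cn : 0 < `|c| by rewrite normr_gt0.
have conv : (fun n => L2norm (Op_error p (psi n) g)) @ \oo --> 0%E.
  apply: H => //; apply/L2norm_cvg0P => // e e0.
  have := (L2norm_cvg0P mB).1 phif (`|c| * e) (mulr_gt0 cn e0).
  apply: filterS => n [L h].
  have ae : {ae mu, forall x, psi n x - f x = c^-1 * (phi n x - f' x)}.
    by apply: aeS ff' => x ->; rewrite /psi; field.
  have Lc := L2Z c^-1 L.
  have mc := L2_measurable Lc.
  have E := norm2_ae (mB' n) mc ae.
  split; last by rewrite /= E norm2Z// normfV ler_pdivrMl.
  apply: L2_fin => //.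
  have : L2norm (psi n \- f) = L2norm (fun x => c^-1 * (phi n x - f' x)).
    rewrite !L2norm_poweR; congr poweR.
    apply: (ae_eq_integral (mu := mu)) => //.
    - by apply/measurable_EFinP; exact: (measurable_funX _ (mB' n)).
    - by apply/measurable_EFinP; exact: (measurable_funX _ mc).
    - by apply: aeS ae => x /= -> _.
  by move=> ->; rewrite L2normE// ltry.
have mE n := measurable_Op_error mp (mpsi n) (L2_measurable Lg).
have mE' n := measurable_Op_error mp (mphi n) (L2_measurable (L2Z c Lg)).
have EE n : Op_error p (phi n) (fun x => c * g x) = (fun x => `|c| * Op_error p (psi n) g x).
  apply/funext => x; rewrite !Op_errorE// -cabsZ /=; congr (cabs (Complex _ _)).
    by rewrite /psi (Op_reZ mp (mphi n)); field.
  by rewrite /psi (Op_imZ mp (mphi n)); field.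
apply/L2norm_cvg0P => // e e0.
have := (L2norm_cvg0P mE).1 conv (`|c|^-1 * e) (mulr_gt0 _ e0); rewrite invr_gt0 => /(_ cn).
apply: filterS => n [L h]; rewrite -/(Op_error p (phi n) (fun x => c * g x)) EE.
split; first exact: L2Z.
by rewrite norm2Z// normr_id -ler_pdivlMl.
Qed.

End Extension.

(** * The L^2 bound *)

Section OperatorBounds.
Context {R : realType}.
Local Notation mu := (@lebesgue_measure R).
Local Open Scope classical_set_scope.
Implicit Types (f g h phi u v : R -> R) (p q : R -> R -> R).

Lemma ler_add_mul_small (X Y C : R) : 0 <= C ->
  (forall e, 0 < e -> e <= 1 -> X <= Y + C * e) -> X <= Y.
Proof.
move=> C0 H; apply/ler_addgt0Pr => d d0.
have C1 : 0 < C + 1 by lra.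
pose e := Num.min 1 (d / (C + 1)).
have e0 : 0 < e by rewrite lt_min ltr01 divr_gt0.
apply: (le_trans (H e e0 _)); first by rewrite ge_min lexx.
rewrite lerD2l; apply: (@le_trans _ _ (C * (d / (C + 1)))).
  by rewrite ler_wpM2l// ge_min lexx orbT.
by rewrite mulrCA ler_piMr ?(ltW d0)// ler_pdivrMr// mul1r; lra.
Qed.

Lemma test_function_L2 v r : smooth v -> supported v r -> L2 v.
Proof.
move=> sv vr; have [K _ hK] := continuous_supported_bounded (smooth_cvg sv) vr.
exact: bounded_supported_L2 (smooth_measurable sv) hK vr.
Qed.

Section Bounded.
Variables (q : R -> R -> R) (M : R).
Hypothesis q_le : forall a b, (a <= 1)%N -> (b <= 1)%N -> weakly_bounded a b q M.

Let M0 : 0 <= M.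
Proof.
by have := le_trans (normr_ge0 _) (coef_bound q_le (ltn0Sn 0) 0 0); rewrite pmulr_rge0.
Qed.

Let mq : measurable_fun setT (fun z : R * R => q z.1 z.2).
Proof. exact: (weakly_bounded_box q_le).1. Qed.

(* [10692 = 9 * 18 * 66]: [66] comes from the discrete estimate, [18] from the bound [9 * M] on
   the coefficients times a Lipschitz cutoff, and [9 = 1 + 8] from the choice of [t]. *)
Let B : R := 10692 * M.
Let B0 : 0 <= B. Proof. by apply: mulr_ge0 M0; exact: ler0n. Qed.

Lemma Op_re_weak_bound u v r s : smooth u -> supported u r -> smooth v -> supported v s ->
  mu.-integrable setT (EFin \o (fun x => v x * Op_re q u x)) /\
  `|Rintegral mu setT (fun x => v x * Op_re q u x)| <= B * (norm2 v * norm2 u).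
Proof.
move=> su ur sv vs.
have [Ku Ku0 [uK u_lip]] := smooth_supported_lip su ur.
have [Kv Kv0 [vK v_lip]] := smooth_supported_lip sv vs.
pose t := `|r| + `|s|; pose K := Ku + Kv.
have t0 : 0 <= t by rewrite addr_ge0.
have K0 : 0 <= K by rewrite addr_ge0.
have ut : supported u t.
  by move=> x tx; apply: ur; have := ler_norm r; have := normr_ge0 s; rewrite /t in tx; lra.
have vt : supported v t.
  by move=> x tx; apply: vs; have := ler_norm s; have := normr_ge0 r; rewrite /t in tx; lra.
have uK' x : `|u x| <= K by apply: le_trans (uK x) _; rewrite lerDl.
have vK' x : `|v x| <= K by apply: le_trans (vK x) _; rewrite lerDr.
have u_lip' : lip u K by move=> x y; apply: le_trans (u_lip x y) _; rewrite ler_wpM2r// lerDl.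
have v_lip' : lip v K by move=> x y; apply: le_trans (v_lip x y) _; rewrite ler_wpM2r// lerDr.
have -> : (fun x => v x * Op_re q u x) =
    (fun x => v x * Rintegral mu setT (fun xi => q x xi * kernel u x xi)).
  by apply/funext => x; rewrite (Op_re_kernel _ _ su ur).
have W := weak_bound q_le t0 K0 uK' u_lip' ut vK' v_lip' vt su.
split; first exact: (W _ ltr01).1.
set a := norm2 u; set b := norm2 v; have a0 : 0 <= a := norm2_ge0 u; have b0 : 0 <= b := norm2_ge0 v.
apply: (@ler_add_mul_small _ _ (B * (a + b + 1))) => [|e e0 e1]; first by rewrite mulr_ge0// !addr_ge0.
have ae : 0 < a + e by lra.
have be : 0 < b + e by lra.
(* The weight [t = (a + e) / (b + e)] balances the two squares; [e] is there because [a] or [b] may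
   vanish. The two terms are then at most [1] and [8] times [(a + e) * (b + e)]. *)
apply: (le_trans (W _ (divr_gt0 ae be)).2); rewrite -!norm2_sqr -/a -/b.
apply: (@le_trans _ _ (B * ((a + e) * (b + e)))); last first.
  have -> : B * (b * a) + B * (a + b + 1) * e = B * (b * a + (a + b + 1) * e) by ring.
  by rewrite ler_wpM2l//; nra.
have -> : B * ((a + e) * (b + e)) = 1188 * M * (9 * ((a + e) * (b + e))) by rewrite /B; ring.
apply: ler_wpM2l; first by apply: mulr_ge0 M0; exact: ler0n.
have h1 : (a + e) / (b + e) * b ^+ 2 <= (a + e) * (b + e).
  by rewrite mulrAC -mulrA ler_pM2l// ler_pdivrMr//; nra.
have h2 : a ^+ 2 / ((a + e) / (b + e)) <= (a + e) * (b + e).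
  rewrite ler_pdivrMr ?divr_gt0//.
  have -> : (a + e) * (b + e) * ((a + e) / (b + e)) = (a + e) ^+ 2 by field; rewrite gt_eqF.
  by rewrite lerXn2r ?nnegrE//; lra.
have -> : 8 * a ^+ 2 / ((a + e) / (b + e)) = 8 * (a ^+ 2 / ((a + e) / (b + e))) by rewrite mulrA.
by move: h1 h2; set P := (a + e) * (b + e); lra.
Qed.

(** By duality: approximating [f] gives the bound of the pairing of [g] with a test function [v],
    and letting [v] tend to [g] itself gives [|g| ^ 2 <= B * |g| * |f|]. *)
Lemma is_Op_at_bound f g : L2 f -> is_Op_at q f g -> norm2 g <= B * norm2 f.
Proof.
move=> Lf Hg; have Lg := Hg.1.
have [phi [sphi rphi Lphi phif]] := test_sequence Lf.
set a := norm2 f; set b := norm2 g; have a0 : 0 <= a := norm2_ge0 f; have b0 : 0 <= b := norm2_ge0 g.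
have weak v s : smooth v -> supported v s ->
    `|Rintegral mu setT (fun x => v x * g x)| <= B * (norm2 v * a).
  move=> sv vs; have Lv := test_function_L2 sv vs; have v0 := norm2_ge0 v.
  apply: (@ler_add_mul_small _ _ (B * norm2 v + norm2 v)) => [|e e0 _].
    by rewrite addr_ge0// mulr_ge0.
  have n1 := is_Op_at_test mq Hg sphi rphi Lphi phif e0.
  have [n [[Ln hn] fn]] := filter_ex (filterI n1 (phif e e0)).
  have [r hr] := rphi n; have [iW W] := Op_re_weak_bound (sphi n) hr sv vs.
  have -> : (fun x => v x * g x) = (fun x => v x * Op_re q (phi n) x - v x * (Op_re q (phi n) x - g x)).
    by apply/funext => x; ring.
  rewrite RintegralB//; last exact: L2M.
  apply: le_trans (ler_normB _ _) _.
  have N1 : norm2 (phi n) <= a + e.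
    have -> : phi n = (fun x => f x + (phi n x - f x)) by apply/funext => x; ring.
    by apply: le_trans (norm2D Lf (Lphi n)) _; rewrite lerD2l.
  have C := le_trans (cauchy_schwarz Lv Ln) (ler_wpM2l v0 hn).
  apply: le_trans (lerD W C) _.
  have : B * (norm2 v * norm2 (phi n)) <= B * (norm2 v * (a + e)) by rewrite !ler_wpM2l.
  by move/(lerD (lexx (norm2 v * e))); rewrite addrC => /le_trans; apply; rewrite le_eqVlt; apply/orP; left; apply/eqP; ring.
have key : b ^+ 2 <= B * (b * a).
  have [w [sw rw Lw wg]] := test_sequence Lg.
  apply: (@ler_add_mul_small _ _ (B * a + b)) => [|e e0 _]; first by rewrite addr_ge0// mulr_ge0.
  have [n hn] := filter_ex (wg e e0); have [s ws] := rw n.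
  rewrite /b norm2_sqr.
  have Lwn := test_function_L2 (sw n) ws.
  have -> : (fun x => g x ^+ 2) = (fun x => w n x * g x - (w n x - g x) * g x).
    by apply/funext => x; ring.
  rewrite RintegralB; [|by []|exact: L2M|exact: L2M].
  apply: le_trans (ler_norm _) _; apply: le_trans (ler_normB _ _) _.
  have N1 : norm2 (w n) <= b + e.
    have -> : w n = (fun x => g x + (w n x - g x)) by apply/funext => x; ring.
    by apply: le_trans (norm2D Lg (Lw n)) _; rewrite lerD2l.
  have C := le_trans (cauchy_schwarz (Lw n) Lg) (ler_wpM2r b0 hn).
  apply: le_trans (lerD (weak _ _ (sw n) ws) C) _.
  have : B * (norm2 (w n) * a) <= B * ((b + e) * a) by rewrite ler_wpM2l// ler_wpM2r.
  by move/(lerD (lexx (e * b))); rewrite addrC => /le_trans; apply; rewrite le_eqVlt; apply/orP; left; apply/eqP; rewrite -/b; ring.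
have [->|bn0] := eqVneq b 0; first exact: mulr_ge0.
have bp : 0 < b by rewrite lt_neqAle eq_sym bn0.
by move: key; rewrite expr2 mulrCA ler_pM2l.
Qed.

End Bounded.

Lemma symbol_norm_ge0 (a b : nat) q : (0 <= symbol_norm a b q)%E.
Proof.
apply: (@le_trans _ _ (weak_deriv_sup 0 0 q)).
  by apply/ereal_infP => _ [g _ <-]; exact: Lnorm_ge0.
by apply: ereal_sup_ubound; exists (0%N, 0%N).
Qed.

Lemma Op_L2 p f : L2 (Op p f).
Proof.
have [ex|nex] := pselect (exists g, is_Op_at p f g); first by case: (xgetPex (fun=> 0) ex).
by rewrite /Op xgetPN; [exact: L2_0|move=> g hg; apply: nex; exists g].
Qed.

Lemma norm2_0 : norm2 (fun=> 0 : R) = 0.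
Proof. by rewrite /norm2; under eq_Rintegral do rewrite expr0n/=; rewrite Rintegral_cst// mul0r sqrtr0. Qed.

(** [weakly_bounded] is available for constants strictly above the norm, whence [s + e] with [e]
    tending to [0]. If the extension does not exist at [f], the default value [0] satisfies the
    bound. *)
Lemma Op_bound q f (s : R) : symbol_norm 1 1 q = s%:E -> L2 f -> norm2 (Op q f) <= 10692 * s * norm2 f.
Proof.
move=> qs Lf; have s0 : 0 <= s by rewrite -lee_fin -qs symbol_norm_ge0.
have f0 := norm2_ge0 f.
have [ex|nex] := pselect (exists g, is_Op_at q f g); last first.
  rewrite /Op xgetPN; last by move=> g hg; apply: nex; exists g.
  by rewrite norm2_0; exact: mulr_ge0 (mulr_ge0 (ler0n _ _) s0) f0.
have Hf := xgetPex (fun=> 0) ex; rewrite -/(Op q f) in Hf.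
apply: (@ler_add_mul_small _ _ (10692 * norm2 f)) => [|e e0 _]; first exact: mulr_ge0 (ler0n _ _) f0.
have q_le a b : (a <= 1)%N -> (b <= 1)%N -> weakly_bounded a b q (s + e).
  by apply: symbol_norm_weakly_bounded; rewrite qs lte_fin ltrDl.
have -> : 10692 * s * norm2 f + 10692 * norm2 f * e = 10692 * (s + e) * norm2 f by ring.
by have := is_Op_at_bound q_le Lf Hf.
Qed.

Lemma ae_scale_inv f f' (c : R) : c != 0 -> {ae mu, forall x, f' x = c * f x} ->
  {ae mu, forall x, f x = c^-1 * f' x}.
Proof. by move=> c0; apply: aeS => x ->; rewrite mulKf. Qed.

(* Functions are not quotiented by a.e. equality, and [Op p f] is chosen separately for each
   [f]; normalising [f] inside [opnorm] needs this weak homogeneity. *)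
Lemma Op_homogeneous p f f' (c : R) : measurable_fun setT (fun z : R * R => p z.1 z.2) ->
  c != 0 -> L2 f -> L2 f' -> {ae mu, forall x, f' x = c * f x} ->
  {ae mu, forall x, Op p f' x = c * Op p f x}.
Proof.
move=> mp c0 Lf Lf' ff'.
have [ex|nex] := pselect (exists g, is_Op_at p f g).
  have Hf := is_Op_at_homogeneous mp c0 Lf Lf' ff' (xgetPex (fun=> 0) ex).
  have ex' : exists g, is_Op_at p f' g by exists (fun x => c * Op p f x).
  exact: is_Op_at_unique mp Lf' (xgetPex (fun=> 0) ex') Hf.
have nex' g : ~ is_Op_at p f' g.
  move=> hg; apply: nex; exists (fun x => c^-1 * g x).
  by apply: is_Op_at_homogeneous hg => //; [rewrite invr_eq0|exact: ae_scale_inv].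
have nex1 g : ~ is_Op_at p f g by move=> hg; apply: nex; exists g.
by rewrite /Op !xgetPN//; apply: aeW => x; rewrite mulr0.
Qed.

(** * Adjoints and operator norms *)

Section Adjoint.
Variable T : (R -> R) -> R -> R.
Hypothesis TL2 : forall f, L2 f -> L2 (T f).

Lemma adjoint_L2 f : L2 (adjoint T f).
Proof.
have [ex|nex] := pselect (exists g, is_adjoint_at T f g); first by case: (xgetPex (fun=> 0) ex).
by rewrite /adjoint xgetPN; [exact: L2_0|move=> g hg; apply: nex; exists g].
Qed.

Lemma is_adjoint_at_homogeneous f f' g (c : R) : L2 f -> L2 f' ->
  {ae mu, forall x, f' x = c * f x} -> is_adjoint_at T f g -> is_adjoint_at T f' (fun x => c * g x).
Proof.
move=> Lf Lf' ff' [Lg H]; split=> [|h Lh]; first exact: L2Z.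
have LT := TL2 Lh.
have m1 := measurable_funM (L2_measurable Lf') (L2_measurable LT).
have m2 := measurable_funM (L2_measurable (L2Z c Lf)) (L2_measurable LT).
have -> : Rintegral mu setT (fun x => f' x * T h x) = Rintegral mu setT (fun x => c * f x * T h x).
  by apply: (Rintegral_ae m1 m2); apply: aeS ff' => x /= ->.
under eq_Rintegral do rewrite -mulrA.
under [RHS]eq_Rintegral do rewrite -mulrA.
by rewrite !RintegralZl ?H//; exact: L2M.
Qed.

Lemma is_adjoint_at_unique f g1 g2 : is_adjoint_at T f g1 -> is_adjoint_at T f g2 ->
  {ae mu, forall x, g1 x = g2 x}.
Proof.
move=> [L1 H1] [L2' H2]; have Lg := L2B L1 L2'.
suff : norm2 (fun x => g1 x - g2 x) = 0.
  by move/(norm2_eq0 Lg); apply: aeS => x /eqP; rewrite subr_eq0 => /eqP.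
apply/eqP; rewrite -sqrf_eq0 norm2_sqr.
have -> : (fun x => (g1 x - g2 x) ^+ 2) = (fun x => g1 x * (g1 x - g2 x) - g2 x * (g1 x - g2 x)).
  by apply/funext => x; ring.
by rewrite RintegralB ?H1 ?H2 ?subrr//; exact: L2M.
Qed.

Lemma adjoint_homogeneous f f' (c : R) : c != 0 -> L2 f -> L2 f' ->
  {ae mu, forall x, f' x = c * f x} -> {ae mu, forall x, adjoint T f' x = c * adjoint T f x}.
Proof.
move=> c0 Lf Lf' ff'.
have [ex|nex] := pselect (exists g, is_adjoint_at T f g).
  have Hf := is_adjoint_at_homogeneous Lf Lf' ff' (xgetPex (fun=> 0) ex).
  have ex' : exists g, is_adjoint_at T f' g by exists (fun x => c * adjoint T f x).
  exact: is_adjoint_at_unique (xgetPex (fun=> 0) ex') Hf.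
have nex' g : ~ is_adjoint_at T f' g.
  move=> hg; apply: nex; exists (fun x => c^-1 * g x).
  exact: is_adjoint_at_homogeneous Lf' Lf (ae_scale_inv c0 ff') hg.
have nex1 g : ~ is_adjoint_at T f g by move=> hg; apply: nex; exists g.
by rewrite /adjoint !xgetPN//; apply: aeW => x; rewrite mulr0.
Qed.

(** Stated as a quotient with [f] of positive norm, because [opnorm T] may be infinite and a product
    with a zero norm would then say nothing. *)
Lemma le_opnorm f : (forall f f' (c : R), c != 0 -> L2 f -> L2 f' ->
    {ae mu, forall x, f' x = c * f x} -> {ae mu, forall x, T f' x = c * T f x}) ->
  L2 f -> 0 < norm2 f -> ((norm2 (T f) / norm2 f)%:E <= opnorm T)%E.
Proof.
move=> hom Lf f0; pose f' x := (norm2 f)^-1 * f x.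
have Lf' : L2 f' by exact: L2Z.
have c0 : (norm2 f)^-1 != 0 by rewrite invr_eq0 gt_eqF.
have ae : {ae mu, forall x, f' x = (norm2 f)^-1 * f x} by exact: aeW.
have E := norm2_ae (L2_measurable (TL2 Lf')) (L2_measurable (L2Z _ (TL2 Lf))) (hom _ _ _ c0 Lf Lf' ae).
have -> : (norm2 (T f) / norm2 f)%:E = L2norm (T f').
  rewrite L2normE; last exact: TL2.
  by rewrite E norm2Z ?gtr0_norm ?invr_gt0 1?mulrC//; exact: TL2.
apply: ereal_sup_ubound; exists f' => //; split=> //.
by rewrite L2normE// lee_fin norm2Z// gtr0_norm ?invr_gt0// mulVf// gt_eqF.
Qed.

End Adjoint.

End OperatorBounds.

(** * The Gårding inequality *)

Local Open Scope classical_set_scope.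
Local Open Scope ring_scope.

Theorem lemma5p5 (R : realType) :
  exists2 C : R, 0 < C &
  forall p : R -> R -> R,
    (forall x xi, 0 <= p x xi) ->
    (forall x xi, p x (- xi) = p x xi) ->
    let q : R -> R -> R := fun x xi => Num.sqrt (p x xi) in
    symbol_class 1 1 q ->
    symbol_class 2 0 q ->
    (exists2 eps : R, 0 < eps & mixed_deriv_sobolev eps q) ->
    forall f : R -> R, L2 f ->
      ((- Rintegral lebesgue_measure setT (fun x => f x * Op p f x))%:E <=
       C%:E * (opnorm (compdefect q q)
               + symbol_norm 1 1 q * opnorm (op_skew (Op q)))
       * (L2norm f * L2norm f))%E.
Proof.
(* [C] is taken at least [1] because the term of the composition defect comes with constant [1] and
   has to fit under the same [C]. *)
have [C C1 C_bound] : exists2 C : R, 1 <= C & forall q f s, symbol_norm 1 1 q = s%:E ->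
    L2 f -> norm2 (Op q f) <= C * s * norm2 f.
  by exists 10692; [rewrite ler1n|exact: Op_bound].
have C0 : 0 <= C := le_trans ler01 C1.
exists C; first exact: lt_le_trans ltr01 C1.
move=> p p0 _ q q11 _ _ f Lf.
have [s qs s0] : exists2 s : R, symbol_norm 1 1 q = s%:E & 0 <= s.
  have n0 := symbol_norm_ge0 1 1 q; exists (fine (symbol_norm 1 1 q)); last exact: fine_ge0.
  by rewrite fineK// ge0_fin_numE.
have mq : measurable_fun setT (fun z : R * R => q z.1 z.2).
  have q_le a b : (a <= 1)%N -> (b <= 1)%N -> weakly_bounded a b q (s + 1).
    by apply: symbol_norm_weakly_bounded; rewrite qs lte_fin ltrDl.
  exact: (weakly_bounded_box q_le).1.
have qqp : (fun y xi => q y xi * q y xi) = p.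
  by apply/funext => y; apply/funext => xi; rewrite -expr2 sqr_sqrtr.
have mp : measurable_fun setT (fun z : R * R => p z.1 z.2).
  have -> : (fun z : R * R => p z.1 z.2) = (fun z => q z.1 z.2 * q z.1 z.2).
    by apply/funext => z; rewrite -expr2 sqr_sqrtr.
  exact: (measurable_funM mq mq).
pose Q := Op q; pose D := compdefect q q; pose S := op_skew Q.
have DE g x : D g x = Q (Q g) x - Op p g x by rewrite /D /compdefect qqp.
have SE g x : S g x = Q g x - adjoint Q g x by [].
have QL2 g : L2 g -> L2 (Q g) by move=> _; exact: Op_L2.
have Q_hom (g g' : R -> R) (c : R) : c != 0 -> L2 g -> L2 g' ->
    {ae lebesgue_measure, forall x, g' x = c * g x} ->
    {ae lebesgue_measure, forall x, Q g' x = c * Q g x} by exact: Op_homogeneous.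
have DL2 g : L2 g -> L2 (D g) by move=> _; apply: L2B; exact: Op_L2.
have SL2 g : L2 g -> L2 (S g) by move=> Lg; apply: L2B; [exact: Op_L2|exact: adjoint_L2].
have D_hom (g g' : R -> R) (c : R) : c != 0 -> L2 g -> L2 g' ->
    {ae lebesgue_measure, forall x, g' x = c * g x} ->
    {ae lebesgue_measure, forall x, D g' x = c * D g x}.
  move=> c0 Lg Lg' gg'; have h1 := Q_hom _ _ _ c0 Lg Lg' gg'.
  have h2 := Q_hom _ _ _ c0 (QL2 _ Lg) (QL2 _ Lg') h1.
  have h3 := Op_homogeneous mp c0 Lg Lg' gg'.
  by apply: aeS2 h2 h3 => x; rewrite !DE mulrBr => -> ->.
have S_hom (g g' : R -> R) (c : R) : c != 0 -> L2 g -> L2 g' ->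
    {ae lebesgue_measure, forall x, g' x = c * g x} ->
    {ae lebesgue_measure, forall x, S g' x = c * S g x}.
  move=> c0 Lg Lg' gg'; have h1 := Q_hom _ _ _ c0 Lg Lg' gg'.
  have h2 := adjoint_homogeneous QL2 c0 Lg Lg' gg'.
  by apply: aeS2 h1 h2 => x; rewrite !SE mulrBr => -> ->.
set a := norm2 f; have a0 : 0 <= a := norm2_ge0 f.
set I := Rintegral _ _ _.
have bQ g : L2 g -> norm2 (Q g) <= C * s * norm2 g by exact: C_bound.
have bD : I >= Rintegral lebesgue_measure setT (fun x => f x * Q (Q f) x) - a * norm2 (D f).
  have -> : I = Rintegral lebesgue_measure setT (fun x => f x * Q (Q f) x - f x * D f x).
    by apply: eq_Rintegral => x _; rewrite DE; ring.
  rewrite RintegralB//; [|exact: L2M (QL2 _ (QL2 _ Lf))|exact: L2M (DL2 _ Lf)].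
  rewrite lerD2l lerN2; apply: le_trans (ler_norm _) _.
  exact: cauchy_schwarz Lf (DL2 _ Lf).
have bS : - Rintegral lebesgue_measure setT (fun x => f x * Q (Q f) x) <=
    C * s * a * norm2 (S f).
  have LQ := QL2 _ Lf.
  have [ex|nex] := pselect (exists h, is_adjoint_at Q f h).
    have [Lh H] := xgetPex (fun=> 0) ex; rewrite -/(adjoint Q f) in Lh H.
    rewrite -H//.
    have -> : (fun x => adjoint Q f x * Q f x) = (fun x => Q f x ^+ 2 - S f x * Q f x).
      by apply/funext => x; rewrite SE; ring.
    rewrite RintegralB//; [|exact: ((L2P _).1 LQ).2|exact: L2M (SL2 _ Lf) LQ].
    rewrite opprB; apply: (@le_trans _ _ (Rintegral lebesgue_measure setT (fun x => S f x * Q f x))).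
      by rewrite gerBl Rintegral_sqr_ge0.
    apply: le_trans (ler_norm _) _; apply: le_trans (cauchy_schwarz (SL2 _ Lf) LQ) _.
    by rewrite mulrC ler_wpM2r ?norm2_ge0 ?bQ.
  (* Without an adjoint at [f], [adjoint Q f] is the junk value [0]. *)
  have -> : S f = Q f.
    apply/funext => x; rewrite SE /adjoint xgetPN ?subr0// => h hh.
    by apply: nex; exists h.
  apply: le_trans (ler_norm _) _; rewrite normrN; apply: le_trans (cauchy_schwarz Lf (QL2 _ LQ)) _.
  by rewrite -/a [C * s * a]mulrC -mulrA ler_wpM2l ?bQ.
have main : - I <= a * norm2 (D f) + C * s * a * norm2 (S f).
  by move: bD; rewrite -lerN2 opprB => /le_trans; apply; rewrite lerD2l.
rewrite L2normE// -/a -EFinM.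
(* For [a = 0] the right-hand side is [0] even if an operator norm is infinite, by the convention
   for products with [0]; the quotients by [a] below need the other case. *)
have [az|an] := eqVneq a 0.
  rewrite az mulr0 mule0 lee_fin; apply: le_trans main _.
  by rewrite az mul0r mulr0 mul0r addr0.
have ap : 0 < a by rewrite lt_neqAle eq_sym an.
have oD := le_opnorm DL2 D_hom Lf ap; have oS := le_opnorm SL2 S_hom Lf ap.
rewrite -/a in oD oS; set x1 := norm2 (D f) / a in oD; set x2 := norm2 (S f) / a in oS.
have x10 : 0 <= x1 by rewrite divr_ge0 ?norm2_ge0.
have x20 : 0 <= x2 by rewrite divr_ge0 ?norm2_ge0.
apply: (@le_trans _ _ (C%:E * (x1%:E + s%:E * x2%:E) * (a * a)%:E)%E); last first.
  apply: lee_wpmul2r; first by rewrite lee_fin mulr_ge0.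
  apply: lee_wpmul2l; first by rewrite lee_fin.
  apply: leeD => //; rewrite qs; apply: lee_wpmul2l => //.
have -> : (C%:E * (x1%:E + s%:E * x2%:E) * (a * a)%:E =
    (C * (x1 + s * x2) * (a * a))%:E)%E by rewrite !EFinM EFinD EFinM.
rewrite lee_fin.
have -> : C * (x1 + s * x2) * (a * a) = C * (a * norm2 (D f)) + C * s * a * norm2 (S f).
  by rewrite /x1 /x2; field.
have aD : 0 <= a * norm2 (D f) by rewrite mulr_ge0 ?norm2_ge0.
by apply: le_trans main _; rewrite lerD2r ler_peMl.
Qed.
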